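(* Let $N>1$ and let $\mathcal H$ denote either the Hardy space $H^2(B_N)$ or a weighted Bergman space $A^2_\alpha(B_N)$ with $\alpha>-1$. If $\varphi$ and $\psi$ are linear-fractional self-maps of $B_N$ with $C_\varphi-C_\psi$ compact on $\mathcal H$, then either $\varphi=\psi$, or $\|\varphi\|_\infty<1$ and $\|\psi\|_\infty<1$ (so that $C_\varphi$ and $C_\psi$ are compact on $\mathcal H$).
   Context: $B_N$ is the open unit ball of $\mathbb C^N$ with the standard inner product $\langle z,w\rangle=\sum z_j\overline{w_j}$; $\sigma$ is normalized surface measure on $\partial B_N$ and $\nu$ normalized volume measure on $B_N$. $H^2(B_N)$ is the space of analytic $f$ on $B_N$ with $\|f\|^2=\sup_{0<r<1}\int_{\partial B_N}|f(r\zeta)|^2d\sigma(\zeta)<\infty$. For $\alpha>-1$, $A^2_\alpha(B_N)$ is the space of analytic $f$ on $B_N$ with $\|f\|_\alpha^2=\int_{B_N}|f(z)|^2 w_\alpha(z)\,d\nu(z)<\infty$, where $w_\alpha(z)=\frac{\Gamma(N+\alpha+1)}{\Gamma(N+1)\Gamma(\alpha+1)}(1-|z|^2)^\alpha$. A linear-fractional self-map of $B_N$ is a map of the form $\varphi(z)=\frac{Az+B}{\langle z,C\rangle+d}$ ($A$ an $N\times N$ complex matrix, $B,C\in\mathbb C^N$, $d\in\mathbb C$) which is analytic on $B_N$ and maps $B_N$ into $B_N$; such maps are analytic on a neighborhood of $\overline{B_N}$ and induce bounded composition operators $C_\varphi f=f\circ\varphi$ on $\mathcal H$. $\|\varphi\|_\infty=\sup_{z\in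 B_N}|\varphi(z)|$. *)

(* Defs.v *)
From HB Require Import structures.
From mathcomp Require Import all_boot all_order all_algebra.
From mathcomp Require Import all_classical all_reals all_analysis.
From mathcomp Require Import complex.

Set Implicit Arguments.
Unset Strict Implicit.
Unset Printing Implicit Defensive.

Import Order.TTheory GRing.Theory Num.Theory.
Import numFieldNormedType.Exports.
Local Open Scope classical_set_scope.
Local Open Scope ring_scope.

Section Defs.
Variable R : realType.
Variable N : nat.

Definition cre (z : R[i]) : R := let: Complex a _ := z in a.
Definition cim (z : R[i]) : R := let: Complex _ b := z in b.
Definition cabs (z : R[i]) : R := Num.sqrt (cre z ^+ 2 + cim z ^+ 2).
Definition cconj (z : R[i]) : R[i] := Complex (cre z) (- cim z).
Definition rC (r : R) : R[i] := Complex r 0.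

Definition inner (z w : 'I_N -> R[i]) : R[i] := \sum_(j < N) z j * cconj (w j).
Definition vnorm (z : 'I_N -> R[i]) : R := Num.sqrt (\sum_(j < N) cabs (z j) ^+ 2).
Definition inball (z : 'I_N -> R[i]) : Prop := vnorm z < 1.

Definition analytic_on_ball (f : ('I_N -> R[i]) -> R[i]) : Prop :=
  forall z, inball z -> exists L : 'I_N -> R[i],
    forall eps : R, 0 < eps -> exists2 delta : R, 0 < delta &
      forall h : 'I_N -> R[i], vnorm h < delta -> inball (fun j => z j + h j) ->
        cabs (f (fun j => z j + h j) - f z - \sum_(j < N) L j * h j) <= eps * vnorm h.

(** Lebesgue integral on R^n (coordinates x : nat -> R, first n used) of a
    nonnegative function, as an iterated Lebesgue integral (Tonelli). *)
Fixpoint iint (n : nat) (F : (nat -> R) -> \bar R) : \bar R :=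
  match n with
  | 0%N => F (fun _ => 0)
  | n'.+1 => (\int[@lebesgue_measure R]_t
                iint n' (fun x => F (fun k => if k == n' then t else x k)))%E
  end.

Definition z_of (x : nat -> R) : 'I_N -> R[i] :=
  fun j => Complex (x (2 * j)%N) (x (2 * j).+1).

Definition nu_int (g : ('I_N -> R[i]) -> \bar R) : \bar R :=
  (iint (2 * N) (fun x => if `[< inball (z_of x) >] then g (z_of x) else 0%E) *
   ((fine (iint (2 * N) (fun x => if `[< inball (z_of x) >] then 1%E else 0%E)))^-1)%:E)%E.

(** integral against normalized surface measure sigma on the sphere, via the
    polar-coordinates identity  int_S g dsigma = int_B g(z/|z|) dnu(z). *)
Definition sigma_int (g : ('I_N -> R[i]) -> \bar R) : \bar R :=
  nu_int (fun z => g (fun j => z j * rC (vnorm z)^-1)).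

Definition Gamma (x : R) : R :=
  fine (\int[@lebesgue_measure R]_(t in [set t : R | (0 < t)%R]) ((powR t (x - 1) * expR (- t))%R)%:E)%E.

Definition bergman_weight (a : R) (z : 'I_N -> R[i]) : R :=
  Gamma (N%:R + a + 1) / (Gamma (N%:R + 1) * Gamma (a + 1)) * powR (1 - vnorm z ^+ 2) a.

Inductive fspace := Hardy | Bergman of R.

Definition admissible (H : fspace) : Prop :=
  match H with Hardy => True | Bergman a => -1 < a end.

Definition norm2 (H : fspace) (f : ('I_N -> R[i]) -> R[i]) : \bar R :=
  match H with
  | Hardy => ereal_sup [set sigma_int (fun zeta => ((cabs (f (fun j => rC r * zeta j))) ^+ 2)%:E)
                       | r in `]0, 1[%classic]
  | Bergman a => nu_int (fun z => ((cabs (f z)) ^+ 2 * bergman_weight a z)%:E)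
  end.

Definition memH (H : fspace) (f : ('I_N -> R[i]) -> R[i]) : Prop :=
  analytic_on_ball f /\ (norm2 H f < +oo)%E.

Definition compact_op (H : fspace)
    (T : (('I_N -> R[i]) -> R[i]) -> (('I_N -> R[i]) -> R[i])) : Prop :=
  forall fs : nat -> ('I_N -> R[i]) -> R[i],
    (forall n, memH H (fs n) /\ (norm2 H (fs n) <= 1)%E) ->
    exists (s : nat -> nat) (g : ('I_N -> R[i]) -> R[i]),
      [/\ {homo s : m n / (m < n)%N >-> (m < n)%N}, memH H g &
          (fun k => norm2 H (fun z => T (fs (s k)) z - g z)) @ \oo --> (0 : \bar R)%E].

Definition lfmap (A : 'M[R[i]]_N) (B C : 'I_N -> R[i]) (d : R[i])
    (z : 'I_N -> R[i]) : 'I_N -> R[i] :=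
  fun i => (\sum_(j < N) A i j * z j + B i) / (inner z C + d).

Definition lf_selfmap (A : 'M[R[i]]_N) (B C : 'I_N -> R[i]) (d : R[i]) : Prop :=
  (forall z, inball z -> inner z C + d != 0) /\
  (forall z, inball z -> inball (lfmap A B C d z)).

Definition Cop (phi : ('I_N -> R[i]) -> ('I_N -> R[i]))
    (f : ('I_N -> R[i]) -> R[i]) : ('I_N -> R[i]) -> R[i] := fun z => f (phi z).

Definition supnorm (phi : ('I_N -> R[i]) -> ('I_N -> R[i])) : \bar R :=
  ereal_sup [set (vnorm (phi z))%:E | z in inball].

End Defs.

(* Main.v *)
(* If K_a^m(z) = (1 - <z, a>)^-m is suitably normalized, it tends to 0 on
   compact sets as a approaches the sphere while its norm stays bounded, so
   compactness of C_phi - C_psi makes (C_phi - C_psi) K_a^m small in norm.  The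
   norm dominates a local mean over a nonisotropic box around any point w, so
   (1 - |w|^2)^s (1 - |a|^2)^(2m - s) |K_a^m(phi z) - K_a^m(psi z)|^2 is
   arbitrarily small at some z close to w, s being the norm exponent of the
   space.

   If sup |phi| = 1, then phi sends a boundary point zeta to a boundary point
   eta, and w -> zeta, a -> eta are chosen along curves with gap comparable to
   t^2.  The values of (1 - <phi z, a>) / t^2 and (1 - <psi z, a>) / t^2 then
   have equal limits; comparing successively the orders t^0, t^1, t^2 for all
   admissible tangent directions of the two curves gives psi(zeta) = eta, equal
   normal derivatives, and finally equal linear parts of the numerator and
   denominator at zeta, whence phi = psi. *)

(* Smallness in norm is felt only at an unknown point [z] of a shrinking box around [w], so limits
   are taken along perturbed curves: [(z - zeta) / t] is known up to [o(1)], and its component along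
   [zeta] up to [o(t)]. The order [t^2] comparison consumes exactly this, which is why the boxes are
   nonisotropic. As both gaps have order [t^2], the weight has order [t^(4m)] whatever [s] is, and
   from there on Hardy and Bergman spaces are treated alike.

   The integer exponent [m] replaces that of the reproducing kernel: no branch of a power is
   involved, and two consecutive values of [m] remove the root-of-unity ambiguity left by a single
   [m]-th power.

   Surface integrals are ball integrals of functions homogeneous of degree 0, so they can be
   evaluated on thin shells under the sphere.

   A self-map is assumed regular on the open ball only. A pole on the sphere has to be dealt with
   first; it occurs only for constant maps. *)
Require Import Defs.
From HB Require Import structures.
From mathcomp Require Import all_boot all_order all_algebra.
From mathcomp Require Import all_classical all_reals all_analysis.
From mathcomp Require Import measurable_realfun lebesgue_measure.
From mathcomp Require Import complex ring lra.
Import Order.TTheory GRing.Theory Num.Theory.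
Import numFieldNormedType.Exports.
Set Implicit Arguments.
Unset Strict Implicit.
Unset Printing Implicit Defensive.
Local Open Scope classical_set_scope.
Local Open Scope ring_scope.

(** * Tonelli for iterated Lebesgue integrals in finitely many coordinates *)

Section IteratedIntegral.
Variable R : realType.
Implicit Types (F G : (nat -> R) -> \bar R) (x : nat -> R) (n i : nat).
Local Notation mu := (@lebesgue_measure R).

Definition upd x i (t : R) : nat -> R := fun k => if k == i then t else x k.

Lemma iintS n F : iint n.+1 F = (\int[mu]_t iint n (fun x => F (upd x n t)))%E.
Proof. by []. Qed.

Lemma upd_comm x i j s t : i != j -> upd (upd x i s) j t = upd (upd x j t) i s.
Proof.
move=> ij; apply/funext => k; rewrite /upd; case: eqP => [->|//].
by rewrite eq_sym (negbTE ij).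
Qed.

Lemma upd_upd x i s t : upd (upd x i s) i t = upd x i t.
Proof. by apply/funext => k; rewrite /upd; case: eqP. Qed.

Lemma updE x i t : upd x i t i = t.
Proof. by rewrite /upd eqxx. Qed.

Lemma upd_ne x i j t : j != i -> upd x i t j = x j.
Proof. by rewrite /upd => /negbTE ->. Qed.

(* Unlike [ge0_le_integral], no measurability is required. *)
Lemma ge0_le_integral_nomeas d (T : measurableType d)
    (m : {measure set T -> \bar R}) (f g : T -> \bar R) :
  (forall t, 0 <= f t)%E -> (forall t, f t <= g t)%E ->
  (\int[m]_t f t <= \int[m]_t g t)%E.
Proof.
move=> f0 fg; rewrite !ge0_integralTE//; last first.
  by move=> x; exact: le_trans (fg x).
apply: ge_ereal_sup => _ [h hf <-]; apply: ereal_sup_ubound => /=.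
by exists h => // x; exact: le_trans (fg x).
Qed.

Lemma iint_ge0 n F : (forall x, 0 <= F x)%E -> (0 <= iint n F)%E.
Proof.
elim: n F => [|n IH] F F0; first exact: F0.
by apply: integral_ge0 => t _; exact: IH.
Qed.

Lemma iint_le n F G : (forall x, 0 <= F x)%E -> (forall x, F x <= G x)%E ->
  (iint n F <= iint n G)%E.
Proof.
elim: n F G => [|n IH] F G F0 FG; first exact: FG.
by apply: ge0_le_integral_nomeas => t; [exact: iint_ge0|exact: IH].
Qed.

(* Measurability with respect to finitely or countably many coordinates, phrased
   through arbitrary measurable curves so that no measurable structure on
   [nat -> R] is needed; [t] is an additional parameter. *)
Definition meas_at d (T : measurableType d) d' (U : sigmaRingType d')
    (F : T -> (nat -> R) -> U) : Prop :=
  forall d1 (S : measurableType d1) (tau : S -> T) (c : nat -> S -> R),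
    measurable_fun [set: S] tau -> (forall k, measurable_fun [set: S] (c k)) ->
    measurable_fun [set: S] (fun s => F (tau s) (fun k => c k s)).

Definition ymeas d' (U : sigmaRingType d') (F : (nat -> R) -> U) : Prop :=
  forall d1 (S : measurableType d1) (c : nat -> S -> R),
    (forall k, measurable_fun [set: S] (c k)) ->
    measurable_fun [set: S] (fun s => F (fun k => c k s)).

Lemma meas_at_upd d (T : measurableType d) d' (U : sigmaRingType d')
    (F : T -> (nat -> R) -> U) i :
  meas_at F ->
  @meas_at _ (T * measurableTypeR R)%type d' U
    (fun p x => F p.1 (upd x i p.2)).
Proof.
move=> mF d1 S tau c mtau mc; apply: mF => [|k].
  exact: measurableT_comp.
by rewrite /upd; case: eqP => // _; exact: measurableT_comp.
Qed.

Lemma ymeas_upd d' (U : sigmaRingType d') (F : (nat -> R) -> U) i :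
  ymeas F ->
  @meas_at _ (measurableTypeR R) d' U (fun t x => F (upd x i t)).
Proof.
move=> mF d1 S tau c mtau mc; apply: mF => k.
by rewrite /upd; case: eqP.
Qed.

(** The parameter [t] carries the induction: the outermost coordinate joins it in a product space,
    where Tonelli makes the partial integral measurable. *)
Lemma measurable_iint n d (T : measurableType d)
    (F : T -> (nat -> R) -> \bar R) :
  meas_at F -> (forall t x, 0 <= F t x)%E ->
  measurable_fun [set: T] (fun t => iint n (F t)).
Proof.
elim: n d T F => [|n IH] d T F mF F0 /=.
  by apply: (mF d T idfun (fun _ _ => 0)) => [|k]; [exact: measurable_id|exact: measurable_cst].
pose f (p : T * measurableTypeR R) := iint n (fun x => F p.1 (upd x n p.2)).
apply: (@measurable_fun_fubini_tonelli_F _ _ _ _ _ mu f).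
  exact: IH (meas_at_upd _ mF) _.
by move=> p; exact: iint_ge0.
Qed.

Lemma iint_swap n (F : measurableTypeR R -> (nat -> R) -> \bar R) :
  meas_at F -> (forall t x, 0 <= F t x)%E ->
  (\int[mu]_t iint n (F t) = iint n (fun x => \int[mu]_t F t x))%E.
Proof.
elim: n F => [//|n IH] F mF F0 /=.
pose f (p : measurableTypeR R * measurableTypeR R) :=
  iint n (fun x => F p.1 (upd x n p.2)).
rewrite (@fubini_tonelli _ _ _ _ _ mu mu f); last 2 first.
- exact: measurable_iint (meas_at_upd _ mF) _.
- by move=> p; exact: iint_ge0.
apply: eq_integral => s _; rewrite -IH//.
move=> d1 S tau c mtau mc; apply: mF => // k.
by rewrite /upd; case: eqP.
Qed.

(* Tonelli in coordinate form: any coordinate may be integrated first. *)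
Lemma iint_coord n i F G : (i < n)%N -> ymeas F -> ymeas G ->
  (forall x, 0 <= F x)%E -> (forall x, 0 <= G x)%E ->
  (forall x, \int[mu]_t F (upd x i t) = \int[mu]_t G (upd x i t))%E ->
  iint n F = iint n G.
Proof.
elim: n F G => [//|n IH] F G; rewrite ltnS leq_eqVlt => iltn mF mG F0 G0 FG.
have [ni|ni] := eqVneq i n.
  subst i; rewrite /= !(@iint_swap n (fun t x => _ (upd x n t)))//; last 2 first.
  - exact: ymeas_upd.
  - exact: ymeas_upd.
  by congr iint; apply/funext.
move: iltn; rewrite (negbTE ni) /= => iltn; apply: eq_integral => t _; apply: IH => //.
- by move=> d1 S c mc; apply: (ymeas_upd n mF (tau := cst t)).
- by move=> d1 S c mc; apply: (ymeas_upd n mG (tau := cst t)).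
- move=> x; transitivity (\int[mu]_t0 F (upd (upd x n t) i t0))%E.
    by apply: eq_integral => s _; congr F; rewrite -upd_comm.
  by rewrite FG; apply: eq_integral => s _; congr G; rewrite -upd_comm.
Qed.

Lemma iintZ n (c : R) F : 0 <= c -> ymeas F -> (forall x, 0 <= F x)%E ->
  (iint n (fun x => c%:E * F x) = c%:E * iint n F)%E.
Proof.
move=> c0; elim: n F => [//|n IH] F mF F0 /=.
rewrite -ge0_integralZl_EFin//.
- apply: eq_integral => t _; rewrite -IH//.
  by move=> d1 S k mk; apply: (ymeas_upd n mF (tau := cst t)).
- by move=> t _; exact: iint_ge0.
- apply: (@measurable_iint n _ _ (fun t x => F (upd x n t))) => //.
  exact: ymeas_upd.
Qed.

Lemma iintD n F G : ymeas F -> (forall x, 0 <= F x)%E ->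
  ymeas G -> (forall x, 0 <= G x)%E ->
  (iint n (fun x => F x + G x) = iint n F + iint n G)%E.
Proof.
elim: n F G => [//|n IH] F G mF F0 mG G0 /=.
rewrite -ge0_integralD//; last first.
- by apply: (@measurable_iint n _ _ (fun t x => G (upd x n t))) => //; exact: ymeas_upd.
- by move=> t _; exact: iint_ge0.
- by apply: (@measurable_iint n _ _ (fun t x => F (upd x n t))) => //; exact: ymeas_upd.
- by move=> t _; exact: iint_ge0.
apply: eq_integral => t _; rewrite -IH//.
- by move=> d1 S k mk; apply: (ymeas_upd n mF (tau := cst t)).
- by move=> d1 S k mk; apply: (ymeas_upd n mG (tau := cst t)).
Qed.

End IteratedIntegral.

(** * Translations and dilations of the real line *)

Section LineIntegrals.
Variable R : realType.
Local Notation mu := (@lebesgue_measure R).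

(** Lebesgue measure is determined by its values on half-open intervals, where both sides agree. *)
Lemma lebesgue_measure_shift (c : R) (A : set R) : measurable A ->
  pushforward mu ((fun t => t + c) : _ -> measurableTypeR R) A = mu A.
Proof.
have mf : measurable_fun [set: R] ((fun t => t + c) : R -> R).
  exact: measurable_funD.
move=> mA; apply/esym/(@lebesgue_measure_unique _ (pushforward mu _)) => //.
move=> _ [[a b]] _ <-.
rewrite /= [RHS](_ : _ = mu ((fun t => t + c) @^-1` `]a, b]))//.
have -> : ((fun t => t + c) @^-1` `]a, b]) = `]a - c, b - c]%classic :> set R.
  by apply/seteqP; split => x /=; rewrite !in_itv/= ltrBlDr lerBrDr.
rewrite !lebesgue_measure_itv/= !lte_fin ltrD2r.
by case: ifP => // _; rewrite -!EFinB; congr EFin; ring.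
Qed.

Lemma ge0_integral_shift (f : R -> \bar R) (c : R) :
  measurable_fun [set: R] f -> (forall r, 0 <= f r)%E ->
  (\int[mu]_t f (t + c)%R = \int[mu]_t f t)%E.
Proof.
move=> mf f0.
have m1 : measurable_fun [set: measurableTypeR R] ((fun t => t + c) : measurableTypeR R -> measurableTypeR R).
  exact: measurable_funD.
rewrite [LHS](_ : _ = \int[mu]_(t in (fun t => t + c)%R @^-1` [set: R]) (f \o (fun t => t + c)%R) t)%E//.
rewrite -(@ge0_integral_pushforward _ _ _ _ _ _ m1 mu setT f)//.
by apply: eq_measure_integral => //= A mA AS; rewrite -[RHS](lebesgue_measure_shift c).
Qed.

Lemma lebesgue_measure_scale (k : R) (k0 : 0 < k) (A : set R) : measurable A ->
  pushforward mu ((fun t => k * t) : _ -> measurableTypeR R) A =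
  ((k^-1)%:E * mu A)%E.
Proof.
have k0' : 0 <= k by exact: ltW.
have mf : measurable_fun [set: R] ((fun t => k * t) : R -> R).
  exact: measurable_funM.
move=> mA.
(* Uniqueness is applied to [k] times the pushforward, which gives every interval its own length. *)
suff h : mu A = pushforward (mscale (NngNum k0') mu) ((fun t => k * t) : _ -> measurableTypeR R) A.
  rewrite [in RHS]h [X in (_ * X)%E](_ : _ =
    (k%:E * pushforward mu ((fun t => k * t)%R : _ -> measurableTypeR R) A)%E)//.
  by rewrite muleA -EFinM mulVf ?mul1e// gt_eqF.
apply/(@lebesgue_measure_unique _ (pushforward (mscale (NngNum k0') mu) _)) => //.
move=> _ [[a b]] _ <-.
rewrite /= [RHS](_ : _ = k%:E * mu ((fun t => k * t)%R @^-1` `]a, b]))%E//.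
have -> : ((fun t => k * t) @^-1` `]a, b]) = `]k^-1 * a, k^-1 * b]%classic :> set R.
  by apply/seteqP; split => x /=; rewrite !in_itv/= ltr_pdivrMl// ler_pdivlMl.
rewrite !lebesgue_measure_itv/= !lte_fin ltr_pM2l ?invr_gt0//.
case: ifP => // _; last by rewrite mule0.
rewrite -!EFinB -EFinM; congr EFin; field.
by rewrite gt_eqF.
Qed.

Lemma ge0_integral_scale (f : R -> \bar R) (k : R) : 0 < k ->
  measurable_fun [set: R] f -> (forall r, 0 <= f r)%E ->
  (\int[mu]_t f (k * t)%R = (k^-1)%:E * \int[mu]_t f t)%E.
Proof.
move=> k0 mf f0.
have m1 : measurable_fun [set: measurableTypeR R] ((fun t => k * t) : measurableTypeR R -> measurableTypeR R).
  exact: measurable_funM.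
have ki0 : 0 <= k^-1 by rewrite invr_ge0 ltW.
rewrite [LHS](_ : _ = \int[mu]_(t in (fun t => k * t)%R @^-1` [set: R]) (f \o (fun t => k * t)%R) t)%E//.
rewrite -(@ge0_integral_pushforward _ _ _ _ _ _ m1 mu setT f)//.
rewrite -[RHS](@ge0_integral_mscale _ _ _ mu _ measurableT (NngNum ki0) f)//.
by apply: eq_measure_integral => //= A mA AS; rewrite -[RHS](lebesgue_measure_scale k0).
Qed.

End LineIntegrals.

(** * Measurable coordinate expressions; shears and dilations of coordinate space *)

Section CoordinateMeasurability.
Variable R : realType.
Local Notation mu := (@lebesgue_measure R).
Implicit Types (F G : (nat -> R) -> R).

Lemma ymeas_coord k : ymeas (fun x : nat -> R => x k).
Proof. by move=> d S c mc. Qed.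

Lemma ymeas_cst d (U : sigmaRingType d) (u : U) : ymeas (fun _ : nat -> R => u).
Proof. by move=> d1 S c mc; exact: measurable_cst. Qed.

Lemma ymeasD F G : ymeas F -> ymeas G -> ymeas (fun x => F x + G x).
Proof. by move=> mF mG d S c mc; apply: measurable_funD; [exact: mF|exact: mG]. Qed.

Lemma ymeasB F G : ymeas F -> ymeas G -> ymeas (fun x => F x - G x).
Proof. by move=> mF mG d S c mc; apply: measurable_funB; [exact: mF|exact: mG]. Qed.

Lemma ymeasM F G : ymeas F -> ymeas G -> ymeas (fun x => F x * G x).
Proof. by move=> mF mG d S c mc; apply: measurable_funM; [exact: mF|exact: mG]. Qed.

Lemma ymeasN F : ymeas F -> ymeas (fun x => - F x).
Proof. by move=> mF d S c mc; apply: measurableT_comp => //; exact: mF. Qed.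

Lemma ymeasX F n : ymeas F -> ymeas (fun x => F x ^+ n).
Proof. by move=> mF d S c mc; apply: measurable_funX; exact: mF. Qed.

Lemma ymeas_powR F (a : R) : ymeas F -> ymeas (fun x => powR (F x) a).
Proof.
move=> mF d S c mc.
by apply: (measurableT_comp (measurable_powR a)); exact: mF.
Qed.

Lemma ymeas_sqrt F : ymeas F -> ymeas (fun x => Num.sqrt (F x)).
Proof.
move=> mF d S c mc; apply: (measurableT_comp _ (mF _ _ _ mc)).
by apply: continuous_measurable_fun; exact: sqrt_continuous.
Qed.

Lemma ymeas_sum (I : finType) (F : I -> (nat -> R) -> R) :
  (forall i, ymeas (F i)) -> ymeas (fun x => \sum_i F i x).
Proof.
move=> mF d S c mc; apply: measurable_sum => i; exact: mF.
Qed.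

Lemma ymeas_lt F G : ymeas F -> ymeas G -> ymeas (fun x => F x < G x).
Proof. by move=> mF mG d S c mc; apply: measurable_fun_ltr; [exact: mF|exact: mG]. Qed.

Lemma ymeas_le F G : ymeas F -> ymeas G -> ymeas (fun x => F x <= G x).
Proof. by move=> mF mG d S c mc; apply: measurable_fun_ler; [exact: mF|exact: mG]. Qed.

Lemma ymeas_and (p q : (nat -> R) -> bool) : ymeas p -> ymeas q ->
  ymeas (fun x => p x && q x).
Proof. by move=> mp mq d S c mc; apply: measurable_and; [exact: mp|exact: mq]. Qed.

Lemma ymeas_if d (U : measurableType d) (p : (nat -> R) -> bool)
    (f g : (nat -> R) -> U) : ymeas p -> ymeas f -> ymeas g ->
  ymeas (fun x => if p x then f x else g x).
Proof.
by move=> mp mf mg d1 S c mc; apply: measurable_fun_ifT;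
  [exact: mp|exact: mf|exact: mg].
Qed.

(** The inverse is expressed by [powR _ (-1)]; the split by sign is there because [powR_inv1] asks
    for a nonnegative base. *)
Lemma ymeasV F : ymeas F -> ymeas (fun x => (F x)^-1).
Proof.
move=> mF; rewrite (_ : (fun x => _) = fun x =>
    if F x < 0 then - powR (- F x) (-1) else powR (F x) (-1)).
  apply: ymeas_if; [by apply: ymeas_lt => //; exact: ymeas_cst| |exact: ymeas_powR].
  by apply: ymeasN; apply: ymeas_powR; exact: ymeasN.
apply/funext => x; case: ltP => h; last by rewrite powR_inv1.
by rewrite powR_inv1 ?oppr_ge0 ?ltW// invrN opprK.
Qed.

Lemma ymeas_EFin F : ymeas F -> ymeas (fun x => (F x)%:E).
Proof. by move=> mF d S c mc; apply/measurable_EFinP; exact: mF. Qed.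

Lemma ymeasME (F G : (nat -> R) -> \bar R) : ymeas F -> ymeas G ->
  ymeas (fun x => F x * G x)%E.
Proof. by move=> mF mG d S c mc; apply: emeasurable_funM; [exact: mF|exact: mG]. Qed.

Lemma ymeas_comp d (U : sigmaRingType d) (F : (nat -> R) -> U)
    (tau : (nat -> R) -> nat -> R) :
  ymeas F -> (forall k, ymeas (fun x => tau x k)) -> ymeas (F \o tau).
Proof. by move=> mF mt d1 S c mc; apply: mF => k; exact: mt. Qed.

Lemma ymeas_comp_upd d (U : sigmaRingType d) (F : (nat -> R) -> U) i
    (h : (nat -> R) -> R) :
  ymeas F -> ymeas h -> ymeas (fun x => F (upd x i (h x))).
Proof.
move=> mF mh; apply: (ymeas_comp (tau := fun x => upd x i (h x))) => // k.
rewrite /upd; case: (k == i) => //; exact: ymeas_coord.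
Qed.

Lemma measurable_slice d (U : sigmaRingType d) (F : (nat -> R) -> U) i x :
  ymeas F -> measurable_fun [set: measurableTypeR R] (fun t => F (upd x i t)).
Proof.
move=> mF; apply: (ymeas_upd i mF (tau := idfun)); first exact: measurable_id.
by move=> k; exact: measurable_cst.
Qed.

(** By [iint_coord] the coordinate [i] may be integrated first; since [h] does not depend on it, the
    shear is then a translation by a constant. *)
Lemma iint_shear n i (h : (nat -> R) -> R) (F : (nat -> R) -> \bar R) :
  (i < n)%N -> ymeas h -> (forall x t, h (upd x i t) = h x) ->
  ymeas F -> (forall x, 0 <= F x)%E ->
  iint n (fun x => F (upd x i (x i + h x))) = iint n F.
Proof.
move=> iltn mh hi mF F0; apply: (@iint_coord _ n i) => //.
  by apply: ymeas_comp_upd => //; apply: ymeasD => //; exact: ymeas_coord.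
move=> x.
rewrite -(@ge0_integral_shift _ (fun t => F (upd x i t)) (h x))//.
  by apply: eq_integral => t _; rewrite upd_upd updE hi.
exact: measurable_slice.
Qed.

Lemma iint_scale1 n i (k : R) (F : (nat -> R) -> \bar R) :
  (i < n)%N -> 0 < k -> ymeas F -> (forall x, 0 <= F x)%E ->
  (iint n (fun x => F (upd x i (k * x i)%R)) = (k^-1)%:E * iint n F)%E.
Proof.
move=> iltn k0 mF F0.
have ki0 : 0 <= k^-1 by rewrite invr_ge0 ltW.
rewrite -iintZ//; apply: (@iint_coord _ n i) => //.
- by apply: ymeas_comp_upd => //; apply: ymeasM; [exact: ymeas_cst|exact: ymeas_coord].
- by apply: ymeasME => //; exact: ymeas_cst.
- by move=> x; exact: mule_ge0.
move=> x; rewrite ge0_integralZl_EFin//; last exact: measurable_slice.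
rewrite -(@ge0_integral_scale _ (fun t => F (upd x i t)) k)//.
  by apply: eq_integral => t _; rewrite upd_upd updE.
exact: measurable_slice.
Qed.

(** A partial dilation, so that [iint_scale] can be proved one coordinate at a time. *)
Definition scale_below m (k : R) (x : nat -> R) : nat -> R :=
  fun j => if (j < m)%N then k * x j else x j.

Lemma iint_scale n (k : R) (F : (nat -> R) -> \bar R) :
  0 < k -> ymeas F -> (forall x, 0 <= F x)%E ->
  (iint n (fun x => F (scale_below n k x)) = ((k ^+ n)^-1)%:E * iint n F)%E.
Proof.
move=> k0 mF F0.
suff H m : (m <= n)%N ->
  (iint n (fun x => F (scale_below m k x)) = ((k ^+ m)^-1)%:E * iint n F)%E.
  exact: H.
elim: m => [_|m IH mn]; first by rewrite expr0 invr1 mul1e.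
transitivity (iint n (fun x => F (scale_below m k (upd x m (k * x m))))).
  congr iint; apply/funext => x; congr F; apply/funext => j.
  rewrite /scale_below /upd ltnS leq_eqVlt; case: eqP => [->|_] //=.
  by rewrite ltnn.
rewrite (@iint_scale1 n m k (fun x => F (scale_below m k x)))//.
  by rewrite IH ?(ltnW mn)// muleA -EFinM exprS invfM.
apply: (ymeas_comp (tau := scale_below m k)) => // j.
rewrite /scale_below; case: (j < m)%N; last exact: ymeas_coord.
by apply: ymeasM; [exact: ymeas_cst|exact: ymeas_coord].
Qed.

End CoordinateMeasurability.

(** * Complex modulus, Hermitian inner product and norm *)

Section ComplexVectors.
Variable R : realType.
Local Notation C := R[i].
Implicit Types a b : C.

Lemma creD a b : cre (a + b) = cre a + cre b. Proof. by case: a; case: b. Qed.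
Lemma cimD a b : cim (a + b) = cim a + cim b. Proof. by case: a; case: b. Qed.
Lemma creN a : cre (- a) = - cre a. Proof. by case: a. Qed.
Lemma cimN a : cim (- a) = - cim a. Proof. by case: a. Qed.
Lemma creM a b : cre (a * b) = cre a * cre b - cim a * cim b.
Proof. by case: a; case: b. Qed.
Lemma cimM a b : cim (a * b) = cre a * cim b + cim a * cre b.
Proof. by case: a; case: b => *; rewrite /= addrC. Qed.

Lemma eqC a b : cre a = cre b -> cim a = cim b -> a = b.
Proof. by case: a; case: b => /= *; subst. Qed.

Lemma cre_sum (I : finType) (F : I -> C) : cre (\sum_i F i) = \sum_i cre (F i).
Proof. by elim/big_ind2 : _ => // x1 x2 y1 y2 <- <-; rewrite creD. Qed.

Lemma cim_sum (I : finType) (F : I -> C) : cim (\sum_i F i) = \sum_i cim (F i).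
Proof. by elim/big_ind2 : _ => // x1 x2 y1 y2 <- <-; rewrite cimD. Qed.

Lemma cabsE a : cabs a = Normc.normc a. Proof. by case: a. Qed.

Lemma cabs_ge0 a : 0 <= cabs a. Proof. exact: sqrtr_ge0. Qed.

Lemma cabs2E a : cabs a ^+ 2 = cre a ^+ 2 + cim a ^+ 2.
Proof. by rewrite sqr_sqrtr// addr_ge0// sqr_ge0. Qed.

Lemma cabsM a b : cabs (a * b) = cabs a * cabs b.
Proof. by rewrite !cabsE Normc.normcM. Qed.

Lemma cabsD a b : cabs (a + b) <= cabs a + cabs b.
Proof. by rewrite !cabsE le_normcD. Qed.

Lemma cabsN a : cabs (- a) = cabs a.
Proof. by rewrite /cabs creN cimN !sqrrN. Qed.

Lemma cabsB a b : cabs (a - b) <= cabs a + cabs b.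
Proof. by rewrite -(cabsN b) cabsD. Qed.

Lemma cabsBC a b : cabs (a - b) = cabs (b - a).
Proof. by rewrite -cabsN opprB. Qed.

Lemma cabsV a : cabs a^-1 = (cabs a)^-1.
Proof. by rewrite !cabsE Normc.normcV. Qed.

Lemma cabs0 : cabs (0 : C) = 0. Proof. by rewrite cabsE Normc.normc0. Qed.

Lemma cabs1 : cabs (1 : C) = 1. Proof. by rewrite cabsE Normc.normc1. Qed.

Lemma cabsX a n : cabs (a ^+ n) = cabs a ^+ n.
Proof. by elim: n => [|n IH]; rewrite ?expr0 ?cabs1// !exprS cabsM IH. Qed.

Lemma cabs_eq0 a : (cabs a == 0) = (a == 0).
Proof.
apply/eqP/eqP => [|->]; last exact: cabs0.
by rewrite cabsE => /Normc.eq0_normc.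
Qed.

Lemma cabs_rC (r : R) : cabs (rC r) = `|r|.
Proof. by rewrite /cabs /= expr0n addr0 sqrtr_sqr. Qed.

Lemma cre_le_cabs a : `|cre a| <= cabs a.
Proof. by rewrite -sqrtr_sqr ler_wsqrtr// lerDl sqr_ge0. Qed.

Lemma cim_le_cabs a : `|cim a| <= cabs a.
Proof. by rewrite -sqrtr_sqr ler_wsqrtr// lerDr sqr_ge0. Qed.

Lemma cabs_le_reim a : cabs a <= `|cre a| + `|cim a|.
Proof.
rewrite -[leRHS]ger0_norm ?addr_ge0// -sqrtr_sqr ler_wsqrtr//.
rewrite -[cre a ^+ 2]real_normK ?num_real// -[cim a ^+ 2]real_normK ?num_real//.
rewrite sqrrD lerD2r// lerDl mulrn_wge0// mulr_ge0//.
Qed.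

Lemma cconjE a : cconj a = conjc a. Proof. by case: a. Qed.

Lemma cconjD a b : cconj (a + b) = cconj a + cconj b.
Proof. by rewrite !cconjE rmorphD. Qed.

Lemma cconjM a b : cconj (a * b) = cconj a * cconj b.
Proof. by rewrite !cconjE rmorphM. Qed.

Lemma cconjN a : cconj (- a) = - cconj a.
Proof. by rewrite !cconjE rmorphN. Qed.

Lemma cconjK a : cconj (cconj a) = a.
Proof. by rewrite !cconjE conjcK. Qed.

Lemma cconj_sum (I : finType) (F : I -> C) :
  cconj (\sum_i F i) = \sum_i cconj (F i).
Proof.
elim/big_ind2 : _ => // [|x1 x2 y1 y2 <- <-]; last by rewrite cconjD.
by rewrite cconjE conjc0.
Qed.

Lemma cconj_rC (r : R) : cconj (rC r) = rC r.
Proof. by rewrite /cconj /rC /= oppr0. Qed.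

Lemma cabs_conj a : cabs (cconj a) = cabs a.
Proof. by rewrite /cabs /= sqrrN. Qed.

Lemma mulC_conj a : a * cconj a = rC (cabs a ^+ 2).
Proof. by apply: eqC; rewrite ?creM ?cimM /= ?cabs2E; ring. Qed.

Lemma rCD (r s : R) : rC (r + s) = rC r + rC s.
Proof. by apply: eqC; rewrite ?creD ?cimD /= ?addr0. Qed.

Lemma rCM (r s : R) : rC (r * s) = rC r * rC s.
Proof. by apply: eqC; rewrite ?creM ?cimM /=; ring. Qed.

Lemma rCN (r : R) : rC (- r) = - rC r.
Proof. by apply: eqC; rewrite ?creN ?cimN /= ?oppr0. Qed.

Lemma rCV (r : R) : rC r^-1 = (rC r)^-1.
Proof.
have [->|r0] := eqVneq r 0; first by rewrite invr0 [rC 0](_ : _ = 0)// invr0.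
have c0 : rC r != 0 by rewrite -cabs_eq0 cabs_rC normr_eq0.
apply: (mulIf c0); rewrite mulVf// -rCM mulVf//.
Qed.

Lemma rCB (r s : R) : rC (r - s) = rC r - rC s.
Proof. by rewrite rCD rCN. Qed.

Lemma cre_rCM (r : R) a : cre (rC r * a) = r * cre a.
Proof. by rewrite creM /= mul0r subr0. Qed.

Lemma cim_rCM (r : R) a : cim (rC r * a) = r * cim a.
Proof. by rewrite cimM /= mul0r addr0. Qed.

Variable N : nat.
Local Notation V := ('I_N -> C).
Implicit Types z w u : V.

Definition vadd z w : V := fun j => z j + w j.
Definition vsub z w : V := fun j => z j - w j.
Definition vscl a z : V := fun j => a * z j.

Lemma inner_addl z w u : inner (vadd z w) u = inner z u + inner w u.
Proof. by rewrite /inner -big_split; apply: eq_bigr => j _; rewrite mulrDl. Qed.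

Lemma inner_subl z w u : inner (vsub z w) u = inner z u - inner w u.
Proof. by rewrite /inner -sumrB; apply: eq_bigr => j _; rewrite mulrBl. Qed.

Lemma inner_scll a z u : inner (vscl a z) u = a * inner z u.
Proof. by rewrite /inner mulr_sumr; apply: eq_bigr => j _; rewrite mulrA. Qed.

Lemma inner_conj z w : inner w z = cconj (inner z w).
Proof.
rewrite /inner cconj_sum; apply: eq_bigr => j _.
by rewrite cconjM cconjK mulrC.
Qed.

Lemma inner_addr z w u : inner u (vadd z w) = inner u z + inner u w.
Proof. by rewrite inner_conj inner_addl cconjD -!inner_conj. Qed.

Lemma inner_subr z w u : inner u (vsub z w) = inner u z - inner u w.
Proof. by rewrite inner_conj inner_subl cconjD cconjN -!inner_conj. Qed.

Lemma inner_sclr a z u : inner u (vscl a z) = cconj a * inner u z.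
Proof. by rewrite inner_conj inner_scll cconjM -inner_conj. Qed.

Lemma vnorm_ge0 z : 0 <= vnorm z. Proof. exact: sqrtr_ge0. Qed.

Lemma vnorm2E z : vnorm z ^+ 2 = \sum_j cabs (z j) ^+ 2.
Proof. by rewrite sqr_sqrtr// sumr_ge0// => j _; exact: sqr_ge0. Qed.

Lemma inner_self z : inner z z = rC (vnorm z ^+ 2).
Proof.
rewrite vnorm2E /inner; elim/big_ind2 : _ => // [x1 x2 y1 y2 -> ->|j _].
  by rewrite rCD.
exact: mulC_conj.
Qed.

Lemma vnorm_scl a z : vnorm (vscl a z) = cabs a * vnorm z.
Proof.
rewrite /vnorm -[cabs a]ger0_norm ?cabs_ge0// -sqrtr_sqr -sqrtrM ?sqr_ge0//.
congr Num.sqrt; rewrite mulr_sumr; apply: eq_bigr => j _.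
by rewrite /vscl cabsM exprMn.
Qed.

Lemma vnorm2_sub z w :
  vnorm (vsub z w) ^+ 2 = vnorm z ^+ 2 - 2 * cre (inner z w) + vnorm w ^+ 2.
Proof.
have h : inner (vsub z w) (vsub z w) =
    inner z z - inner z w - (inner w z - inner w w).
  by rewrite inner_subr !inner_subl; ring.
move: h; rewrite (inner_conj z w) !inner_self => /(congr1 (@cre R)).
by rewrite !(creD, creN) /= => ->; ring.
Qed.

Lemma vnorm2_add z w :
  vnorm (vadd z w) ^+ 2 = vnorm z ^+ 2 + 2 * cre (inner z w) + vnorm w ^+ 2.
Proof.
have h : inner (vadd z w) (vadd z w) =
    inner z z + inner z w + (inner w z + inner w w).
  by rewrite inner_addr !inner_addl; ring.
move: h; rewrite (inner_conj z w) !inner_self => /(congr1 (@cre R)).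
by rewrite !(creD, creN) /= => ->; ring.
Qed.

Lemma vnorm0_eq0 z : vnorm z = 0 -> forall j, z j = 0.
Proof.
move=> z0 j; apply/eqP; rewrite -cabs_eq0 -sqrf_eq0.
have : \sum_i cabs (z i) ^+ 2 = 0 by rewrite -vnorm2E z0 expr0n.
move/eqP; rewrite psumr_eq0 => [/allP/(_ j)|i _]; last exact: sqr_ge0.
by rewrite mem_index_enum => /(_ isT).
Qed.

Lemma cauchy_schwarz z w : cabs (inner z w) <= vnorm z * vnorm w.
Proof.
have [w0|w0] := eqVneq (vnorm w) 0.
  rewrite w0 mulr0 /inner big1 ?cabs0// => j _.
  by rewrite (vnorm0_eq0 w0 j) [cconj 0](_ : _ = 0) ?mulr0//= /cconj /= oppr0.
have wp : 0 < vnorm w by rewrite lt_neqAle eq_sym w0 vnorm_ge0.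
set b := vnorm w ^+ 2; set p := inner z w.
have b0 : 0 < b by rewrite exprn_gt0.
(* With b = |w|^2 and p = <z, w>, this square expands to b (b |z|^2 - |p|^2). *)
have := sqr_ge0 (vnorm (vsub (vscl (rC b) z) (vscl p w))).
rewrite vnorm2_sub !vnorm_scl inner_scll inner_sclr -/p cabs_rC gtr0_norm//.
rewrite cre_rCM [cconj p * p]mulrC mulC_conj /= => h.
rewrite -(@ler_pXn2r _ 2) ?nnegrE ?cabs_ge0 ?mulr_ge0 ?vnorm_ge0//.
rewrite exprMn -/b.
have : 0 <= b * (vnorm z ^+ 2 * b - cabs p ^+ 2).
  by apply: le_trans h _; rewrite !exprMn -/b; lra.
by rewrite pmulr_rge0// subr_ge0.
Qed.

Lemma vnormD z w : vnorm (vadd z w) <= vnorm z + vnorm w.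
Proof.
rewrite -(@ler_pXn2r _ 2) ?nnegrE ?addr_ge0 ?vnorm_ge0//.
rewrite vnorm2_add.
have : cre (inner z w) <= vnorm z * vnorm w.
  by rewrite (le_trans (ler_norm _))// (le_trans (cre_le_cabs _))// cauchy_schwarz.
by lra.
Qed.

Lemma vnormN z : vnorm (fun j => - z j) = vnorm z.
Proof. by congr Num.sqrt; apply: eq_bigr => j _; rewrite cabsN. Qed.

Lemma vnormB z w : vnorm (vsub z w) <= vnorm z + vnorm w.
Proof. by rewrite -(vnormN w) vnormD. Qed.

Lemma vnorm_subC z w : vnorm (vsub z w) = vnorm (vsub w z).
Proof.
by rewrite -vnormN; congr Num.sqrt; apply: eq_bigr => j _; rewrite /vsub opprB.
Qed.

Lemma cabs_le_vnorm z j : cabs (z j) <= vnorm z.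
Proof.
rewrite -(@ler_pXn2r _ 2) ?nnegrE ?cabs_ge0 ?vnorm_ge0// vnorm2E.
by rewrite (bigD1 j)//= lerDl sumr_ge0// => i _; exact: sqr_ge0.
Qed.

End ComplexVectors.

(** * Invariance of volume under rotations, obtained from shears *)

Section UnitaryInvariance.
Variables (R : realType) (N : nat).
Local Notation C := R[i].
Local Notation V := ('I_N -> C).
Local Notation zof := (@z_of R N).
Implicit Types (z w : V) (i l : 'I_N).

Lemma eq_ymeas d (U : sigmaRingType d) (F G : (nat -> R) -> U) :
  (forall x, F x = G x) -> ymeas G -> ymeas F.
Proof. by move=> /funext ->. Qed.

Definition cmeas (F : (nat -> R) -> C) :=
  ymeas (fun x => cre (F x)) /\ ymeas (fun x => cim (F x)).

Lemma cmeas_cst (a : C) : cmeas (fun _ => a).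
Proof. by split; exact: ymeas_cst. Qed.

Lemma cmeas_z_of (j : 'I_N) : cmeas (fun x => zof x j).
Proof. by split; exact: ymeas_coord. Qed.

Lemma cmeasB F G : cmeas F -> cmeas G -> cmeas (fun x => F x - G x).
Proof.
move=> [F1 F2] [G1 G2]; split.
- apply: (eq_ymeas (fun x => creD _ _)); apply: ymeasD => //.
  by apply: (eq_ymeas (fun x => creN _)); exact: ymeasN.
- apply: (eq_ymeas (fun x => cimD _ _)); apply: ymeasD => //.
  by apply: (eq_ymeas (fun x => cimN _)); exact: ymeasN.
Qed.

Lemma cmeasM F G : cmeas F -> cmeas G -> cmeas (fun x => F x * G x).
Proof.
move=> [F1 F2] [G1 G2]; split.
- by apply: (eq_ymeas (fun x => creM _ _)); apply: ymeasB; exact: ymeasM.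
- by apply: (eq_ymeas (fun x => cimM _ _)); apply: ymeasD; exact: ymeasM.
Qed.

Lemma cmeas_rC (F : (nat -> R) -> R) : ymeas F -> cmeas (fun x => rC (F x)).
Proof. by move=> mF; split => //=; exact: ymeas_cst. Qed.

Lemma cmeas_sum (I : finType) (F : I -> (nat -> R) -> C) :
  (forall k, cmeas (F k)) -> cmeas (fun x => \sum_k F k x).
Proof.
move=> mF; split.
- apply: (eq_ymeas (fun x => cre_sum _)).
  by apply: ymeas_sum => i; exact: (mF i).1.
- apply: (eq_ymeas (fun x => cim_sum _)).
  by apply: ymeas_sum => i; exact: (mF i).2.
Qed.

Lemma cmeas_abs F : cmeas F -> ymeas (fun x => cabs (F x)).
Proof.
by move=> [F1 F2]; apply: ymeas_sqrt; apply: ymeasD; exact: ymeasX.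
Qed.

Definition vmeas (F : (nat -> R) -> V) := forall j, cmeas (fun x => F x j).

Lemma vmeas_z_of : vmeas (fun x => zof x).
Proof. exact: cmeas_z_of. Qed.

Lemma vmeas_norm F : vmeas F -> ymeas (fun x => vnorm (F x)).
Proof.
move=> mF; apply: ymeas_sqrt; apply: ymeas_sum => j; apply: ymeasX.
exact: cmeas_abs (mF j).
Qed.

Lemma vmeas_inner F w : vmeas F -> cmeas (fun x => inner (F x) w).
Proof.
move=> mF; apply: cmeas_sum => j; apply: cmeasM (mF j) _.
exact: cmeas_cst.
Qed.

(** Measurability of the composite belongs to the notion, so that invariance is stable under
    composition. *)
Definition iint_invariant (U : V -> V) := forall g : V -> \bar R,
  ymeas (g \o zof) -> (forall z, 0 <= g z)%E ->
  ymeas (g \o U \o zof) /\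
  iint (2 * N) (g \o U \o zof) = iint (2 * N) (g \o zof).

Lemma iint_invariant_comp U1 U2 : iint_invariant U1 -> iint_invariant U2 ->
  iint_invariant (U1 \o U2).
Proof.
move=> h1 h2 g mg g0; have [m1 e1] := h1 g mg g0.
have [m2 e2] := h2 (g \o U1) m1 (fun z => g0 (U1 z)).
by split=> //; rewrite -e1 -e2.
Qed.

Definition cshear i l (c : C) (z : V) : V :=
  fun j => if j == i then z i + c * z l else z j.

Lemma double_ord_ltn (j : 'I_N) : (2 * j < 2 * N)%N /\ ((2 * j).+1 < 2 * N)%N.
Proof.
have jN := ltn_ord j; have h : ((2 * j).+1 < 2 * N)%N by rewrite !mul2n -doubleS leq_double.
by split=> //; exact: ltnW.
Qed.

(** A complex shear is two real shears, of the real and of the imaginary coordinate of [z i]. Both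
    increments depend on [z l] only, hence are constant along the coordinate that moves. *)
Lemma iint_invariant_cshear i l c : i != l -> iint_invariant (cshear i l c).
Proof.
move=> il g mg g0.
have ilN : nat_of_ord i != nat_of_ord l by [].
pose h (x : nat -> R) := cre (c * zof x l).
pose h' (x : nat -> R) := cim (c * zof x l).
have [mh mh'] : cmeas (fun x => c * zof x l).
  by apply: cmeasM; [exact: cmeas_cst|exact: cmeas_z_of].
have z_updl x t : zof (upd x (2 * i)%N t) l = zof x l.
  congr Complex; rewrite upd_ne//.
    by rewrite eqn_mul2l /= eq_sym.
  apply/negP => /eqP /(congr1 odd); by rewrite /= !mul2n !odd_double.
have z_updl' x t : zof (upd x (2 * i).+1 t) l = zof x l.
  congr Complex; rewrite upd_ne//.
    apply/negP => /eqP /(congr1 odd); by rewrite /= !mul2n !odd_double.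
  by rewrite eqSS eqn_mul2l /= eq_sym.
have [lt0 lt1] := double_ord_ltn i.
pose F0 := g \o zof.
pose F1 (x : nat -> R) := F0 (upd x (2 * i)%N (x (2 * i)%N + h x)).
pose F2 (x : nat -> R) := F1 (upd x (2 * i).+1 (x (2 * i).+1 + h' x)).
have mF1 : ymeas F1.
  by apply: ymeas_comp_upd => //; apply: ymeasD => //; exact: ymeas_coord.
have mF2 : ymeas F2.
  by apply: ymeas_comp_upd => //; apply: ymeasD => //; exact: ymeas_coord.
have E : g \o cshear i l c \o zof = F2.
  apply/funext => x; rewrite /F2 /F1 /F0 /=; congr g; apply/funext => j.
  rewrite /cshear; case: eqP => [->|/eqP ji].
    apply: eqC; rewrite ?creD ?cimD /=.
      rewrite updE upd_ne ?neq_ltn ?ltnSn//; congr (_ + _).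
      by rewrite /h z_updl'.
    by rewrite upd_ne ?neq_ltn ?ltnSn ?orbT// updE.
  congr Complex; rewrite !upd_ne//.
  - by apply/negP => /eqP /(congr1 odd); rewrite /= !mul2n !odd_double.
  - by rewrite eqn_mul2l.
  - by rewrite eqSS eqn_mul2l.
  - by apply/negP => /eqP /(congr1 odd); rewrite /= !mul2n !odd_double.
rewrite E; split => //.
rewrite /F2 (@iint_shear _ _ _ h' F1)//; first last.
- by move=> x; exact: g0.
- by move=> x t; rewrite /h' z_updl'.
rewrite /F1 (@iint_shear _ _ _ h F0)//.
- by move=> x t; rewrite /h z_updl.
- by move=> x; exact: g0.
Qed.

Definition givens i l (a b c d : C) (z : V) : V :=
  fun j => if j == i then a * z i + b * z l
           else if j == l then c * z i + d * z l else z j.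

(** A 2 x 2 matrix of determinant 1 whose lower left entry [c] is nonzero is a product of three
    shears (upper, lower, upper), so no Jacobian formula is involved. *)
Lemma iint_invariant_givens i l a b c d : i != l -> a * d - b * c = 1 ->
  c != 0 -> iint_invariant (givens i l a b c d).
Proof.
move=> il det c0.
rewrite (_ : givens i l a b c d =
  cshear i l ((a - 1) / c) \o (cshear l i c \o cshear i l ((d - 1) / c))).
  apply: iint_invariant_comp; first exact: iint_invariant_cshear.
  by apply: iint_invariant_comp; apply: iint_invariant_cshear => //; rewrite eq_sym.
apply/funext => z; apply/funext => j.
rewrite /givens /cshear /= !eqxx (negbTE il) (eq_sym l i) (negbTE il).
case: eqP => _.
  have -> : b = (a * d - 1) / c by rewrite -det; field.
  by field.
by case: eqP => _ //; field.
Qed.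

Definition isU (U : V -> V) :=
  (forall z w, inner (U z) (U w) = inner z w) /\ iint_invariant U.

Lemma isU_comp U1 U2 : isU U1 -> isU U2 -> isU (U1 \o U2).
Proof.
move=> [h1 i1] [h2 i2]; split; last exact: iint_invariant_comp.
by move=> z w /=; rewrite h1 h2.
Qed.

Lemma isU_id : isU id.
Proof. by split. Qed.

Lemma isU_givens i l a c : i != l -> cabs a ^+ 2 + cabs c ^+ 2 = 1 -> c != 0 ->
  isU (givens i l a (- cconj c) c (cconj a)).
Proof.
move=> il ac c0.
have ac' : a * cconj a + c * cconj c = 1.
  by rewrite !mulC_conj -rCD ac.
split; last first.
  apply: iint_invariant_givens => //.
  by rewrite mulNr opprK [cconj c * c]mulrC.
move=> z w; rewrite /inner (bigD1 i)//= (bigD1 l) 1?eq_sym//=.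
rewrite [RHS](bigD1 i)//= [in RHS](bigD1 l) 1?eq_sym//=.
rewrite !addrA; congr (_ + _); last first.
  by apply: eq_bigr => j /andP[ji jl]; rewrite /givens (negbTE ji) (negbTE jl).
rewrite /givens !eqxx (eq_sym l i) (negbTE il) !(cconjD, cconjM, cconjN, cconjK).
transitivity ((a * cconj a + c * cconj c) * (z i * cconj (w i) + z l * cconj (w l))).
  by ring.
by rewrite ac' mul1r.
Qed.

Lemma isU_elim i l z : i != l -> exists U, isU U /\
  [/\ U z i = 0, exists2 r, 0 <= r & U z l = rC r &
      forall j, j != i -> j != l -> U z j = z j].
Proof.
move=> il.
have key y : y i != 0 -> exists U, isU U /\
  [/\ U y i = 0, exists2 r, 0 <= r & U y l = rC r &
      forall j, j != i -> j != l -> U y j = y j].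
  move=> yi0; pose s := cabs (y i) ^+ 2 + cabs (y l) ^+ 2.
  have s0 : 0 < s.
    by rewrite ltr_wpDr ?sqr_ge0// exprn_gt0// lt_neqAle cabs_ge0 eq_sym cabs_eq0 yi0.
  pose r := Num.sqrt s; have r0 : 0 < r by rewrite sqrtr_gt0.
  have r2 : r ^+ 2 = s by rewrite sqr_sqrtr// ltW.
  have rC0 : rC r != 0 by rewrite -cabs_eq0 cabs_rC normr_eq0 gt_eqF.
  exists (givens i l (y l / rC r) (- cconj (cconj (y i) / rC r)) (cconj (y i) / rC r)
    (cconj (y l / rC r))); split.
    apply: isU_givens => //.
      rewrite !cabsM !cabsV cabs_conj cabs_rC gtr0_norm//.
      rewrite !expr_div_n -mulrDl r2 addrC divff// gt_eqF//.
    by rewrite mulf_neq0 ?invr_eq0// -cabs_eq0 cabs_conj cabs_eq0.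
  rewrite -rCV /givens; split.
  - rewrite eqxx !(cconjM, cconjK, cconj_rC); ring.
  - rewrite eq_sym (negbTE il) eqxx; exists r; first exact: ltW.
    rewrite !(cconjM, cconjK, cconj_rC).
    transitivity ((y i * cconj (y i) + y l * cconj (y l)) * rC r^-1); first by ring.
    rewrite !mulC_conj -rCD -/s -r2 -rCM expr2 mulfK// gt_eqF//.
  - by move=> j /negbTE -> /negbTE ->.
have [zi|zi] := eqVneq (z i) 0; last exact: key.
have [zl|zl] := eqVneq (z l) 0.
  exists id; split; first exact: isU_id.
  by split => //; exists 0.
(* The phase of [z l] still has to be removed. [W] exchanges the two coordinates up to sign, which
   brings a nonzero entry to position [i], as [key] requires. *)
pose W := givens i l 0 (- cconj 1) 1 (cconj 0).
have UW : isU W.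
  by apply: isU_givens; rewrite ?oner_eq0// cabs0 cabs1 expr0n expr1n add0r.
have [|U [hU [h1 h2 h3]]] := key (W z).
  rewrite /W /givens eqxx mul0r add0r mulf_neq0// oppr_eq0 -cabs_eq0 cabs_conj cabs1.
  exact: oner_neq0.
exists (U \o W); split; first exact: isU_comp.
split => // j ji jl; rewrite /= h3//.
by rewrite /W /givens (negbTE ji) (negbTE jl).
Qed.

(** The coordinates other than [l] are eliminated one by one. At least one elimination is needed to
    make the coordinate [l] real and nonnegative, hence [1 < N]. *)
Lemma exists_rotation l z : (1 < N)%N -> exists U, isU U /\
  U z = fun j => if j == l then rC (vnorm z) else 0.
Proof.
move=> N1.
have H (s : seq 'I_N) : l \notin s -> exists U, [/\ isU U,
    forall j, j \in s -> U z j = 0 &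
    s != [::] -> exists2 r, 0 <= r & U z l = rC r].
  elim: s => [|i s IH]; first by exists id; split => //; exact: isU_id.
  rewrite inE negb_or => /andP[li ls]; have [U [hU h0 _]] := IH ls.
  rewrite eq_sym in li.
  have [W [hW [w1 w2 w3]]] := isU_elim (U z) li.
  exists (W \o U); split => //; first exact: isU_comp.
  move=> j; rewrite inE; have [->//|ji /= js] := eqVneq j i.
  have jl : j != l by apply: contraNneq ls => <-.
  by rewrite w3// h0.
have [|U [hU h0 h1]] := H [seq j <- enum 'I_N | j != l].
  by rewrite mem_filter eqxx.
exists U; split => //.
have [|r r0 hr] := h1.
  have [j jl] : exists j : 'I_N, j != l.
    have [l0|l0] := eqVneq (nat_of_ord l) 0%N.
      by exists (Ordinal N1); rewrite -(inj_eq val_inj) /= l0.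
    by exists (Ordinal (ltnW N1)); rewrite -(inj_eq val_inj) /= eq_sym.
  apply/eqP => h; have : j \in [seq j <- enum 'I_N | j != l].
    by rewrite mem_filter jl mem_enum.
  by rewrite h.
have h0' j : j != l -> U z j = 0.
  by move=> jl; apply: h0; rewrite mem_filter jl mem_enum.
have rz : r = vnorm z.
  apply/eqP; rewrite -(@eqrXn2 _ 2)// ?vnorm_ge0//; apply/eqP.
  have /(congr1 (@cre R)) := hU.1 z z; rewrite !inner_self /= => <-.
  rewrite vnorm2E (bigD1 l)//= big1 ?addr0 => [|j /h0' ->]; last by rewrite cabs0 expr0n.
  by rewrite hr cabs_rC ger0_norm.
apply/funext => j; case: eqP => [->|/eqP /h0' //].
by rewrite hr rz.
Qed.

End UnitaryInvariance.

(** * Volumes of boxes and integrals over the ball *)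

Section BallIntegrals.
Variable R : realType.
Local Notation mu := (@lebesgue_measure R).

Lemma integral_if_itv (a b c : R) : a <= b -> 0 <= c ->
  (\int[mu]_t (if (a < t < b)%R then c%:E else 0) = (c * (b - a))%:E)%E.
Proof.
move=> ab c0.
transitivity (\int[mu]_(t in `]a, b[) c%:E)%E.
  rewrite [RHS]integral_mkcond; apply: eq_integral => t _.
  by rewrite patchE mem_setE in_itv.
rewrite integral_cst//= lebesgue_measure_itv/= lte_fin EFinM.
case: ltP => // ba; rewrite mule0 (_ : b - a = 0) ?mule0//.
by apply/eqP; rewrite subr_eq0 eq_le ba ab.
Qed.

Lemma iint_box n (a b : nat -> R) : (forall i, a i <= b i) ->
  iint n (fun x => if [forall i : 'I_n, a i < x i < b i] then 1%E else 0%E)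
  = (\prod_(i < n) (b i - a i))%:E.
Proof.
move=> ab; elim: n => [|n IH].
  by rewrite big_ord0 /=; case: forallP => // -[] [].
rewrite big_ord_recr /=.
have p0 : 0 <= \prod_(i < n) (b i - a i) by apply: prodr_ge0 => i _; rewrite subr_ge0.
rewrite -integral_if_itv//.
apply: eq_integral => t _; rewrite -IH.
case: ifPn => tab; last first.
  rewrite (_ : (fun x => _) = fun=> 0%E).
    elim: n {IH p0 tab} => [//|n IH] /=.
    by rewrite integral0_eq.
  apply/funext => x; case: forallP => // /(_ ord_max) /=.
  by rewrite eqxx (negbTE tab).
congr iint; apply/funext => x; congr (if _ then _ else _).
apply/forallP/forallP => [h i|h i].
  have := h (widen_ord (leqnSn n) i); rewrite /= ltn_eqF//.
have [->//|/eqP ni] := eqVneq (nat_of_ord i) n.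
have lin : (i < n)%N by rewrite ltn_neqAle; apply/andP; split; [exact/eqP|rewrite -ltnS].
exact: (h (Ordinal lin)).
Qed.

Variable n : nat.
Local Notation N := n.+1.
Local Notation C := R[i].
Local Notation V := ('I_N -> C).
Local Notation zof := (@z_of R N).
Local Notation l := (@ord_max n).
Implicit Types z w : V.

(** The centre is real and on the last axis because a rotation will have moved the point of interest
    there. The two half-widths accommodate nonisotropic proportions. *)
Lemma iint_box_le (P : V -> bool) (alpha k1 k2 : R) : 0 <= k1 -> 0 <= k2 ->
  (forall z, `|cre (z l) - alpha| < k1 -> `|cim (z l)| < k1 ->
    (forall j, j != l -> `|cre (z j)| < k2 /\ `|cim (z j)| < k2) -> P z) ->
  (((2 * k2) ^+ (2 * n) * (2 * k1) ^+ 2)%:E <=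
   iint (2 * N) (fun x => if P (zof x) then 1 else 0))%E.
Proof.
move=> k10 k20 hP.
pose c i := if i == (2 * n)%N then alpha else 0.
pose r i := if (i < 2 * n)%N then k2 else k1.
have r0 i : 0 <= r i by rewrite /r; case: ifP.
pose a i := c i - r i; pose b i := c i + r i.
rewrite (_ : (_ * _) = \prod_(i < 2 * N) (b i - a i)); last first.
  have br i : b i - a i = 2 * r i by rewrite /a /b; ring.
  under eq_bigr do rewrite br.
  rewrite (_ : 2 * N = (2 * n).+2)%N; last by rewrite mulnS.
  rewrite !big_ord_recr /= /r ltnn ltnNge leqnSn /= -mulrA; congr (_ * _).
  rewrite (eq_bigr (fun=> 2 * k2)) => [|i _]; last by rewrite /= ltn_ord.
  by rewrite prodr_const card_ord.
rewrite -iint_box; last by move=> i; rewrite lerBlDr -addrA lerDl addr_ge0.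
apply: iint_le => x; first by case: ifP.
case: forallP => [h|_]; last by case: ifP.
rewrite hP//.
- have /= := h (Ordinal (double_ord_ltn l).1).
  by rewrite /a /b /c /r /= eqxx ltnn ltr_distl.
- have /= := h (Ordinal (double_ord_ltn l).2).
  rewrite /a /b /c /r /= gtn_eqF// ltnNge leqnSn /= -ltr_distl subr0.
  by [].
- move=> j jl; have jn : (j < n)%N.
    by rewrite ltn_neqAle -(inj_eq val_inj)/= in jl *; rewrite jl -ltnS ltn_ord.
  have jn2 : ((2 * j).+1 < 2 * n)%N by rewrite !mul2n -doubleS leq_double.
  split.
  + have /= := h (Ordinal (double_ord_ltn j).1).
    by rewrite /a /b /c /r /= ltn_eqF ?ltn_pmul2l// jn -ltr_distl subr0.
  + have /= := h (Ordinal (double_ord_ltn j).2).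
    by rewrite /a /b /c /r /= ltn_eqF// jn2 -ltr_distl subr0.
Qed.

Definition ballint (g : V -> \bar R) : \bar R :=
  iint (2 * N) (fun x => if vnorm (zof x) < 1 then g (zof x) else 0%E).

Definition ballvol : R := fine (ballint (fun=> 1%E)).

Lemma nu_intE (g : V -> \bar R) : nu_int g = (ballint g * (ballvol^-1)%:E)%E.
Proof.
rewrite /nu_int /ballvol /ballint; congr (iint _ _ * ((fine (iint _ _))^-1)%:E)%E.
  by apply/funext => x; rewrite /inball asboolb.
by apply/funext => x; rewrite /inball asboolb.
Qed.

Let sqr_le_norm (x k : R) : `|x| <= k -> x ^+ 2 <= k ^+ 2.
Proof.
move=> xk; rewrite -real_normK ?num_real// ler_pXn2r// ?nnegrE//.
exact: le_trans xk.
Qed.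

Lemma vnorm2_le_last (z : V) (k : R) :
  (forall j, j != l -> `|cre (z j)| <= k /\ `|cim (z j)| <= k) ->
  vnorm z ^+ 2 <= cabs (z l) ^+ 2 + 2 * n%:R * k ^+ 2.
Proof.
move=> h; rewrite vnorm2E (bigD1 l)//= lerD2l.
apply: (@le_trans _ _ (\sum_(j < N | j != l) (2 * k ^+ 2))).
  apply: ler_sum => j /h[a b].
  by rewrite cabs2E mulr_natl mulr2n lerD// sqr_le_norm.
rewrite sumr_const (_ : #|_| = n); first by rewrite -mulr_natr; lra.
apply/eqP; rewrite -eqSS; apply/eqP; rewrite -[RHS](card_ord N).
by rewrite -(cardC (pred1 l)) card1 add1n; congr S; apply: eq_card => j.
Qed.

Lemma vnorm2_le (z : V) (k1 k2 : R) :
  `|cre (z l)| <= k1 -> `|cim (z l)| <= k1 ->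
  (forall j, j != l -> `|cre (z j)| <= k2 /\ `|cim (z j)| <= k2) ->
  vnorm z ^+ 2 <= 2 * k1 ^+ 2 + 2 * n%:R * k2 ^+ 2.
Proof.
move=> h1 h2 /vnorm2_le_last h; apply: le_trans h _; rewrite lerD2r.
by rewrite cabs2E mulr_natl mulr2n lerD// sqr_le_norm.
Qed.

Lemma ballvol_fin : (ballint (fun=> 1) < +oo)%E.
Proof.
rewrite /ballint.
apply: (@le_lt_trans _ _ (\prod_(i < 2 * N) (1 - (-1 : R)))%:E); last exact: ltry.
rewrite -(@iint_box _ (fun=> -1) (fun=> 1)); last by move=> _; lra.
apply: iint_le => x; first by case: ifP.
case: ltP => [x1|_]; last by case: forallP.
case: forallP => // -[] i.
have [j hj] : exists j : 'I_N, nat_of_ord i = (2 * j)%N \/ nat_of_ord i = (2 * j).+1.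
  have jN : (i./2 < N)%N by rewrite ltn_half_double -mul2n.
  exists (Ordinal jN) => /=; have := odd_double_half i.
  by rewrite -mul2n; case: (odd i); [right|left].
have h1 := cre_le_cabs (zof x j); have h2 := cim_le_cabs (zof x j).
have h3 := cabs_le_vnorm (zof x) j.
case: hj => ->; rewrite -ltr_norml; apply: le_lt_trans x1.
  exact: le_trans h1 h3.
exact: le_trans h2 h3.
Qed.

Lemma ballvol_gt0 : 0 < ballvol.
Proof.
have h : (0 < ballint (fun=> 1))%E.
  rewrite /ballint.
  (* For this half-side, |z|^2 < 2 N k^2 = k < 1 on the cube. *)
  pose k := (2 * N%:R : R)^-1.
  have k0 : 0 < k by rewrite invr_gt0 mulr_gt0.
  apply: (@lt_le_trans _ _ ((2 * k) ^+ (2 * n) * (2 * k) ^+ 2)%:E).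
    by rewrite lte_fin mulr_gt0// exprn_gt0// mulr_gt0.
  apply: (@iint_box_le (fun z => vnorm z < 1) 0 k k); rewrite ?(ltW k0)// => z.
  rewrite subr0 => h1 h2 h3.
  rewrite -(@ltr_pXn2r _ 2) ?nnegrE ?vnorm_ge0//.
  apply: le_lt_trans (vnorm2_le (k2 := k) (ltW h1) (ltW h2) _) _.
    by move=> j /h3[a b]; split; exact: ltW.
  rewrite expr1n (_ : _ + _ = 2 * N%:R * k * k); last by rewrite -natr1; ring.
  rewrite mulfV ?mul1r; last by rewrite mulf_neq0// pnatr_eq0.
  rewrite /k invf_lt1 ?mulr_gt0//.
  have : (1 : R) <= N%:R by rewrite ler1n.
  by lra.
by rewrite fine_gt0// h ballvol_fin.
Qed.

Lemma zof_scale (k : R) x : zof (scale_below (2 * N) k x) = vscl (rC k) (zof x).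
Proof.
apply/funext => j; have [h1 h2] := double_ord_ltn j.
by apply: eqC; rewrite ?cre_rCM ?cim_rCM /= /scale_below ?h1 ?h2.
Qed.

Definition homog0 (g : V -> \bar R) :=
  forall (k : R) z, 0 < k -> g (vscl (rC k) z) = g z.

(** Dilation by [rho] shows that the ball of radius [rho] carries the fraction [rho ^+ (2 * N)] of
    the integral; finiteness permits the subtraction. This is how spherical means, encoded as ball
    integrals, are read near the sphere. *)
Lemma homog0_shell (g : V -> \bar R) (rho : R) : 0 < rho -> rho <= 1 ->
  homog0 g -> ymeas (g \o zof) -> (forall z, 0 <= g z)%E -> (ballint g < +oo)%E ->
  (iint (2 * N) (fun x => if (rho <= vnorm (zof x) < 1)%R then g (zof x) else 0)
   = (1 - rho ^+ (2 * N))%:E * ballint g)%E.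
Proof.
move=> rho0 rho1 gh mg g0 gfin.
have mv : ymeas (fun x => vnorm (zof x)) by apply: vmeas_norm; exact: vmeas_z_of.
set S := iint _ _.
pose I := iint (2 * N) (fun x => if vnorm (zof x) < rho then g (zof x) else 0%E).
have mI : ymeas (fun x => if vnorm (zof x) < rho then g (zof x) else 0%E).
  apply: ymeas_if; [|exact: mg|exact: ymeas_cst].
  by apply: ymeas_lt => //; exact: ymeas_cst.
have E1 : ballint g = (I + S)%E.
  rewrite /I /S -iintD//.
  - congr iint; apply/funext => x.
    case: (ltP (vnorm (zof x)) rho) => [h|h] /=; last by rewrite add0e.
    by rewrite (lt_le_trans h rho1) adde0.
  - by move=> x; case: ifP.
  - apply: ymeas_if; [|exact: mg|exact: ymeas_cst].
    apply: ymeas_and; last by apply: ymeas_lt => //; exact: ymeas_cst.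
    by apply: ymeas_le => //; exact: ymeas_cst.
  - by move=> x; case: ifP.
have E2 : I = ((rho ^+ (2 * N))%:E * ballint g)%E.
  have := @iint_scale R (2 * N) rho _ rho0 mI.
  rewrite -/I => h; rewrite /ballint.
  rewrite (_ : (fun x => _) =
    fun x => let y := scale_below (2 * N) rho x in
             if vnorm (zof y) < rho then g (zof y) else 0%E).
    rewrite h; last by move=> x; case: ifP.
    by rewrite muleA -EFinM mulfV ?mul1e// expf_neq0// gt_eqF.
  apply/funext => x /=; rewrite zof_scale vnorm_scl cabs_rC gtr0_norm// gh//.
  by rewrite -{2}[rho]mulr1 ltr_pM2l.
have bge0 : (0 <= ballint g)%E by apply: iint_ge0 => x; case: ifP.
have fin : ballint g \is a fin_num by rewrite ge0_fin_numE.
move: E1; rewrite E2; move: fin; case: (ballint g) => // i _.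
case: S => [s| |] //; rewrite -!EFinM -EFinD => -[E]; congr EFin.
by rewrite mulrBl mul1r {1}E; ring.
Qed.

End BallIntegrals.

(** * One-dimensional integrals of real powers, and positivity of Gamma *)

Section PowerIntegrals.
Variable R : realType.
Local Notation mu := (@lebesgue_measure R).

Lemma ge0_integral_opp (f : R -> \bar R) :
  measurable_fun [set: R] f -> (forall r, 0 <= f r)%E ->
  (\int[mu]_t f (- t)%R = \int[mu]_t f t)%E.
Proof.
move=> mf f0.
have m1 : measurable_fun [set: measurableTypeR R] ((fun t => - t) : measurableTypeR R -> measurableTypeR R).
  exact: oppr_measurable.
rewrite [LHS](_ : _ = \int[mu]_(t in (fun t => - t)%R @^-1` [set: R]) (f \o (fun t => - t)%R) t)%E//.
rewrite -(@ge0_integral_pushforward _ _ _ _ _ _ m1 mu setT f)//.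
by apply: eq_measure_integral => //= A mA AS; rewrite -[RHS]lebesgue_measureN.
Qed.

Lemma continuous_powR_pos (g x : R) : 0 < x -> {for x, continuous (fun t : R => t `^ g)}.
Proof.
move=> x0; apply: differentiable_continuous; apply/derivable1_diffP.
by apply: derivable_powR; rewrite in_itv/= x0.
Qed.

Lemma integral_powR_itv (g a b : R) : g + 1 != 0 -> 0 < a -> a < b ->
  (\int[mu]_(t in `[a, b]) (t `^ g)%:E =
   ((b `^ (g + 1) - a `^ (g + 1)) / (g + 1))%:E)%E.
Proof.
move=> g0 a0 ab.
pose F t := t `^ (g + 1) / (g + 1).
have dF (x : R) : 0 < x -> is_derive x 1 F (x `^ g).
  move=> x0.
  have h : is_derive x 1 (fun t : R => t `^ (g + 1)) ((g + 1) * x `^ (g + 1 - 1)).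
    exact: is_derive1_powR.
  have -> : F = (g + 1)^-1 \*: (fun t : R => t `^ (g + 1)).
    by apply/funext => t; rewrite /F /= /GRing.scale/= mulrC.
  apply: is_derive_eq.
  by rewrite /GRing.scale /= mulrA mulVf// mul1r addrK.
have cF (x : R) : 0 < x -> {for x, continuous F}.
  move=> x0; apply: differentiable_continuous; apply/derivable1_diffP.
  exact: (@ex_derive _ _ _ _ _ _ _ (dF x x0)).
rewrite (@continuous_FTC2 _ _ F)//.
- by rewrite -EFinB /F -mulrBl.
- apply: continuous_in_subspaceT => x; rewrite inE/= in_itv/= => /andP[ax _].
  by apply: continuous_powR_pos; exact: lt_le_trans ax.
- split => [x||].
  + rewrite in_itv/= => /andP[ax _]; apply: ex_derive.
    exact: dF (lt_trans a0 ax).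
  + exact/cvg_at_right_filter/cF.
  + exact/cvg_at_left_filter/cF/(lt_trans a0 ab).
- move=> x; rewrite in_itv/= => /andP[ax _].
  by rewrite derive1E; apply: derive_val; exact: dF (lt_trans a0 ax).
Qed.

Lemma measurable_powR_EFin (D : set R) (g : R) :
  measurable_fun D (fun t : R => (t `^ g)%:E).
Proof.
apply/measurable_EFinP; apply: measurable_funTS; exact: measurable_powR.
Qed.

(** Monotone convergence along an exhaustion; it carries bounds on compact intervals over to
    improper integrals. *)
Lemma ge0_integral_le_nondecr (F : (set R)^nat) (f : R -> \bar R) (M : \bar R) :
  nondecreasing_seq F -> (forall i, measurable (F i)) ->
  measurable_fun [set: R] f -> (forall x, 0 <= f x)%E ->
  (forall i, \int[mu]_(x in F i) f x <= M)%E ->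
  (\int[mu]_(x in \bigcup_i F i) f x <= M)%E.
Proof.
move=> ndF mF mf f0 fM.
have h : (\int[mu]_(x in F i) f x @[i --> \oo] --> \int[mu]_(x in \bigcup_i F i) f x)%E.
  by apply: ge0_nondecreasing_set_cvg_integral => // i; exact: measurable_funTS.
rewrite -(cvg_lim (@ereal_hausdorff R) h).
by apply: lime_le; [apply/cvg_ex; eexists; exact: h|apply: nearW].
Qed.

Lemma integral_powR_near0 (g b : R) : -1 < g -> 0 < b ->
  (\int[mu]_t (if (0 < t < b)%R then (t `^ g)%:E else 0) <=
   (b `^ (g + 1) / (g + 1))%:E)%E.
Proof.
move=> g1 b0.
have g0 : 0 < g + 1 by lra.
(* The shift [k.+2] keeps the left end strictly below [b] already for [k = 0]. *)
pose F k := `[b / k.+2%:R, b]%classic : set R.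
have mp := @measurable_powR_EFin setT g.
apply: (@le_trans _ _ (\int[mu]_(x in \bigcup_i F i) (x `^ g)%:E)%E).
  rewrite [leRHS]integral_mkcond; apply: ge0_le_integral_nomeas => t.
    by case: ifP => // _; rewrite lee_fin powR_ge0.
  case: ifPn => [/andP[t0 tb]|_].
    rewrite patchE ifT// inE; exists (Num.trunc (b / t)) => //.
    rewrite /F /= in_itv/= (ltW tb) andbT ler_pdivrMr// -ler_pdivrMl// mulrC.
    have := truncnS_gt (b / t); rewrite -[(Num.trunc _).+2%:R]natr1.
    by lra.
  by rewrite patchE; case: ifP => // _; rewrite lee_fin powR_ge0.
apply: ge0_integral_le_nondecr => //.
- move=> i j ij; apply/subsetPset => t; rewrite /F /= !in_itv/= => /andP[h ->].
  rewrite andbT; apply: le_trans h; rewrite ler_pM2l// lef_pV2 ?posrE//.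
  by rewrite ler_nat.
- by move=> i; exact: measurable_itv.
- by move=> x; rewrite lee_fin powR_ge0.
- move=> k; rewrite /F integral_powR_itv ?gt_eqF//.
  + by rewrite lee_fin ler_pM2r ?invr_gt0// gerBl powR_ge0.
  + by rewrite divr_gt0.
  + by rewrite ltr_pdivrMr// ltr_pMr// ltr1n.
Qed.

Lemma integral_powR_tail (g c : R) : g < -1 -> 0 < c ->
  (\int[mu]_t (if (c < t)%R then (t `^ g)%:E else 0) <=
   (c `^ (g + 1) / - (g + 1))%:E)%E.
Proof.
move=> g1 c0.
have g0 : g + 1 < 0 by lra.
pose F k := `[c, c + k.+1%:R]%classic : set R.
have mp := @measurable_powR_EFin setT g.
apply: (@le_trans _ _ (\int[mu]_(x in \bigcup_i F i) (x `^ g)%:E)%E).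
  rewrite [leRHS]integral_mkcond; apply: ge0_le_integral_nomeas => t.
    by case: ifP => // _; rewrite lee_fin powR_ge0.
  case: ifPn => [t0|_].
    rewrite patchE ifT// inE; exists (Num.trunc (t - c)) => //.
    rewrite /F /= in_itv/= (ltW t0) /=.
    by have := truncnS_gt (t - c); lra.
  by rewrite patchE; case: ifP => // _; rewrite lee_fin powR_ge0.
apply: ge0_integral_le_nondecr => //.
- move=> i j ij; apply/subsetPset => t; rewrite /F /= !in_itv/= => /andP[-> h].
  by apply: le_trans h _; rewrite lerD2l ler_nat.
- by move=> i; exact: measurable_itv.
- by move=> x; rewrite lee_fin powR_ge0.
- move=> k; rewrite /F integral_powR_itv ?lt_eqF//; last first.
    by rewrite ltrDl.
  rewrite lee_fin -mulrNN -invrN opprB ler_pM2r ?invr_gt0 ?oppr_gt0//.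
  by rewrite gerBl powR_ge0.
Qed.

Lemma measurable_if_itv_powR (g a b : R) :
  measurable_fun [set: R] (fun t : R => if (a < t < b)%R then (t `^ g)%:E else 0%E).
Proof.
apply: measurable_fun_ifT.
- by apply: measurable_and; apply: measurable_fun_ltr.
- exact: measurable_powR_EFin.
- exact: measurable_cst.
Qed.

Lemma measurable_if_gt_powR (g a : R) :
  measurable_fun [set: R] (fun t : R => if (a < t)%R then (t `^ g)%:E else 0%E).
Proof.
apply: measurable_fun_ifT; first exact: measurable_fun_ltr.
- exact: measurable_powR_EFin.
- exact: measurable_cst.
Qed.

(** For [k > 0], exp t is the [k]-th power of exp (t / k), which is at least t / k. *)
Lemma exprn_expRN_le (k : nat) (t : R) : 0 <= t -> t ^+ k * expR (- t) <= k%:R ^+ k.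
Proof.
case: k => [|k] t0; first by rewrite !expr0 mul1r -expR0 ler_expR oppr_le0.
have k0 : (0 : R) < k.+1%:R by rewrite ltr0n.
rewrite expRN ler_pdivrMr ?expR_gt0//.
rewrite (_ : expR t = expR (t / k.+1%:R) ^+ k.+1); last first.
  by rewrite -expRM_natl mulrC divfK// gt_eqF.
rewrite -exprMn lerXn2r ?nnegrE ?mulr_ge0 ?expR_ge0//.
rewrite mulrC -ler_pdivrMr//; by apply: le_trans (expR_ge1Dx _); rewrite lerDr.
Qed.

(** [fine] sends an infinite integral to 0, so positivity includes finiteness: below 2 the integrand
    is at most t^(x - 1), and beyond 2 at most a multiple of t^-2. *)
Lemma Gamma_gt0 (x : R) : 0 < x -> 0 < Gamma x.
Proof.
move=> x0.
pose f (t : R) : \bar R := (t `^ (x - 1) * expR (- t))%:E.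
have fE : (\int[mu]_(t in [set t : R | (0 < t)%R]) f t =
           \int[mu]_t (if (0 < t)%R then f t else 0))%E.
  by rewrite integral_mkcond; apply: eq_integral => t _; rewrite patchE mem_setE.
rewrite /Gamma fE; apply: fine_gt0; apply/andP; split.
- apply: (@lt_le_trans _ _ (\int[mu]_t (if (1 < t < 2)%R then
      (Num.min 1 (2 `^ (x - 1)) * expR (- 2))%:E else 0))%E).
    rewrite integral_if_itv; [|lra|].
      by rewrite lte_fin mulr_gt0 ?mulr_gt0 ?expR_gt0 ?lt_min ?ltr01 ?powR_gt0//; lra.
    by rewrite mulr_ge0 ?expR_ge0// le_min ler01 powR_ge0.
  apply: ge0_le_integral_nomeas => t.
    by case: ifP => // _; rewrite lee_fin mulr_ge0 ?expR_ge0// le_min ler01 powR_ge0.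
  case: ifPn => [/andP[t1 t2]|_]; last first.
    by case: ifP => // _; rewrite lee_fin mulr_ge0 ?expR_ge0 ?powR_ge0.
  rewrite (lt_trans ltr01 t1) lee_fin ler_pM ?expR_ge0//.
  + rewrite ge_min; have [x1|x1] := leP 1 x.
      apply/orP; left; rewrite -[leLHS](powRr0 t); apply: ler_powR; [exact: ltW|lra].
    apply/orP; right; rewrite -[x - 1]opprK powRN [leRHS]powRN lef_pV2 ?posrE ?powR_gt0//; [|lra].
    apply: ge0_ler_powR; rewrite ?nnegrE ?(ltW t2)//; first lra.
    exact/ltW/(lt_trans ltr01).
  + by rewrite ler_expR lerN2 ltW.
- have [k kx] : exists k : nat, x + 1 <= k%:R.
    by exists (Num.trunc (x + 1)).+1; apply: ltW; exact: truncnS_gt.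
  pose K : R := k%:R ^+ k.
  have K0 : 0 <= K by rewrite exprn_ge0.
  pose f1 (t : R) : \bar R := if (0 < t < 2)%R then (t `^ (x - 1))%:E else 0%E.
  pose f2 (t : R) : \bar R := if (1 < t)%R then (t `^ (- 2))%:E else 0%E.
  have f10 t : (0 <= f1 t)%E by rewrite /f1; case: ifP => // _; rewrite lee_fin powR_ge0.
  have f20 t : (0 <= f2 t)%E by rewrite /f2; case: ifP => // _; rewrite lee_fin powR_ge0.
  apply: (@le_lt_trans _ _ (\int[mu]_t (f1 t + K%:E * f2 t))%E).
    apply: ge0_le_integral_nomeas => t.
      by case: ifP => // _; rewrite lee_fin mulr_ge0 ?expR_ge0 ?powR_ge0.
    case: ifPn => [t0|_]; last by rewrite adde_ge0// mule_ge0.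
    have [t2|t2] := ltP t 2.
      rewrite -[f t]adde0 leeD ?mule_ge0// /f1 t0 t2 /= lee_fin.
      rewrite ler_piMr ?powR_ge0// -expR0 ler_expR oppr_le0 ltW//.
    rewrite -[f t]add0e leeD// /f2 (lt_le_trans _ t2) ?ltr1n// -EFinM lee_fin.
    apply: (@le_trans _ _ (t `^ (- 2) * (t ^+ k * expR (- t)))).
      rewrite mulrA ler_wpM2r ?expR_ge0// -powR_mulrn ?(ltW t0)//.
      rewrite -powRD; last by rewrite (gt_eqF t0) implybT.
      by apply: ler_powR; [apply: le_trans t2; rewrite ler1n|lra].
    by rewrite mulrC ler_wpM2r ?powR_ge0// exprn_expRN_le// ltW.
  rewrite ge0_integralD//.
  + rewrite ge0_integralZl_EFin//; last exact: measurable_if_gt_powR.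
    rewrite lte_add_pinfty//.
      by apply: (le_lt_trans (integral_powR_near0 _ _)); rewrite ?ltry//; lra.
    have := @integral_powR_tail (- 2) 1; rewrite -/f2 => h.
    apply: lte_mul_pinfty; rewrite ?lee_fin//.
    by apply: (le_lt_trans (h _ _)); rewrite ?ltry//; lra.
  + exact: measurable_if_itv_powR.
  + by move=> t _; rewrite mule_ge0.
  + by apply: measurable_funeM; exact: measurable_if_gt_powR.
Qed.

Lemma integral_powR_sqr (g : R) : -1 < g -> exists2 c, 0 <= c & forall A : R, 0 < A ->
  (\int[mu]_t (if (t ^+ 2 < A)%R then ((A - t ^+ 2) `^ g)%:E else 0) <=
   (c * A `^ (g + 2^-1))%:E)%E.
Proof.
move=> g1; have g0 : 0 < g + 1 by lra.
pose M : R := Num.max 1 (2 `^ g).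
have M0 : 0 <= M by rewrite le_max ler01.
exists (M * 2 * (2 `^ (g + 1) / (g + 1))).
  apply: mulr_ge0; first exact: mulr_ge0.
  by rewrite divr_ge0 ?powR_ge0// ltW.
move=> A A0; pose r := Num.sqrt A.
have r0 : 0 < r by rewrite sqrtr_gt0.
have rA : r ^+ 2 = A by rewrite sqr_sqrtr// ltW.
pose h (u : R) : \bar R := if (0 < u < 2 * r)%R then (u `^ g)%:E else 0%E.
have h0 u : (0 <= h u)%E by rewrite /h; case: ifP => // _; rewrite lee_fin powR_ge0.
have mh : measurable_fun [set: R] h by exact: measurable_if_itv_powR.
have mh1 : measurable_fun [set: measurableTypeR R] (fun t : R => h (t + r)%R).
  by apply: (measurableT_comp mh); exact: measurable_funD.
have mh2 : measurable_fun [set: measurableTypeR R] (fun t : R => h (- t + r)%R).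
  by apply: (measurableT_comp mh1); exact: oppr_measurable.
have mh12 : measurable_fun [set: measurableTypeR R] (fun t : R => h (t + r)%R + h (- t + r)%R)%E.
  exact: emeasurable_funD.
have c0 : 0 <= M * r `^ g by rewrite mulr_ge0// powR_ge0.
apply: (@le_trans _ _ (\int[mu]_t ((M * r `^ g)%:E * (h (t + r)%R + h (- t + r)%R)))%E).
  apply: ge0_le_integral_nomeas => t.
    by case: ifP => // _; rewrite lee_fin powR_ge0.
  case: ifPn => [tA|_]; last by rewrite mule_ge0// ?lee_fin// adde_ge0.
  have : `|t| < r by rewrite -[r]ger0_norm ?ltW// -ltr_sqr ?nnegrE// !real_normK ?num_real// rA.
  rewrite ltr_norml => /andP[t1 t2].
  have key (s : R) : 0 <= s -> s < r -> (A - s ^+ 2) `^ g <= M * r `^ g * (r - s) `^ g.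
    move=> s0 sr.
    rewrite (_ : A - s ^+ 2 = r * ((1 + s / r) * (r - s))); last first.
      by rewrite -rA; field; rewrite gt_eqF.
    have sr0 : 0 <= s / r by rewrite divr_ge0// ltW.
    have sr1 : s / r <= 1 by rewrite ler_pdivrMr// mul1r ltW.
    rewrite powRM ?(ltW r0)//; last by rewrite mulr_ge0//; lra.
    rewrite powRM; [|lra|lra].
    rewrite [M * _]mulrC -mulrA ler_wpM2l ?powR_ge0// ler_wpM2r ?powR_ge0//.
    rewrite le_max; have [gp|gn] := leP 0 g.
      apply/orP; right; apply: ge0_ler_powR; rewrite ?nnegrE//; lra.
    apply/orP; left; rewrite -[leRHS](powRr0 (1 + s / r)); apply: ler_powR; lra.
  have [t0|t0] := leP 0 t.
    apply: (@le_trans _ _ ((M * r `^ g)%:E * h (- t + r)%R)%E).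
      rewrite /h ifT; last by apply/andP; split; lra.
      by rewrite -EFinM lee_fin [- t + r]addrC key.
    by rewrite lee_wpmul2l ?lee_fin// leeDr.
  apply: (@le_trans _ _ ((M * r `^ g)%:E * h (t + r)%R)%E).
    rewrite /h ifT; last by apply/andP; split; lra.
    have := key (- t); rewrite sqrrN opprK [r + t]addrC => k.
    by rewrite -EFinM lee_fin k//; lra.
  by rewrite lee_wpmul2l ?lee_fin// leeDl.
rewrite ge0_integralZl_EFin//; last by move=> t _; exact: adde_ge0.
rewrite ge0_integralD//.
rewrite (@ge0_integral_opp (fun t => h (t + r)%R))//.
rewrite (@ge0_integral_shift _ h r)//.
have hI : (\int[mu]_t h t <= ((2 * r) `^ (g + 1) / (g + 1))%:E)%E.
  by apply: integral_powR_near0 => //; rewrite mulr_gt0.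
apply: (@le_trans _ _ ((M * r `^ g)%:E *
  (((2 * r) `^ (g + 1) / (g + 1))%:E + ((2 * r) `^ (g + 1) / (g + 1))%:E))%E).
  by rewrite lee_wpmul2l ?lee_fin// leeD.
rewrite -EFinD -EFinM lee_fin powRM ?(ltW r0)//.
rewrite (_ : A `^ (g + 2^-1) = r `^ g * r `^ (g + 1)).
  by rewrite le_eqVlt; apply/orP; left; apply/eqP; field; rewrite gt_eqF.
rewrite -powRD; last by rewrite (gt_eqF r0) implybT.
rewrite -rA -powR_mulrn ?(ltW r0)// -powRrM; by congr (_ `^ _); field.
Qed.

End PowerIntegrals.

(** * Norms dominate local lower bounds on nonisotropic boxes *)

Section NormLowerBound.
Variables (R : realType) (n : nat).
Local Notation N := n.+1.
Local Notation C := R[i].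
Local Notation V := ('I_N -> C).
Local Notation zof := (@z_of R N).
Local Notation l := (@ord_max n).
Implicit Types z w : V.

(** The exponent [s] for which (1 - <z, w>)^(-s) is the reproducing kernel of the space. *)
Definition kernel_exponent (H : fspace R) : R :=
  match H with Hardy => N%:R | Bergman a => N%:R + 1 + a end.

Definition gap w : R := 1 - vnorm w ^+ 2.

(* Nonisotropic box: size [gap w] in the complex direction of [w], and
   [sqrt (gap w)] in the orthogonal directions. *)
Definition koranyi_box (eps : R) w z : bool :=
  (cabs (inner (vsub z w) w) <= eps * gap w) &&
  (vnorm (vsub z w) ^+ 2 <= eps * gap w).

(** |z|^2 - |w|^2 = 2 Re <z - w, w> + |z - w|^2 is at most 3 eps times the gap in modulus, by the
    two conditions that define the box. *)
Lemma gap_box eps w z : eps <= 8^-1 -> vnorm w < 1 -> koranyi_box eps w z ->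
  gap w / 2 <= gap z <= 3 / 2 * gap w.
Proof.
move=> e8 w1 /andP[h1 h2].
have g0 : 0 < gap w by rewrite subr_gt0 expr_lt1// vnorm_ge0.
have zE : vnorm z ^+ 2 = vnorm w ^+ 2 + 2 * cre (inner (vsub z w) w) + vnorm (vsub z w) ^+ 2.
  rewrite (vnorm2_sub z w) inner_subl creD creN inner_self /=; ring.
have := le_trans (cre_le_cabs _) h1; rewrite ler_norml => /andP[h3 h4].
have h5 : eps * gap w <= 8^-1 * gap w by rewrite ler_pM2r.
have h6 : 0 <= vnorm (vsub z w) ^+ 2 by exact: sqr_ge0.
have -> : gap z = gap w - (vnorm z ^+ 2 - vnorm w ^+ 2) by rewrite /gap; ring.
by rewrite zE; apply/andP; split; lra.
Qed.

Lemma koranyi_boxU U eps w z : isU U ->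
  koranyi_box eps (U w) (U z) = koranyi_box eps w z.
Proof.
move=> [hU _]; rewrite /koranyi_box.
have vU y : vnorm (U y) ^+ 2 = vnorm y ^+ 2.
  by have /(congr1 (@cre R)) := hU y y; rewrite !inner_self.
have h1 : inner (vsub (U z) (U w)) (U w) = inner (vsub z w) w.
  by rewrite (inner_subl (U z)) (inner_subl z) (hU z w) (hU w w).
have h2 : vnorm (vsub (U z) (U w)) ^+ 2 = vnorm (vsub z w) ^+ 2.
  by rewrite (vnorm2_sub (U z)) (vnorm2_sub z) (vU z) (vU w) (hU z w).
by rewrite /gap h1 h2 vU.
Qed.

Lemma vnormU U z : isU U -> vnorm (U z) = vnorm z.
Proof.
move=> [hU _]; apply/eqP; rewrite -(@eqrXn2 _ 2)// ?vnorm_ge0//; apply/eqP.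
by have /(congr1 (@cre R)) := hU z z; rewrite !inner_self.
Qed.

Definition axis (t : R) : V := fun j => if j == l then rC t else 0.

Lemma inner_axis z t : inner z (axis t) = rC t * z l.
Proof.
rewrite /inner (bigD1 l)//= /axis eqxx cconj_rC big1 ?addr0 1?mulrC//.
by move=> j /negbTE ->; rewrite [cconj 0](_ : _ = 0) ?mulr0//= /cconj /= oppr0.
Qed.

Lemma vnorm_axis t : vnorm (axis t) = `|t|.
Proof.
apply/eqP; rewrite -(@eqrXn2 _ 2)// ?vnorm_ge0//; apply/eqP.
have /(congr1 (@cre R)) := inner_self (axis t).
rewrite inner_axis /axis eqxx -rCM /= => <-.
by rewrite real_normK ?num_real.
Qed.

Lemma koranyi_box_meas F eps w : vmeas F -> ymeas (fun x => koranyi_box eps w (F x)).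
Proof.
move=> mF.
have mS : vmeas (fun x => vsub (F x) w).
  by move=> j; apply: cmeasB => //; exact: cmeas_cst.
apply: ymeas_and; apply: ymeas_le; try exact: ymeas_cst.
  by apply: cmeas_abs; exact: vmeas_inner.
by apply: ymeasX; exact: vmeas_norm.
Qed.

Lemma box_volume_eq (k d : R) : 0 <= d ->
  (2 * (k * Num.sqrt d)) ^+ (2 * n) * (2 * (k * d)) ^+ 2 =
  (2 * k) ^+ (2 * N) * d ^+ N.+1.
Proof.
move=> d0; rewrite mulrA exprMn [Num.sqrt d ^+ _]exprM sqr_sqrtr//.
rewrite (mulnS 2 n) (_ : d ^+ N.+1 = d ^+ 2 * d ^+ n); last by rewrite -exprD.
by rewrite exprD; ring.
Qed.

Hypothesis N_gt1 : (1 < N)%N.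

(** Once [w] is rotated onto the last axis, the box contains a coordinate box with half-widths of
    order gap in the last complex coordinate and sqrt(gap) in the [n] others: the volume has order
    gap^2 gap^n. *)
Lemma koranyi_box_volume eps w : 0 < eps -> eps <= 1 -> vnorm w < 1 ->
  (((eps / N%:R) ^+ (2 * N) * gap w ^+ N.+1)%:E <=
   iint (2 * N) (fun x => if koranyi_box eps w (zof x) then 1 else 0))%E.
Proof.
move=> e0 e1 w1.
have g0 : 0 < gap w by rewrite subr_gt0 expr_lt1// vnorm_ge0.
have g1 : gap w <= 1 by rewrite lerBlDr lerDl sqr_ge0.
have [U [hU Uw]] := exists_rotation l w N_gt1.
set r := vnorm w in Uw g0 g1 *.
have {}Uw : U w = axis r by rewrite Uw.
pose g z : \bar R := if koranyi_box eps (axis r) z then 1%E else 0%E.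
have g_ge0 z : (0 <= g z)%E by rewrite /g; case: ifP.
have mg : ymeas (g \o zof).
  apply: ymeas_if; try exact: ymeas_cst.
  exact/koranyi_box_meas/vmeas_z_of.
have [_] := hU.2 g mg g_ge0.
rewrite (_ : g \o U \o zof = fun x => if koranyi_box eps w (zof x) then 1%E else 0%E); last first.
  by apply/funext => x; rewrite /= /g -Uw koranyi_boxU.
move=> ->.
have gapE : gap (axis r) = gap w by rewrite /gap vnorm_axis ger0_norm ?vnorm_ge0.
have N0 : (0 : R) < N%:R by rewrite ltr0n.
(* Chosen so that 2 k N = eps, which absorbs the sum over the [N] coordinates in |z - w|^2. *)
pose k := eps / (2 * N%:R).
have k0 : 0 < k by rewrite divr_gt0// mulr_gt0.
have kN : 2 * k * N%:R = eps.
  by move: N0; rewrite /k; move: (N%:R : R) => M M0; field; rewrite gt_eqF.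
have k2N : 2 * k = eps / N%:R by rewrite -kN mulfK// gt_eqF.
rewrite -k2N -(@box_volume_eq k (gap w) (ltW g0)).
have N1 : (1 : R) <= N%:R by rewrite ler1n.
have k_le1 : k <= 1 by rewrite /k ler_pdivrMr ?mulr_gt0//; lra.
clearbody k.
apply: (@iint_box_le R n (koranyi_box eps (axis r)) r) => [||z h1 h2 h3].
- by rewrite mulr_ge0 ?ltW.
- by rewrite mulr_ge0 ?sqrtr_ge0 ?ltW.
have ul : vsub z (axis r) l = z l - rC r by rewrite /vsub /axis eqxx.
have uj j : j != l -> vsub z (axis r) j = z j.
  by rewrite /vsub /axis => /negbTE ->; rewrite subr0.
have a1 : `|cre (vsub z (axis r) l)| < k * gap w by rewrite ul creD creN.
have a2 : `|cim (vsub z (axis r) l)| < k * gap w by rewrite ul cimD cimN /= subr0.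
have k1 : k * gap w <= 2^-1 * eps * gap w.
  rewrite ler_pM2r// -kN; have := mulr_ge0 (ltW k0) (_ : 0 <= N%:R - 1 :> R).
  by rewrite subr_ge0 => /(_ N1); lra.
rewrite /koranyi_box gapE inner_axis cabsM cabs_rC; apply/andP; split.
  apply: (@le_trans _ _ (cabs (vsub z (axis r) l))).
    by rewrite ler_piMl ?cabs_ge0// ger0_norm ?vnorm_ge0// ltW.
  apply: le_trans (cabs_le_reim _) _; lra.
apply: le_trans (@vnorm2_le _ _ _ (k * gap w) (k * Num.sqrt (gap w)) _ _ _) _.
- exact: ltW.
- exact: ltW.
- by move=> j jl; have [b1 b2] := h3 j jl; rewrite uj//; split; exact: ltW.
rewrite !exprMn sqr_sqrtr ?(ltW g0)//.
have : k ^+ 2 * gap w ^+ 2 <= k ^+ 2 * gap w.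
  by rewrite ler_wpM2l ?sqr_ge0// expr2 ler_piMl// ltW.
have : 2 * k ^+ 2 * N%:R * gap w <= eps * gap w.
  rewrite ler_pM2r// (_ : _ * N%:R = k * (2 * k * N%:R)); last by ring.
  by rewrite kN ler_piMl// ltW.
have -> : N%:R = n%:R + 1 :> R by rewrite natr1.
move: (gap w) (n%:R : R) => d m A B.
by lra.
Qed.

Lemma gap_gt0 w : vnorm w < 1 -> 0 < gap w.
Proof. by move=> w1; rewrite subr_gt0 expr_lt1// vnorm_ge0. Qed.

Lemma gap_gt0P w : 0 < gap w -> vnorm w < 1.
Proof. by rewrite subr_gt0 expr_lt1// vnorm_ge0. Qed.

Lemma gap_le1 w : gap w <= 1.
Proof. by rewrite lerBlDr lerDl sqr_ge0. Qed.

Lemma koranyi_box_ball eps w z : eps <= 8^-1 -> vnorm w < 1 ->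
  koranyi_box eps w z -> vnorm z < 1.
Proof.
move=> e8 w1 /(gap_box e8 w1)/andP[h _]; apply: gap_gt0P; apply: lt_le_trans h.
by rewrite divr_gt0// gap_gt0.
Qed.

Definition bergman_cst (a : R) : R :=
  Gamma (N%:R + a + 1) / (Gamma (N%:R + 1) * Gamma (a + 1)).

Lemma bergman_cst_gt0 a : -1 < a -> 0 < bergman_cst a.
Proof.
move=> a1; have N0 : (0 : R) <= N%:R by [].
by rewrite divr_gt0 ?mulr_gt0// ?Gamma_gt0//; lra.
Qed.

Lemma powR_comparable (a d y : R) : 0 < d -> d / 2 <= y <= 3 / 2 * d ->
  Num.min (powR 2^-1 a) (powR (3 / 2) a) * powR d a <= powR y a.
Proof.
move=> d0 /andP[y1 y2].
have y0 : 0 < y by apply: lt_le_trans y1; rewrite divr_gt0.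
have [a0|a0] := leP 0 a.
  apply: (@le_trans _ _ (powR (d / 2) a)); last first.
    by apply: ge0_ler_powR => //; rewrite nnegrE ltW// divr_gt0.
  rewrite mulrC powRM ?invr_ge0 ?(ltW d0)// ler_wpM2l ?powR_ge0//.
  by rewrite ge_min lexx.
apply: (@le_trans _ _ (powR (3 / 2 * d) a)).
  by rewrite [leRHS]powRM ?(ltW d0)// ?divr_ge0// ler_wpM2r ?powR_ge0// ge_min lexx orbT.
rewrite -[a]opprK powRN [leRHS]powRN lef_pV2 ?posrE ?powR_gt0 ?mulr_gt0 ?divr_gt0//.
by apply: ge0_ler_powR; rewrite ?nnegrE ?oppr_ge0 ?(ltW a0) ?(ltW y0)// ltW// mulr_gt0 ?divr_gt0.
Qed.

Lemma box_cst_gt0 (eps : R) : 0 < eps -> 0 < (eps / N%:R) ^+ (2 * N).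
Proof. by move=> e0; rewrite exprn_gt0// divr_gt0. Qed.

(** The exponent adds the volume of the box, gap^(N + 1), to the weight, which by [gap_box] is
    comparable to gap^a on the whole box. *)
Lemma norm2_lower_bergman a eps : -1 < a -> 0 < eps -> eps <= 8^-1 ->
  exists2 c, 0 < c & forall w (f : V -> C) b, vnorm w < 1 -> 0 <= b ->
    (forall z, vnorm z < 1 -> koranyi_box eps w z -> b <= cabs (f z) ^+ 2) ->
    ((c * b * powR (gap w) (N%:R + 1 + a))%:E <= norm2 (Bergman a) f)%E.
Proof.
move=> a1 e0 e8.
pose m := Num.min (powR (2^-1 : R) a) (powR (3 / 2) a).
have m0 : 0 < m by rewrite lt_min !powR_gt0//= divr_gt0.
have v0 := ballvol_gt0 R n.
have bc0 := bergman_cst_gt0 a1.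
exists ((eps / N%:R) ^+ (2 * N) * bergman_cst a * m / ballvol R n).
  by rewrite divr_gt0// mulr_gt0// mulr_gt0// box_cst_gt0.
move=> w f b w1 b0 hf; have g0 := gap_gt0 w1.
rewrite /= nu_intE.
pose K := b * (bergman_cst a * (m * powR (gap w) a)).
have K0 : 0 <= K.
  by rewrite mulr_ge0// mulr_ge0 ?(ltW bc0)// mulr_ge0 ?powR_ge0// (ltW m0).
rewrite (_ : _ * powR _ _ = K * ((eps / N%:R) ^+ (2 * N) * gap w ^+ N.+1) / ballvol R n); last first.
  rewrite powRD; last by rewrite (gt_eqF g0) implybT.
  by rewrite (_ : N%:R + 1 = N.+1%:R) ?natr1// powR_mulrn ?(ltW g0)// /K; ring.
rewrite [leLHS]EFinM lee_pmul2r ?lte_fin ?invr_gt0//.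
rewrite EFinM; apply: (@le_trans _ _ (K%:E *
   iint (2 * N) (fun x => if koranyi_box eps w (zof x) then 1 else 0))%E).
  by rewrite lee_wpmul2l ?lee_fin// koranyi_box_volume//; lra.
rewrite -iintZ//; last 2 first.
- apply: ymeas_if; try exact: ymeas_cst.
  exact/koranyi_box_meas/vmeas_z_of.
- by move=> x; case: ifP.
apply: iint_le => x; first by rewrite mule_ge0 ?lee_fin//; case: ifP.
case: ifPn => [hb|_]; last first.
  rewrite mule0; case: ifP => // _; rewrite lee_fin mulr_ge0 ?sqr_ge0//.
  by rewrite mulr_ge0 ?powR_ge0// ltW.
rewrite mule1 (koranyi_box_ball e8 w1 hb) lee_fin /K.
apply: ler_pM => //.
- by rewrite mulr_ge0 ?(ltW bc0)// mulr_ge0 ?powR_ge0// (ltW m0).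
- by apply: hf => //; exact: koranyi_box_ball hb.
rewrite /bergman_weight -/(bergman_cst a) ler_pM2l//.
exact: powR_comparable (gap_box e8 w1 hb).
Qed.

Lemma one_minus_exprn_le (x : R) m : 0 <= x -> x <= 1 -> 1 - x ^+ m <= m%:R * (1 - x).
Proof.
move=> x0 x1; elim: m => [|m IH]; first by rewrite expr0 subrr mul0r.
rewrite exprS -natr1 mulrDl mul1r.
have : x * (1 - x ^+ m) <= 1 - x ^+ m.
  by rewrite ler_piMl// subr_ge0 exprn_ile1.
by lra.
Qed.

Definition normalize z : V := fun j => z j * rC (vnorm z)^-1.

Lemma normalizeE z : normalize z = vscl (rC (vnorm z)^-1) z.
Proof. by apply/funext => j; rewrite /vscl mulrC. Qed.

Lemma vnorm_normalize z : 0 < vnorm z -> vnorm (normalize z) = 1.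
Proof.
by move=> z0; rewrite normalizeE vnorm_scl cabs_rC ger0_norm ?mulVf ?gt_eqF// invr_ge0 ltW.
Qed.

Lemma normalize_scl (k : R) z : 0 < k -> normalize (vscl (rC k) z) = normalize z.
Proof.
move=> k0; apply/funext => j.
rewrite /normalize vnorm_scl cabs_rC gtr0_norm// invfM rCM /vscl.
rewrite -[in RHS](mul1r (z j)) -[1](_ : rC k * rC k^-1 = 1); first by ring.
by rewrite -rCM mulfV ?gt_eqF.
Qed.

Lemma koranyi_box_normalizeU U eps w z : isU U ->
  koranyi_box eps (U w) (vscl (rC (vnorm (U w))) (normalize (U z))) =
  koranyi_box eps w (vscl (rC (vnorm w)) (normalize z)).
Proof.
move=> hU; have vU := vnormU _ hU.
have iU y : inner (vscl (rC (vnorm (U w))) (normalize (U y))) (U w) =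
            inner (vscl (rC (vnorm w)) (normalize y)) w.
  by rewrite !normalizeE !inner_scll !vU (hU.1 y w).
have nU y : vnorm (vscl (rC (vnorm (U w))) (normalize (U y))) =
            vnorm (vscl (rC (vnorm w)) (normalize y)).
  by rewrite !normalizeE !vnorm_scl !vU.
have h1 : inner (vsub (vscl (rC (vnorm (U w))) (normalize (U z))) (U w)) (U w) =
          inner (vsub (vscl (rC (vnorm w)) (normalize z)) w) w.
  by rewrite inner_subl [in RHS]inner_subl iU (hU.1 w w).
have h2 : vnorm (vsub (vscl (rC (vnorm (U w))) (normalize (U z))) (U w)) ^+ 2 =
          vnorm (vsub (vscl (rC (vnorm w)) (normalize z)) w) ^+ 2.
  by rewrite vnorm2_sub [in RHS]vnorm2_sub iU nU (vU w).
by rewrite /koranyi_box /gap h1 h2 (vU w).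
Qed.

Lemma vmeas_normalize F : vmeas F -> vmeas (fun x => normalize (F x)).
Proof.
move=> mF j; apply: cmeasM; first exact: mF.
by apply: cmeas_rC; apply: ymeasV; exact: vmeas_norm.
Qed.

(** The box is centred at 1 - d / 2, in the middle of the shell. Its tangential extent contributes
    only order k^2 N d to |z|^2, since those half-widths are k sqrt(d). *)
Lemma flat_box_shell (k d : R) z : 0 < k * d -> k * d <= d / 8 -> 8 * (k * N%:R) = 1 ->
  d <= 128^-1 -> `|cre (z l) - (1 - d / 2)| < k * d -> `|cim (z l)| < k * d ->
  (forall j, j != l ->
    `|cre (z j)| < k * Num.sqrt d /\ `|cim (z j)| < k * Num.sqrt d) ->
  1 - d <= vnorm z < 1.
Proof.
move=> kd0 kd kN d1 h1 h2 h3.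
have d0 : 0 < d by lra.
have /andP[x1 x2] : - (k * d) < cre (z l) - (1 - d / 2) < k * d by rewrite -ltr_norml.
have xq : cre (z l) <= vnorm z.
  apply: le_trans (ler_norm _) _; apply: le_trans (cre_le_cabs _) _.
  exact: cabs_le_vnorm.
apply/andP; split; first by lra.
rewrite -(@ltr_pXn2r _ 2) ?nnegrE ?vnorm_ge0// expr1n.
apply: le_lt_trans (@vnorm2_le_last _ _ _ (k * Num.sqrt d) _) _.
  by move=> j /h3[c1 c2]; split; exact: ltW.
rewrite cabs2E [(k * _) ^+ 2]exprMn sqr_sqrtr ?(ltW d0)//.
have c8 : `|cim (z l)| <= 8^-1 by lra.
have y2 : cim (z l) ^+ 2 <= (k * d) * 8^-1.
  by rewrite -real_normK ?num_real// expr2; apply: ler_pM => //; exact: ltW.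
have x0 : 0 <= cre (z l) by lra.
have x1' : cre (z l) <= 1 by lra.
have xx : cre (z l) ^+ 2 <= cre (z l) by rewrite expr2 ler_piMl.
have k2d : 0 <= k ^+ 2 * d by rewrite mulr_ge0 ?sqr_ge0// ltW.
have nN : n%:R * (k ^+ 2 * d) <= N%:R * (k ^+ 2 * d) by rewrite ler_wpM2r// ler_nat.
have kE : N%:R * (k ^+ 2 * d) = 8 * (k * N%:R) * (k * d) / 8 by field.
rewrite kN in kE.
rewrite -[2 * _ * _]mulrA; move: nN kE; move: (n%:R * _) (N%:R * _) => A B nN kE.
lra.
Qed.

(** With q = |z|, both conditions for the radial projection reduce to q - Re z_l <= 5 d / 8 and |Im
    z_l| <= d / 8; the normalization [eps * gap = 16 * d] leaves ample room. *)
Lemma shell_koranyi_box (r d eps : R) z : 0 < r -> r < 1 -> d <= 128^-1 ->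
  eps * gap (axis r) = 16 * d -> 1 - 5 / 8 * d <= cre (z l) -> `|cim (z l)| <= d / 8 ->
  cre (z l) <= vnorm z -> vnorm z < 1 ->
  koranyi_box eps (axis r) (vscl (rC r) (normalize z)).
Proof.
move=> r0 r1 d1 ed x1 y1 xq q1; set q := vnorm z in xq q1.
have q2 : 2^-1 <= q by lra.
have q0 : 0 < q by apply: lt_le_trans q2; rewrite invr_gt0.
have q1' : q^-1 <= 2 by rewrite -[leRHS]invrK lef_pV2 ?posrE ?invr_gt0.
have r2 : r * r <= 1 by rewrite mulr_ile1// ltW.
have xq0 : 0 <= q - cre (z l) by rewrite subr_ge0.
have qx : q - cre (z l) <= 5 / 8 * d by lra.
rewrite /koranyi_box ed; apply/andP; split.
  rewrite inner_axis /vsub /vscl /axis eqxx /normalize -/q.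
  rewrite (_ : rC r * _ = rC (r * r * q^-1) * (z l - rC q)); last first.
    have cq : rC q != 0 by rewrite -cabs_eq0 cabs_rC normr_eq0 gt_eqF.
    by rewrite !rCM rCV; field.
  have rr0 : 0 <= r * r by rewrite mulr_ge0// ltW.
  have iq0 : 0 <= q^-1 by rewrite invr_ge0 ltW.
  rewrite cabsM cabs_rC ger0_norm; last exact: mulr_ge0.
  apply: (@le_trans _ _ (2 * cabs (z l - rC q))).
    apply: ler_wpM2r; first exact: cabs_ge0.
    by apply: le_trans q1'; rewrite ler_piMl.
  have := cabs_le_reim (z l - rC q).
  rewrite creD creN cimD cimN /= subr0 (ler0_norm (_ : cre (z l) - q <= 0)) ?subr_le0// opprB.
  have : 0 <= `|cim (z l)| by [].
  by move: qx y1; clear; lra.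
rewrite vnorm2_sub vnorm_axis vnorm_scl cabs_rC !ger0_norm ?(ltW r0)//.
rewrite vnorm_normalize// inner_axis /vscl /normalize -/q.
rewrite !cre_rCM [z l * _]mulrC cre_rCM.
have -> : (r * 1) ^+ 2 - 2 * (r * (r * (q^-1 * cre (z l)))) + r ^+ 2 =
    (r * r) * (q^-1 * (2 * (q - cre (z l)))) by field; rewrite gt_eqF.
have c0 : 0 <= 2 * (q - cre (z l)) by rewrite mulr_ge0.
apply: (@le_trans _ _ (q^-1 * (2 * (q - cre (z l))))).
  by apply: ler_piMl => //; rewrite mulr_ge0// invr_ge0 ltW.
apply: (@le_trans _ _ (2 * (2 * (q - cre (z l))))); first exact: ler_wpM2r.
by move: qx xq0; clear; lra.
Qed.

(** The norm dominates the mean over the sphere of radius |w|. Membership of the projected point in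
    the box is homogeneous of degree 0, so its mean can be read on a shell of thickness [d]: volume
    of order d^(N + 1) over thickness [d] leaves the exponent N. *)
Lemma norm2_lower_hardy eps : 0 < eps -> eps <= 8^-1 ->
  exists2 c, 0 < c & forall w (f : V -> C) b, 0 < vnorm w -> vnorm w < 1 -> 0 <= b ->
    (forall z, vnorm z < 1 -> koranyi_box eps w z -> b <= cabs (f z) ^+ 2) ->
    ((c * b * powR (gap w) N%:R)%:E <= norm2 (Hardy R) f)%E.
Proof.
move=> e0 e8.
have v0 := ballvol_gt0 R n.
have N0 : (0 : R) < N%:R by rewrite ltr0n.
have N1 : (1 : R) <= N%:R by rewrite ler1n.
pose k : R := (8 * N%:R)^-1.
have k0 : 0 < k by rewrite invr_gt0 mulr_gt0.
have kN : 8 * (k * N%:R) = 1.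
  by rewrite /k; move: N0; move: (N%:R : R) => M M0; field; rewrite gt_eqF.
have k8 : 8 * k <= 1.
  have := mulr_ge0 (ltW k0) (_ : 0 <= N%:R - 1 :> R).
  by rewrite subr_ge0 => /(_ N1); lra.
clearbody k.
exists ((2 * k) ^+ (2 * N) * (eps / 16) ^+ N / (2 * N%:R) / ballvol R n).
  by rewrite !divr_gt0 ?mulr_gt0 ?exprn_gt0 ?divr_gt0 ?mulr_gt0.
move=> w f b w0 w1 b0 hf.
set r := vnorm w in w0 w1 *.
have g0 : 0 < gap w := gap_gt0 w1.
have g1 := gap_le1 w.
pose box z : \bar R := if koranyi_box eps w (vscl (rC r) (normalize z)) then 1%E else 0%E.
have box0 z : (0 <= box z)%E by rewrite /box; case: ifP.
have box1 z : (box z <= 1)%E by rewrite /box; case: ifP.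
have mbox w' : ymeas (fun x => if koranyi_box eps w' (vscl (rC r) (normalize (zof x))) then 1%E else 0%E : \bar R).
  apply: ymeas_if; try exact: ymeas_cst.
  apply: koranyi_box_meas => j; apply: cmeasM; first exact: cmeas_cst.
  exact: (vmeas_normalize (@vmeas_z_of _ _) j).
have boxh : homog0 box by move=> s z s0; rewrite /box normalize_scl.
have boxfin : (ballint box < +oo)%E.
  apply: le_lt_trans (ballvol_fin R n).
  by apply: iint_le => x; case: ifP.
have bge0 : (0 <= ballint box)%E by apply: iint_ge0 => x; case: ifP.
have [v vE] : exists v, ballint box = v%:E.
  by exists (fine (ballint box)); rewrite fineK// ge0_fin_numE.
have vge0 : 0 <= v by rewrite -lee_fin -vE.
pose d := eps * gap w / 16.
have d0 : 0 < d by rewrite divr_gt0// mulr_gt0.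
have ed : eps * gap w = 16 * d by rewrite /d; field.
have d1 : d <= 128^-1.
  have : eps * gap w <= 8^-1 * 1 by apply: ler_pM => //; exact: ltW.
  by rewrite ed; lra.
have shell : ((2 * k) ^+ (2 * N) * d ^+ N.+1 <= (1 - (1 - d) ^+ (2 * N)) * v).
  rewrite -lee_fin [leRHS]EFinM -vE -(homog0_shell _ _ boxh)//; [|lra|lra|exact: mbox].
  have [U [hU Uw]] := exists_rotation l w N_gt1.
  have {}Uw : U w = axis r by rewrite Uw.
  pose g z : \bar R := if (1 - d <= vnorm z < 1) then
     (if koranyi_box eps (axis r) (vscl (rC r) (normalize z)) then 1 else 0)%E else 0%E.
  have mg : ymeas (g \o zof).
    have mv : ymeas (fun x => vnorm (zof x)) by apply: vmeas_norm; exact: vmeas_z_of.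
    apply: ymeas_if; [|exact: mbox|exact: ymeas_cst].
    by apply: ymeas_and; [apply: ymeas_le|apply: ymeas_lt]; rewrite //; exact: ymeas_cst.
  have gge0 z : (0 <= g z)%E by rewrite /g; case: ifP => // _; case: ifP.
  have [_] := hU.2 g mg gge0.
  rewrite (_ : g \o U \o zof = fun x => if 1 - d <= vnorm (zof x) < 1 then box (zof x) else 0%E); last first.
    apply/funext => x; rewrite /= /g /box (vnormU _ hU).
    by rewrite -(koranyi_box_normalizeU eps w (zof x) hU) Uw vnorm_axis ger0_norm// ltW.
  move=> ->.
  rewrite -(@box_volume_eq k d (ltW d0)).
  apply: (@le_trans _ _ (iint (2 * N) (fun x => if (1 - d <= vnorm (zof x) < 1) &&
      koranyi_box eps (axis r) (vscl (rC r) (normalize (zof x))) then 1%E else 0%E))); last first.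
    apply: iint_le => x; first by case: ifP.
    by rewrite /= /g; case: (1 - d <= _ < 1) => //=.
  apply: (@iint_box_le R n (fun z => (1 - d <= vnorm z < 1) &&
     koranyi_box eps (axis r) (vscl (rC r) (normalize z))) (1 - d / 2)) => [||z h1 h2 h3].
  - by rewrite mulr_ge0 ?ltW.
  - by rewrite mulr_ge0 ?sqrtr_ge0 ?ltW.
  have kd : k * d <= d / 8.
    have := ler_wpM2r (ltW d0) k8; rewrite mul1r -mulrA.
    by move: (k * d) => kd; clear; lra.
  have kd0 : 0 < k * d by rewrite mulr_gt0.
  have /andP[q2 q1] := flat_box_shell kd0 kd kN d1 h1 h2 h3.
  rewrite q1 q2 /=; apply: (shell_koranyi_box w0 w1 d1) => //.
  + by rewrite /gap vnorm_axis ger0_norm// ltW.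
  + by move: h1; rewrite ltr_norml => /andP[h1 _]; move: h1 kd; clear; lra.
  + exact: le_trans (ltW h2) kd.
  + apply: le_trans (ler_norm _) _; apply: le_trans (cre_le_cabs _) _.
    exact: cabs_le_vnorm.
(* The shell carries a fraction of at most 2 N d of the ball integral; dividing by it costs one
   power of [d]. *)
have vlow : (2 * k) ^+ (2 * N) * d ^+ N / (2 * N%:R) <= v.
  rewrite ler_pdivrMr ?mulr_gt0// -(ler_pM2r d0).
  rewrite -mulrA -exprSr; apply: le_trans shell _.
  rewrite -mulrA [leRHS]mulrC ler_wpM2r//.
  apply: le_trans (one_minus_exprn_le _ _ _) _; [lra|lra|].
  by rewrite natrM; lra.
apply: (@le_trans _ _ (b%:E * ballint box * ((ballvol R n)^-1)%:E)%E).
  rewrite vE -!EFinM lee_fin powR_mulrn ?(ltW g0)//.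
  rewrite (_ : _ * gap w ^+ N = b * ((2 * k) ^+ (2 * N) * d ^+ N / (2 * N%:R)) / ballvol R n); last first.
    by rewrite /d !exprMn; ring.
  by rewrite ler_wpM2r ?invr_ge0 ?(ltW v0)// ler_wpM2l.
apply: (@le_trans _ _ (sigma_int (fun zeta : V => (cabs (f (fun j => rC r * zeta j)) ^+ 2)%:E))); last first.
  apply: ereal_sup_ubound; exists r => //=.
  by rewrite in_itv /= w0 w1.
rewrite /sigma_int nu_intE lee_pmul2r ?lte_fin ?invr_gt0//.
rewrite -iintZ//; last 2 first.
- apply: ymeas_if; [|exact: mbox|exact: ymeas_cst].
  by apply: ymeas_lt; [exact/vmeas_norm/vmeas_z_of|exact: ymeas_cst].
- by move=> x; case: ifP.
apply: iint_le => x; first by rewrite mule_ge0 ?lee_fin//; case: ifP.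
case: ifPn => _; last by rewrite mule0.
rewrite /box; case: ifPn => hb; last by rewrite mule0 lee_fin sqr_ge0.
rewrite mule1 lee_fin; apply: hf => //.
exact: koranyi_box_ball hb.
Qed.

End NormLowerBound.

(** * Weighted ball integrals of powers of the kernel *)

Section KernelIntegrals.
Variable R : realType.
Local Notation mu := (@lebesgue_measure R).

Definition sqsum m (x : nat -> R) : R := \sum_(i < m) x i ^+ 2.

Lemma sqsum_upd m (x : nat -> R) t : sqsum m.+1 (upd x m t) = sqsum m x + t ^+ 2.
Proof.
rewrite /sqsum big_ord_recr /= updE; congr (_ + _).
by apply: eq_bigr => i _; rewrite upd_ne// ltn_eqF.
Qed.

Lemma measurable_if_sqr (g A : R) : measurable_fun [set: measurableTypeR R]
  (fun t : R => if (t ^+ 2 < A)%R then ((A - t ^+ 2) `^ g)%:E else 0%E).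
Proof.
apply: measurable_fun_ifT; last exact: measurable_cst.
- by apply: measurable_fun_ltr => //; exact: measurable_funX.
- apply/measurable_EFinP; apply: (measurableT_comp (measurable_powR g)).
  by apply: measurable_funB => //; exact: measurable_funX.
Qed.

(** Each coordinate integrated out by [integral_powR_sqr] raises the exponent by 1/2. All real [A]
    are covered, with bound 0 for [A <= 0], because the induction replaces [A] by [A - t ^+ 2]. *)
Lemma iint_powR_sqsum m (g : R) : -1 < g -> exists2 c, 0 <= c & forall A : R,
  (iint m (fun x => if (sqsum m x < A)%R then ((A - sqsum m x) `^ g)%:E else 0) <=
   if (0 < A)%R then (c * A `^ (g + m%:R / 2))%:E else 0)%E.
Proof.
move=> g1; elim: m => [|m [c c0 IH]].
  exists 1 => // A; rewrite /= /sqsum big_ord0 subr0 mul0r addr0.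
  by case: ifP => // _; rewrite mul1r.
have gm : -1 < g + m%:R / 2 by apply: (lt_le_trans g1); rewrite lerDl divr_ge0.
have [c' c'0 hc'] := integral_powR_sqr gm.
exists (c * c'); first exact: mulr_ge0.
move=> A; rewrite iintS.
apply: (@le_trans _ _ (\int[mu]_t (c%:E *
    if (t ^+ 2 < A)%R then ((A - t ^+ 2) `^ (g + m%:R / 2))%:E else 0))%E).
  apply: ge0_le_integral_nomeas => t.
    by apply: iint_ge0 => x; case: ifP => // _; rewrite lee_fin powR_ge0.
  rewrite (_ : (fun x => _) = fun x => if (sqsum m x < A - t ^+ 2)%R then
      ((A - t ^+ 2 - sqsum m x) `^ g)%:E else 0%E); last first.
    apply/funext => x; rewrite sqsum_upd ltrBrDr.
    by rewrite (_ : A - t ^+ 2 - sqsum m x = A - (sqsum m x + t ^+ 2)); [|ring].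
  apply: le_trans (IH _) _; rewrite subr_gt0.
  by case: ifP => _; rewrite ?mule0// EFinM.
rewrite ge0_integralZl_EFin//; last 2 first.
- by move=> t _; case: ifP => // _; rewrite lee_fin powR_ge0.
- exact: measurable_if_sqr.
case: ifPn => [A0|A0]; last first.
  rewrite integral0_eq ?mule0// => t _; rewrite ifF//; apply/negbTE.
  by rewrite -leNgt (le_trans _ (sqr_ge0 t))// leNgt.
apply: (@le_trans _ _ (c%:E * (c' * A `^ (g + m%:R / 2 + 2^-1))%:E)%E).
  by rewrite lee_wpmul2l ?lee_fin// hc'.
rewrite -EFinM lee_fin mulrA (_ : g + m%:R / 2 + 2^-1 = g + m.+1%:R / 2)//.
by rewrite -natr1; field.
Qed.

Lemma ge0_integral_addl (f : R -> \bar R) (c : R) :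
  measurable_fun [set: R] f -> (forall r, 0 <= f r)%E ->
  (\int[mu]_t f (c + t)%R = \int[mu]_t f t)%E.
Proof.
move=> mf f0; rewrite -[RHS](ge0_integral_shift c)//.
by apply: eq_integral => t _; rewrite addrC.
Qed.

Lemma ge0_integral_subl (f : R -> \bar R) (c : R) :
  measurable_fun [set: R] f -> (forall r, 0 <= f r)%E ->
  (\int[mu]_t f (c - t)%R = \int[mu]_t f t)%E.
Proof.
move=> mf f0; rewrite -[RHS](ge0_integral_addl c)//.
rewrite -[RHS]ge0_integral_opp//.
by apply: (measurableT_comp mf); exact: measurable_funD.
Qed.

(** Together the two integrands dominate (c + |t|)^(-p), one on each half-line; the cutoff at
    [c / 2] removes the singularity. *)
Lemma integral_shifted_tail (p : R) : 1 < p -> exists2 k, 0 <= k & forall c : R, 0 < c ->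
  (\int[mu]_t (if (c / 2 < c + t)%R then ((c + t) `^ (- p))%:E else 0) <=
     (k * c `^ (1 - p))%:E)%E /\
  (\int[mu]_t (if (c / 2 < c - t)%R then ((c - t) `^ (- p))%:E else 0) <=
     (k * c `^ (1 - p))%:E)%E.
Proof.
move=> p1; exists (2^-1 `^ (1 - p) / (p - 1)).
  by rewrite divr_ge0 ?powR_ge0//; lra.
move=> c c0; pose h (t : R) : \bar R := if (c / 2 < t)%R then (t `^ (- p))%:E else 0%E.
have h0 t : (0 <= h t)%E by rewrite /h; case: ifP => // _; rewrite lee_fin powR_ge0.
have mh : measurable_fun [set: R] h by exact: measurable_if_gt_powR.
have mh1 : measurable_fun [set: R] (fun t : R => h (t + c)%R).
  by apply: (measurableT_comp mh); exact: measurable_funD.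
have hI : (\int[mu]_t h t <= (2^-1 `^ (1 - p) / (p - 1) * c `^ (1 - p))%:E)%E.
  apply: (le_trans (integral_powR_tail _ _)); [lra|by rewrite divr_gt0|].
  rewrite lee_fin [- p + 1]addrC opprB powRM ?invr_ge0 ?(ltW c0)//.
  by rewrite le_eqVlt; apply/orP; left; apply/eqP; ring.
split.
  apply: le_trans hI; rewrite le_eqVlt; apply/orP; left; apply/eqP.
  exact: (ge0_integral_addl c mh h0).
apply: le_trans hI; rewrite le_eqVlt; apply/orP; left; apply/eqP.
exact: (ge0_integral_subl c mh h0).
Qed.

Lemma powRN_le (p s t : R) : 0 <= p -> 0 < s -> s <= t -> t `^ (- p) <= s `^ (- p).
Proof.
move=> p0 s0 st; have t0 := lt_le_trans s0 st.
rewrite !powRN lef_pV2 ?posrE ?powR_gt0//.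
by apply: ge0_ler_powR => //; rewrite nnegrE ltW.
Qed.

Lemma sum_double (f : nat -> R) k :
  \sum_(i < 2 * k) f i = \sum_(j < k) (f (2 * j)%N + f (2 * j).+1).
Proof.
elim: k => [|k IH]; first by rewrite muln0 !big_ord0.
by rewrite mulnS !add2n !big_ord_recr /= IH addrA.
Qed.

Variable n : nat.
Local Notation N := n.+1.
Local Notation C := R[i].
Local Notation V := ('I_N -> C).
Local Notation zof := (@z_of R N).
Local Notation l := (@ord_max n).

Lemma vnorm2_sqsum x : vnorm (zof x) ^+ 2 = sqsum (2 * N) x.
Proof.
rewrite vnorm2E /sqsum (sum_double (fun i => x i ^+ 2)).
by apply: eq_bigr => j _; rewrite cabs2E.
Qed.

Definition kernel_integrand (a : R) (m : nat) (w z : V) : R :=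
  (gap z) `^ a * (cabs (1 - inner z w) ^+ (2 * m))^-1.

Lemma kernel_integrand_ge0 a m w z : 0 <= kernel_integrand a m w z.
Proof. by rewrite mulr_ge0 ?powR_ge0// invr_ge0 exprn_ge0// cabs_ge0. Qed.

(** For [2^-1 <= r] the three terms are read off the real and imaginary parts of 1 - r b. For
    smaller [r] their sum is at most 4, while |1 - r b| is at least 1/2: hence the 8. *)
Lemma kernel_dist_ge (r : R) (b : C) : 0 <= r -> r < 1 -> cabs b < 1 ->
  (1 - r + (1 - cre b) + `|cim b|) / 8 <= cabs (1 - rC r * b) /\
  1 - cabs b ^+ 2 <= 2 * cabs (1 - rC r * b).
Proof.
move=> r0 r1 b1.
have xb := le_lt_trans (cre_le_cabs b) b1.
have yb := le_lt_trans (cim_le_cabs b) b1.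
move: xb; rewrite ltr_norml => /andP[x1 x2].
set p := cabs (1 - rC r * b).
have h1 : 1 - r * cre b <= p.
  apply: le_trans (le_trans (ler_norm _) (cre_le_cabs _)).
  by rewrite creD creN cre_rCM.
have h2 : r * `|cim b| <= p.
  apply: le_trans (cim_le_cabs _).
  by rewrite cimD cimN cim_rCM /= add0r normrN normrM ger0_norm.
have h3 : 1 - r * cabs b <= p.
  rewrite lerBlDr -[leLHS]cabs1 -[in leLHS](subrK (rC r * b) 1).
  apply: le_trans (cabsD _ _) _.
  by rewrite lerD2l cabsM cabs_rC ger0_norm.
have c0 := cabs_ge0 b.
split; last first.
  have : r * cabs b <= cabs b by rewrite ler_piMl// ltW.
  have : 0 <= (1 - cabs b) ^+ 2 by exact: sqr_ge0.
  by lra.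
have ry : 0 <= r * `|cim b| by rewrite mulr_ge0.
have [r2|r2] := leP (2^-1) r.
  have : 0 <= (r - 2^-1) * (1 - cre b) by rewrite mulr_ge0//; lra.
  have : 0 <= (r - 2^-1) * `|cim b| by rewrite mulr_ge0//; lra.
  by lra.
have : r * cabs b <= 2^-1 * 1 by apply: ler_pM => //; exact: ltW.
by lra.
Qed.

Hypothesis n_gt0 : (0 < n)%N.

(** For a fixed last coordinate b = x + i y, integrating out the others gives a multiple of A^be
    with A = 1 - |b|^2. As A is at most twice rho = |1 - r b|, what remains is rho^(-q), and
    [kernel_dist_ge] bounds it by a product of a function of x and one of y, each with exponent -p
    where p = q / 2 > 1. *)
Lemma ballint_kernel_axis (a : R) (m : nat) : -1 < a -> N%:R + 1 + a < (2 * m)%:R ->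
  exists2 K, 0 <= K & forall r : R, 0 <= r -> r < 1 ->
    (ballint (fun z => (kernel_integrand a m (axis r) z)%:E) <=
     (K * (1 - r) `^ (N%:R + 1 + a - (2 * m)%:R))%:E)%E.
Proof.
move=> a1 am.
have n1 : (1 : R) <= n%:R by rewrite ler1n.
have NE : N%:R = n%:R + 1 :> R by rewrite natr1.
pose be : R := a + n%:R.
have be0 : 0 < be by rewrite /be; lra.
pose q : R := (2 * m)%:R - be.
have q2 : 2 < q by rewrite /q /be; lra.
pose p : R := q / 2.
have p1 : 1 < p by rewrite /p; lra.
have [c1 c10 hc1] := iint_powR_sqsum (2 * n) a1.
have [k k0 hk] := integral_shifted_tail p1.
pose D : R := c1 * 2 `^ be * 8 `^ q.
have D0 : 0 <= D by rewrite !mulr_ge0 ?powR_ge0.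
exists (D * k * (k + k)); first by rewrite !mulr_ge0// addr_ge0.
move=> r r0 r1; pose c := 1 - r; have cc0 : 0 < c by rewrite subr_gt0.
pose h1 (t : R) : \bar R := if (c / 2 < c + t)%R then ((c + t) `^ (- p))%:E else 0%E.
pose h2 (t : R) : \bar R := if (c / 2 < c - t)%R then ((c - t) `^ (- p))%:E else 0%E.
have h10 t : (0 <= h1 t)%E by rewrite /h1; case: ifP => // _; rewrite lee_fin powR_ge0.
have h20 t : (0 <= h2 t)%E by rewrite /h2; case: ifP => // _; rewrite lee_fin powR_ge0.
have mg : measurable_fun [set: R] (fun t : R => if (c / 2 < t)%R then (t `^ (- p))%:E else 0%E).
  exact: measurable_if_gt_powR.
have mh1 : measurable_fun [set: measurableTypeR R] h1.
  by apply: (measurableT_comp mg); exact: measurable_funD.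
have mh2 : measurable_fun [set: measurableTypeR R] h2.
  by apply: (measurableT_comp mg); exact: measurable_funB.
have mh12 : measurable_fun [set: measurableTypeR R] (fun t : R => h1 t + h2 t)%E.
  exact: emeasurable_funD.
have [I1 I2] := hk c cc0; rewrite -/h1 -/h2 in I1 I2.
have mh3 (e : R) : measurable_fun [set: measurableTypeR R]
    (fun t : R => if (c / 2 < e - t)%R then ((e - t) `^ (- p))%:E else 0%E).
  by apply: (measurableT_comp mg); exact: measurable_funB.
(* The factor in x: 1 - x > 0 plays the role of |y|, so this is [h2] translated by 1. *)
pose h3 (t : R) : \bar R := if (c / 2 < c + 1 - t)%R then ((c + 1 - t) `^ (- p))%:E else 0%E.
have h30 t : (0 <= h3 t)%E by rewrite /h3; case: ifP => // _; rewrite lee_fin powR_ge0.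
have I3 : (\int[mu]_t h3 t <= (k * c `^ (1 - p))%:E)%E.
  rewrite (_ : h3 = fun t => h2 (t - 1)); last first.
    by apply/funext => t; rewrite /h3 /h2 (_ : c - (t - 1) = c + 1 - t); [|ring].
  by rewrite (@ge0_integral_shift _ h2 (-1))//; exact: mh2.
rewrite /ballint (_ : 2 * N = (2 * n).+2)%N; last by rewrite mulnS.
rewrite iintS.
have inner_bound (y x : R) :
  (iint (2 * n) (fun u => let w := upd (upd u (2 * n)%N x) (2 * n).+1%N y in
     if (vnorm (zof w) < 1)%R then (kernel_integrand a m (axis r) (zof w))%:E else 0%E)
   <= D%:E * (h1 y + h2 y) * h3 x)%E.
  pose b : C := Complex x y.
  pose A : R := 1 - cabs b ^+ 2.
  pose rho := cabs (1 - rC r * b).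
  pose E : R := (rho ^+ (2 * m))^-1.
  have E0 : 0 <= E by rewrite invr_ge0 exprn_ge0// cabs_ge0.
  have mS : ymeas (fun u : nat -> R => sqsum (2 * n) u).
    by apply: ymeas_sum => i; apply: ymeasX; exact: ymeas_coord.
  rewrite (_ : (fun u => _) = fun u => (E%:E *
      if (sqsum (2 * n) u < A)%R then ((A - sqsum (2 * n) u) `^ a)%:E else 0)%E); last first.
    apply/funext => u /=; set w := upd _ _ _.
    have wl : zof w l = b.
      by rewrite /zof /b /w /= updE upd_ne ?updE// ltn_eqF.
    have wv : vnorm (zof w) ^+ 2 = sqsum (2 * n) u + cabs b ^+ 2.
      rewrite vnorm2_sqsum (_ : 2 * N = (2 * n).+2)%N; last by rewrite mulnS.
      by rewrite /w !sqsum_upd cabs2E /=; ring.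
    have -> : (vnorm (zof w) < 1) = (sqsum (2 * n) u < A).
      rewrite -(@ltr_pXn2r _ 2) ?nnegrE ?vnorm_ge0// expr1n wv /A.
      by rewrite ltrBrDr.
    case: ifP => _; last by rewrite mule0.
    rewrite -EFinM /kernel_integrand /gap wv inner_axis wl -/rho -/E mulrC.
    by congr (_ * _ `^ _)%:E; rewrite /A; ring.
  rewrite iintZ//; last 2 first.
  - apply: ymeas_if; last exact: ymeas_cst.
      by apply: ymeas_lt => //; exact: ymeas_cst.
    apply: ymeas_EFin; apply: ymeas_powR; apply: ymeasB => //; exact: ymeas_cst.
  - by move=> u; case: ifP => // _; rewrite lee_fin powR_ge0.
  apply: (@le_trans _ _ (E%:E * (if (0 < A)%R then (c1 * A `^ (a + (2 * n)%:R / 2))%:E else 0))%E).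
    by rewrite lee_wpmul2l ?lee_fin// hc1.
  case: ifPn => [A0|_]; last first.
    by rewrite mule0 !mule_ge0// adde_ge0.
  have b1 : cabs b < 1.
    by rewrite -(@ltr_pXn2r _ 2) ?nnegrE ?cabs_ge0// expr1n -subr_gt0.
  have [dist1 dist2] := kernel_dist_ge r0 r1 b1; rewrite -/rho -/A /= in dist1 dist2.
  have x1 : x < 1.
    by apply: le_lt_trans b1; apply: le_trans (ler_norm _) (cre_le_cabs b).
  pose S := c + (1 - x) + `|y|.
  have y0 : 0 <= `|y| by [].
  have S0 : 0 < S by rewrite /S; lra.
  have rho0 : 0 < rho by apply: lt_le_trans dist1; rewrite divr_gt0.
  have p0 : 0 <= p by lra.
  have q0 : 0 <= q by lra.
  have Eb : E * (c1 * A `^ (a + (2 * n)%:R / 2)) <=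
            D * ((c + `|y|) `^ (- p) * (c + 1 - x) `^ (- p)).
    have -> : a + (2 * n)%:R / 2 = be by rewrite natrM /be; field.
    apply: (@le_trans _ _ (c1 * (2 `^ be * rho `^ (- q)))).
      rewrite mulrCA ler_wpM2l//.
      have -> : rho `^ (- q) = rho `^ be * E.
        rewrite (_ : - q = be + - (2 * m)%:R); last by rewrite /q; ring.
        rewrite powRD; last by rewrite (gt_eqF rho0) implybT.
        by rewrite powR_invn ?(ltW rho0).
      rewrite mulrA mulrC ler_wpM2r// -powRM ?(ltW rho0)//.
      by apply: ge0_ler_powR; rewrite ?nnegrE ?(ltW be0) ?(ltW A0)// mulr_ge0// ltW.
    rewrite /D -!mulrA ler_wpM2l// ler_wpM2l ?powR_ge0//.
    apply: (@le_trans _ _ ((S / 8) `^ (- q))).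
      by apply: powRN_le => //; rewrite divr_gt0.
    rewrite powRM ?invr_ge0 ?(ltW S0)//.
    rewrite [X in _ * X <= _](_ : _ = 8 `^ q); last first.
      by rewrite -[8^-1]powR_inv1// -powRrM mulN1r opprK.
    rewrite mulrC ler_wpM2l ?powR_ge0//.
    rewrite (_ : - q = - p + - p); last by rewrite /p; field.
    rewrite powRD; last by rewrite (gt_eqF S0) implybT.
    have cy : 0 < c + `|y| by rewrite ltr_wpDr.
    have cx : 0 < c + 1 - x by move: cc0 x1; clear; lra.
    apply: ler_pM; rewrite ?powR_ge0//; apply: powRN_le => //.
      by rewrite /S; move: x1; clear; lra.
    by rewrite /S; move: y0; clear; lra.
  rewrite -EFinM; apply: (@le_trans _ _ _ _ _ (_ : (_ <= (D * ((c + `|y|) `^ (- p) * (c + 1 - x) `^ (- p)))%:E)%E)).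
    by rewrite lee_fin.
  rewrite -muleA EFinM lee_wpmul2l ?lee_fin// EFinM.
  have -> : h3 x = ((c + 1 - x) `^ (- p))%:E.
    by rewrite /h3 ifT//; move: cc0 x1; clear; lra.
  rewrite lee_wpmul2r ?lee_fin ?powR_ge0//.
  have [yp|yn] := leP 0 y.
    apply: (@le_trans _ _ (h1 y)); last by rewrite leeDl.
    rewrite /h1 (ger0_norm yp) ifT//.
    by move: cc0 yp; clear; lra.
  apply: (@le_trans _ _ (h2 y)); last by rewrite leeDr.
  rewrite /h2 (ltr0_norm yn) ifT//.
  by move: cc0 yn; clear; lra.
apply: (@le_trans _ _ (\int[mu]_y ((D * (k * c `^ (1 - p)))%:E * (h1 y + h2 y)))%E).
  apply: ge0_le_integral_nomeas => y.
    by apply: iint_ge0 => u; case: ifP => // _; rewrite lee_fin kernel_integrand_ge0.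
  rewrite iintS; apply: (@le_trans _ _ (\int[mu]_x ((D%:E * (h1 y + h2 y)) * h3 x))%E).
    apply: ge0_le_integral_nomeas => x; last exact: inner_bound.
    by apply: iint_ge0 => u; case: ifP => // _; rewrite lee_fin kernel_integrand_ge0.
  rewrite ge0_integralZl//; last 2 first.
  - exact: mh3.
  - by rewrite mule_ge0// adde_ge0.
  apply: (@le_trans _ _ (D%:E * (h1 y + h2 y) * (k * c `^ (1 - p))%:E)%E).
    by rewrite lee_wpmul2l// mule_ge0// adde_ge0.
  by rewrite [X in (_ <= X * _)%E]EFinM [leRHS]muleAC.
rewrite ge0_integralZl_EFin//; last 2 first.
- by move=> t _; exact: adde_ge0.
- by rewrite !mulr_ge0 ?powR_ge0.
rewrite ge0_integralD//.
have P0 : 0 <= D * (k * c `^ (1 - p)).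
  by apply: mulr_ge0 => //; apply: mulr_ge0 => //; exact: powR_ge0.
have I12 := leeD I1 I2.
apply: (le_trans (lee_wpmul2l _ I12)); first by rewrite lee_fin.
have PP : (1 - r) `^ (N%:R + 1 + a - (2 * m)%:R) = c `^ (1 - p) * c `^ (1 - p).
  rewrite -powRD; last by rewrite (gt_eqF cc0) implybT.
  by congr (_ `^ _); rewrite NE /p /q /be; field.
rewrite -EFinD -EFinM lee_fin PP.
by rewrite le_eqVlt; apply/orP; left; apply/eqP; ring.
Qed.

End KernelIntegrals.

(** * Upper bounds for the norms of kernel functions *)

Section KernelNorm.
Variables (R : realType) (n : nat).
Hypothesis n_gt0 : (0 < n)%N.
Local Notation N := n.+1.
Local Notation C := R[i].
Local Notation V := ('I_N -> C).
Local Notation zof := (@z_of R N).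
Local Notation l := (@ord_max n).
Implicit Types z w : V.

Lemma ymeas_kernel_integrand a m w : ymeas (fun x => kernel_integrand a m w (zof x)).
Proof.
apply: ymeasM.
  apply: ymeas_powR; apply: ymeasB; first exact: ymeas_cst.
  exact/ymeasX/vmeas_norm/vmeas_z_of.
apply: ymeasV; apply: ymeasX; apply: cmeas_abs; apply: cmeasB.
  exact: cmeas_cst.
exact/vmeas_inner/vmeas_z_of.
Qed.

Lemma ymeas_ball d (U : measurableType d) (f g : (nat -> R) -> U) :
  ymeas f -> ymeas g -> ymeas (fun x => if vnorm (zof x) < 1 then f x else g x).
Proof.
move=> mf mg; apply: ymeas_if => //; apply: ymeas_lt; last exact: ymeas_cst.
exact/vmeas_norm/vmeas_z_of.
Qed.

Lemma ballint_kernel (a : R) (m : nat) : -1 < a -> N%:R + 1 + a < (2 * m)%:R ->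
  exists2 K, 0 <= K & forall w, vnorm w < 1 ->
    (ballint (fun z => (kernel_integrand a m w z)%:E) <=
     (K * gap w `^ (N%:R + 1 + a - (2 * m)%:R))%:E)%E.
Proof.
move=> a1 am; have [K K0 hK] := ballint_kernel_axis n_gt0 a1 am.
pose e : R := (2 * m)%:R - (N%:R + 1 + a).
have e0 : 0 < e by rewrite subr_gt0.
have eN : N%:R + 1 + a - (2 * m)%:R = - e by rewrite opprB.
exists (K * 2 `^ e); first by rewrite mulr_ge0 ?powR_ge0.
move=> w w1; have [U [hU Uw]] := exists_rotation l w (n_gt0 : 1 < N)%N.
set r := vnorm w in Uw w1 *.
have r0 : 0 <= r by exact: vnorm_ge0.
have {}Uw : U w = axis r by rewrite Uw.
pose g z : \bar R := if vnorm z < 1 then (kernel_integrand a m (axis r) z)%:E else 0%E.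
have g0 z : (0 <= g z)%E.
  by rewrite /g; case: ifP => // _; rewrite lee_fin kernel_integrand_ge0.
have mg : ymeas (g \o zof).
  by apply: ymeas_ball; [exact/ymeas_EFin/ymeas_kernel_integrand|exact: ymeas_cst].
have [_] := hU.2 g mg g0.
rewrite (_ : g \o U \o zof = fun x => if vnorm (zof x) < 1 then
    (kernel_integrand a m w (zof x))%:E else 0%E); last first.
  apply/funext => x; rewrite /= /g /kernel_integrand /gap (vnormU _ hU) -Uw.
  by rewrite (hU.1 (zof x) w).
move=> Eq; rewrite /ballint Eq; apply: le_trans (hK r r0 w1) _.
rewrite lee_fin -mulrA; apply: ler_wpM2l => //; rewrite eN.
have g_gt0 : 0 < gap w by exact: gap_gt0.
rewrite (_ : 2 `^ e * gap w `^ (- e) = (gap w / 2) `^ (- e)); last first.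
  rewrite powRM; [|exact: ltW|by rewrite invr_ge0]; rewrite mulrC; congr (_ * _).
  have := powR_inv1 (ler0n R 2) => <-.
  by rewrite -powRrM mulN1r opprK.
apply: powRN_le; [exact: ltW|exact: divr_gt0|].
have : 0 <= (1 - r) ^+ 2 by exact: sqr_ge0.
by rewrite /gap -/r; lra.
Qed.

Definition power_kernel (kappa : R) (m : nat) w z : C :=
  rC kappa * ((1 - inner z w) ^+ m)^-1.

Lemma cabs_power_kernel2 kappa m w z : cabs (power_kernel kappa m w z) ^+ 2 =
  kappa ^+ 2 * (cabs (1 - inner z w) ^+ (2 * m))^-1.
Proof.
rewrite /power_kernel cabsM cabs_rC cabsV cabsX exprMn real_normK ?num_real//.
by rewrite exprVn -exprM mulnC.
Qed.

Lemma norm2_kernel_bergman a m : -1 < a -> N%:R + 1 + a < (2 * m)%:R ->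
  exists2 K, 0 <= K & forall w kappa, vnorm w < 1 ->
    (norm2 (Bergman a) (power_kernel kappa m w) <=
     (kappa ^+ 2 * (K * gap w `^ (N%:R + 1 + a - (2 * m)%:R)))%:E)%E.
Proof.
move=> a1 am; have [K K0 hK] := ballint_kernel a1 am.
have bc0 := bergman_cst_gt0 n a1; have v0 := ballvol_gt0 R n.
exists (bergman_cst n a * K / ballvol R n).
  by rewrite divr_ge0 ?(ltW v0)// mulr_ge0// ltW.
move=> w kappa w1; rewrite /= nu_intE.
have E : ballint (fun z => (cabs (power_kernel kappa m w z) ^+ 2 * bergman_weight a z)%:E) =
    ((kappa ^+ 2 * bergman_cst n a)%:E * ballint (fun z => (kernel_integrand a m w z)%:E))%E.
  rewrite /ballint -iintZ.
  - congr iint; apply/funext => x; case: ifP => _; last by rewrite mule0.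
    rewrite -EFinM cabs_power_kernel2 /bergman_weight -/(bergman_cst n a) /kernel_integrand.
    by congr EFin; rewrite /gap; ring.
  - by rewrite mulr_ge0 ?sqr_ge0// ltW.
  - by apply: ymeas_ball; [exact/ymeas_EFin/ymeas_kernel_integrand|exact: ymeas_cst].
  - by move=> x; case: ifP => // _; rewrite lee_fin kernel_integrand_ge0.
rewrite E; apply: (@le_trans _ _ ((kappa ^+ 2 * bergman_cst n a)%:E *
   (K * gap w `^ (N%:R + 1 + a - (2 * m)%:R))%:E * ((ballvol R n)^-1)%:E)%E).
  rewrite lee_pmul2r ?lte_fin ?invr_gt0// lee_wpmul2l ?hK// lee_fin.
  by rewrite mulr_ge0 ?sqr_ge0// ltW.
by rewrite -!EFinM lee_fin le_eqVlt; apply/orP; left; apply/eqP; ring.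
Qed.

Lemma one_minus_exprn_ge (x : R) k : 0 <= x -> x <= 1 -> (0 < k)%N -> 1 - x <= 1 - x ^+ k.
Proof.
by move=> x0 x1 k0; rewrite lerD2l lerN2; exact: ler_iXnr.
Qed.

Lemma cabs_1inner_ge z w : vnorm z <= 1 -> 1 - vnorm w <= cabs (1 - inner z w).
Proof.
move=> z1; rewrite lerBlDr -[leLHS](cabs1 R) -[in leLHS](subrK (inner z w) 1).
apply: le_trans (cabsD _ _) _; rewrite lerD2l.
apply: le_trans (cauchy_schwarz _ _) _.
by rewrite ler_piMl// vnorm_ge0.
Qed.

(** Strict only at the origin, which is sent to 0 because the inverse of 0 is 0. *)
Lemma normalize_le1 z : vnorm (normalize z) <= 1.
Proof.
have [z0|z0] := ltP 0 (vnorm z); first by rewrite vnorm_normalize.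
rewrite normalizeE vnorm_scl (_ : vnorm z = 0) ?mulr0//.
by apply/eqP; rewrite eq_le z0 vnorm_ge0.
Qed.

(** Restricted to the sphere of radius [rho], the kernel at [w0] is the kernel at rho w0 on the unit
    sphere. Its mean is compared with the ball integral for [a = 0] over a shell of thickness [d],
    and dividing by [d] lowers the exponent N + 1 to N. The bound is uniform in [rho], since the gap
    at rho w0 is at least that at [w0] and the exponent is negative. *)
Lemma norm2_kernel_hardy m : N%:R + 1 < (2 * m)%:R :> R ->
  exists2 K, 0 <= K & forall w kappa, vnorm w < 1 ->
    (norm2 (Hardy R) (power_kernel kappa m w) <=
     (kappa ^+ 2 * (K * gap w `^ (N%:R - (2 * m)%:R)))%:E)%E.
Proof.
move=> am; have a1 : -1 < 0 :> R by lra.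
have am' : N%:R + 1 + 0 < (2 * m)%:R :> R by rewrite addr0.
have [K K0 hK] := ballint_kernel a1 am'.
have v0 := ballvol_gt0 R n.
exists (4 * (2 ^+ (2 * m) * K) / ballvol R n).
  by rewrite divr_ge0 ?(ltW v0)// mulr_ge0// mulr_ge0.
move=> w0 kappa w01; apply: ge_ereal_sup => _ [rho /= hrho <-].
move: hrho; rewrite in_itv /= => /andP[rho0 rho1].
rewrite /sigma_int nu_intE.
pose w := vscl (rC rho) w0.
have wE : vnorm w = rho * vnorm w0 by rewrite vnorm_scl cabs_rC gtr0_norm.
have w0w : vnorm w <= vnorm w0 by rewrite wE ler_piMl ?vnorm_ge0// ltW.
have w1 : vnorm w < 1 by exact: le_lt_trans w01.
(* On a shell of this thickness, radial projection changes 1 - <z, w> by at most [d], while the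
   projected value has modulus at least 2 d; the two moduli are thus comparable. *)
pose d := (1 - vnorm w) / 2.
have d0 : 0 < d by rewrite divr_gt0// subr_gt0.
have d1 : d <= 2^-1 by rewrite /d; have := vnorm_ge0 w; lra.
pose G z : R := (cabs (1 - inner (normalize z) w) ^+ (2 * m))^-1.
have Gge z : 2 * d <= cabs (1 - inner (normalize z) w).
  by apply: le_trans (cabs_1inner_ge w (normalize_le1 z)); rewrite /d; lra.
have G0 z : 0 <= G z by rewrite invr_ge0 exprn_ge0// cabs_ge0.
have mG : ymeas (fun x => G (zof x)).
  apply: ymeasV; apply: ymeasX; apply: cmeas_abs; apply: cmeasB.
    exact: cmeas_cst.
  exact/vmeas_inner/vmeas_normalize/vmeas_z_of.
have Gx0 x : (0 <= if (vnorm (zof x) < 1)%R then (G (zof x))%:E else 0)%E.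
  by case: ifP => // _; rewrite lee_fin.
have mGE : ymeas ((fun z => (G z)%:E) \o zof) by exact: ymeas_EFin.
have E : ballint (fun z => (cabs (power_kernel kappa m w0
     (fun j => rC rho * (z j * rC (vnorm z)^-1))) ^+ 2)%:E) =
   ((kappa ^+ 2)%:E * ballint (fun z => (G z)%:E))%E.
  rewrite /ballint -iintZ.
  - congr iint; apply/funext => x; case: ifP => _; last by rewrite mule0.
    rewrite -EFinM cabs_power_kernel2 /G; congr (_ * (cabs (1 - _) ^+ _)^-1)%:E.
    by rewrite /w inner_sclr cconj_rC -inner_scll.
  - exact: sqr_ge0.
  - by apply: ymeas_ball; [exact: mGE|exact: ymeas_cst].
  - exact: Gx0.
rewrite E.
have Gfin : (ballint (fun z => (G z)%:E) < +oo)%E.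
  apply: (@le_lt_trans _ _ (((2 * d) ^+ (2 * m))^-1%:E * ballint (fun=> 1%E))%E); last first.
    by rewrite lte_mul_pinfty ?lee_fin ?invr_ge0 ?exprn_ge0 ?ballvol_fin// mulr_ge0// ltW.
  rewrite /ballint -iintZ.
  - apply: iint_le => x; first exact: Gx0.
    case: ifP => _; last by rewrite mule0.
    have d20 : 0 < 2 * d by rewrite mulr_gt0.
    have A0 := lt_le_trans d20 (Gge (zof x)).
    rewrite mule1 lee_fin lef_pV2 ?posrE ?exprn_gt0//.
    by rewrite lerXn2r// nnegrE ltW.
  - by rewrite invr_ge0 exprn_ge0// mulr_ge0// ltW.
  - by apply: ymeas_ball; exact: ymeas_cst.
  - by move=> x; case: ifP.
have Gh : homog0 (fun z => (G z)%:E).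
  by move=> k z k0; rewrite /G normalize_scl.
have [v vE] : exists v, ballint (fun z => (G z)%:E) = v%:E.
  exists (fine (ballint (fun z => (G z)%:E))); rewrite fineK// ge0_fin_numE//.
  exact: iint_ge0.
have vge0 : 0 <= v by rewrite -lee_fin -vE; exact: iint_ge0.
have g_gt0 : 0 < gap w by exact: gap_gt0.
have main : d * v <= 2 ^+ (2 * m) * (K * gap w `^ (N%:R + 1 + 0 - (2 * m)%:R)).
  apply: (@le_trans _ _ ((1 - (1 - d) ^+ (2 * N)) * v)).
    apply: ler_wpM2r => //; apply: le_trans (one_minus_exprn_ge _ _ _) => //; lra.
  rewrite -lee_fin EFinM -vE -(homog0_shell _ _ Gh)//; [|lra|lra].
  rewrite EFinM; apply: le_trans (lee_wpmul2l _ (hK w w1)); last by rewrite lee_fin exprn_ge0.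
  rewrite /ballint -iintZ.
  - apply: iint_le => x; first by case: ifP => // _; rewrite lee_fin.
    case: ifPn => [/andP[x1 x2]|_]; last first.
      by rewrite mule_ge0 ?lee_fin ?exprn_ge0//; case: ifP => // _; rewrite lee_fin kernel_integrand_ge0.
    rewrite x2 -EFinM lee_fin /kernel_integrand powRr0 mul1r /G.
    move: x1 x2; set z := zof x => x1 x2.
    have A0 : 0 < cabs (1 - inner (normalize z) w).
      by apply: lt_le_trans (Gge z); rewrite mulr_gt0.
    have B0 : 0 < cabs (1 - inner z w).
      by apply: lt_le_trans (cabs_1inner_ge w (ltW x2)); rewrite subr_gt0.
    have BA : cabs (1 - inner z w) <= 2 * cabs (1 - inner (normalize z) w).
      have z0 : 0 < vnorm z by apply: lt_le_trans x1; lra.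
      have zE : inner z w = rC (vnorm z) * inner (normalize z) w.
        rewrite normalizeE inner_scll mulrA -rCM mulfV ?gt_eqF//.
        by rewrite [rC 1](_ : _ = 1)// mul1r.
      have -> : 1 - inner z w = (1 - inner (normalize z) w) +
          rC (1 - vnorm z) * inner (normalize z) w.
        by rewrite zE rCB [rC 1](_ : _ = 1)//; ring.
      apply: le_trans (cabsD _ _) _; rewrite mulr_natl mulr2n lerD2l.
      apply: le_trans (Gge z); rewrite cabsM cabs_rC ger0_norm ?subr_ge0 ?(ltW x2)//.
      have h1 : cabs (inner (normalize z) w) <= 1.
        apply: le_trans (cauchy_schwarz _ _) _.
        apply: mulr_ile1; [exact: vnorm_ge0|exact: vnorm_ge0|exact: normalize_le1|].
        exact: ltW.
      have : (1 - vnorm z) * cabs (inner (normalize z) w) <= 1 - vnorm z.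
        by rewrite ler_piMr// subr_ge0 ltW.
      by move: x1 d0; clear; lra.
    rewrite ler_pdivlMr ?exprn_gt0// mulrC ler_pdivrMr ?exprn_gt0//.
    by rewrite -exprMn lerXn2r// nnegrE ?mulr_ge0 ?cabs_ge0.
  - by rewrite exprn_ge0.
  - by apply: ymeas_ball; [exact/ymeas_EFin/ymeas_kernel_integrand|exact: ymeas_cst].
  - by move=> x; case: ifP => // _; rewrite lee_fin kernel_integrand_ge0.
have gd : gap w <= 4 * d.
  have : 0 <= (1 - vnorm w) ^+ 2 by exact: sqr_ge0.
  by rewrite /gap /d; lra.
have gg : gap w0 <= gap w.
  by rewrite lerD2l lerN2 lerXn2r// nnegrE vnorm_ge0.
have g0_gt0 : 0 < gap w0 by exact: gap_gt0.
have v_le : v <= 4 * (2 ^+ (2 * m) * K) * gap w0 `^ (N%:R - (2 * m)%:R).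
  rewrite -(ler_pM2l d0); apply: le_trans main _.
  set e : R := (2 * m)%:R - N%:R.
  have e0 : 0 <= e by rewrite /e; move: am; clear; lra.
  have -> : N%:R - (2 * m)%:R = - e by rewrite /e; ring.
  rewrite (_ : N%:R + 1 + 0 - (2 * m)%:R = 1 + - e); last by rewrite /e; ring.
  rewrite powRD; last by rewrite (gt_eqF g_gt0) implybT.
  rewrite powRr1 ?(ltW g_gt0)//.
  have h1 := powRN_le e0 g0_gt0 gg.
  have h2 : gap w * gap w `^ (- e) <= (4 * d) * gap w0 `^ (- e).
    by apply: ler_pM; rewrite ?powR_ge0// ltW.
  have h3 : 0 <= 2 ^+ (2 * m) * K by rewrite mulr_ge0// exprn_ge0.
  have h4 := ler_wpM2l h3 h2; rewrite mulrA; apply: le_trans h4 _.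
  by rewrite le_eqVlt; apply/orP; left; apply/eqP; ring.
rewrite vE -!EFinM lee_fin.
have -> : kappa ^+ 2 * (4 * (2 ^+ (2 * m) * K) / ballvol R n * gap w0 `^ (N%:R - (2 * m)%:R)) =
  kappa ^+ 2 * (4 * (2 ^+ (2 * m) * K) * gap w0 `^ (N%:R - (2 * m)%:R)) / ballvol R n by ring.
apply: ler_wpM2r; first by rewrite invr_ge0; exact: ltW.
by apply: ler_wpM2l => //; exact: sqr_ge0.
Qed.

End KernelNorm.

(** * Analyticity of kernel functions *)

Section KernelAnalytic.
Variables (R : realType) (N : nat).
Local Notation C := R[i].
Local Notation V := ('I_N -> C).

(** Induction on [m]: the new remainder is (p - x)^-1 times the old remainder plus an explicit
    multiple of x^2. *)
Lemma inv_exprn_taylor (p : C) (m : nat) : p != 0 ->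
  exists2 K : R, 0 <= K & forall x : C, cabs x <= cabs p / 2 ->
    cabs (((p - x) ^+ m)^-1 - (p ^+ m)^-1 - m%:R * x * (p ^+ m.+1)^-1)
      <= K * cabs x ^+ 2.
Proof.
move=> p0; have cp0 : 0 < cabs p by rewrite lt_neqAle cabs_ge0 eq_sym cabs_eq0 p0.
elim: m => [|m [K K0 IH]].
  by exists 0 => // x _; rewrite !expr0 subrr !mul0r subr0 cabs0.
pose L : R := cabs (m.+1%:R * (p ^+ m.+2)^-1).
have L0 : 0 <= L by exact: cabs_ge0.
exists (2 / cabs p * (K + L)).
  by rewrite mulr_ge0// ?divr_ge0 ?cabs_ge0// addr_ge0.
move=> x hx; have q0 : cabs p / 2 <= cabs (p - x).
  have := cabsD (p - x) x; rewrite subrK => h.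
  by move: h hx; lra.
have q_gt0 : 0 < cabs (p - x) by apply: lt_le_trans q0; rewrite divr_gt0.
have qn0 : p - x != 0 by rewrite -cabs_eq0 gt_eqF.
rewrite (_ : _ - _ = (p - x)^-1 * ((((p - x) ^+ m)^-1 - (p ^+ m)^-1 - m%:R * x * (p ^+ m.+1)^-1)
   + m.+1%:R * (p ^+ m.+2)^-1 * x ^+ 2)); last first.
  rewrite -natr1 !exprS; field.
  by rewrite !expf_neq0// p0 qn0.
rewrite cabsM cabsV -[leRHS]mulrA; apply: ler_pM.
- by rewrite invr_ge0 cabs_ge0.
- exact: cabs_ge0.
- by rewrite -[2 / _]invf_div lef_pV2 ?posrE ?divr_gt0.
rewrite mulrDl; apply: le_trans (cabsD _ _) _; apply: lerD; first exact: IH.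
by rewrite cabsM cabsX.
Qed.

Lemma power_kernel_analytic (kappa : R) (m : nat) (w : V) : vnorm w < 1 ->
  analytic_on_ball (fun z => rC kappa * ((1 - inner z w) ^+ m)^-1).
Proof.
move=> w1 z z1; set p := 1 - inner z w.
have p0 : p != 0.
  apply/eqP => /eqP; rewrite subr_eq0 => /eqP h.
  have := cauchy_schwarz z w; rewrite -h cabs1; apply/negP; rewrite -ltNge.
  by rewrite mulr_ilt1 ?vnorm_ge0.
have cp0 : 0 < cabs p by rewrite lt_neqAle cabs_ge0 eq_sym cabs_eq0 p0.
have [K K0 hK] := inv_exprn_taylor m p0.
exists (fun j => rC kappa * m%:R * (p ^+ m.+1)^-1 * cconj (w j)) => eps eps0.
pose D : R := `|kappa| * K + 1.
have D0 : 0 < D by rewrite ltr_pwDr// mulr_ge0.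
exists (Num.min (cabs p / 2) (eps / D)).
  by rewrite lt_min !divr_gt0.
move=> h; rewrite lt_min => /andP[h1 h2] _.
have hx : cabs (inner h w) <= vnorm h.
  apply: le_trans (cauchy_schwarz _ _) _.
  by rewrite ler_piMr ?vnorm_ge0// ltW.
have -> : inner (fun j => z j + h j) w = inner z w + inner h w by exact: inner_addl.
rewrite (_ : \sum_(j < N) _ = rC kappa * m%:R * (p ^+ m.+1)^-1 * inner h w); last first.
  rewrite /inner mulr_sumr; apply: eq_bigr => j _.
  by rewrite -!mulrA; congr (_ * (_ * (_ * _))); rewrite mulrC.
rewrite (_ : 1 - (inner z w + inner h w) = p - inner h w); last by rewrite /p; ring.
rewrite (_ : _ - _ = rC kappa * (((p - inner h w) ^+ m)^-1 - (p ^+ m)^-1 -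
  m%:R * inner h w * (p ^+ m.+1)^-1)); last by rewrite -/p; ring.
rewrite cabsM cabs_rC.
have := hK (inner h w) (le_trans hx (ltW h1)) => h3.
apply: (@le_trans _ _ (`|kappa| * (K * vnorm h ^+ 2))).
  apply: ler_wpM2l => //; apply: le_trans h3 _; apply: ler_wpM2l => //.
  by rewrite lerXn2r// nnegrE ?cabs_ge0 ?vnorm_ge0.
rewrite mulrA expr2 mulrA; apply: ler_wpM2r; first exact: vnorm_ge0.
have : D * vnorm h <= eps by rewrite mulrC -ler_pdivlMr// ltW.
apply: le_trans; apply: ler_wpM2r; first exact: vnorm_ge0.
by rewrite /D lerDl.
Qed.

Lemma analytic_continuous (f : V -> C) z : analytic_on_ball f -> inball z ->
  forall eps : R, 0 < eps -> exists2 d : R, 0 < d &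
    forall y, vnorm (vsub y z) < d -> inball y -> cabs (f y - f z) < eps.
Proof.
move=> hf z1 eps e0; have [L hL] := hf z z1.
have [d d0 hd] := hL 1 ltr01.
pose M : R := \sum_(j < N) cabs (L j) + 1.
have M0 : 0 < M by rewrite ltr_pwDr// sumr_ge0// => j _; exact: cabs_ge0.
exists (Num.min d (eps / M)); first by rewrite lt_min d0 divr_gt0.
move=> y; rewrite lt_min => /andP[y1 y2] yb.
have := hd (vsub y z) y1.
have -> : (fun j => z j + vsub y z j) = y by apply/funext => j; rewrite /vsub addrC subrK.
move=> /(_ yb); rewrite mul1r => h.
set S := \sum_(j < N) L j * vsub y z j in h *.
have hS : cabs S <= (M - 1) * vnorm (vsub y z).
  rewrite /M addrK mulr_suml /S; elim/big_ind2 : _ => [|a b c d' h1 h2|j _].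
  - by rewrite cabs0.
  - by apply: le_trans (cabsD _ _) _; exact: lerD.
  - by rewrite cabsM; apply: ler_wpM2l; [exact: cabs_ge0|exact: cabs_le_vnorm].
have := cabsD (f y - f z - S) S; rewrite subrK => h2.
have : M * vnorm (vsub y z) < eps by rewrite mulrC -ltr_pdivlMr.
by move: h h2 hS; lra.
Qed.

End KernelAnalytic.

(** * Compactness makes differences of kernels small *)

Section CompactDifference.
Variables (R : realType) (n : nat).
Hypothesis n_gt0 : (0 < n)%N.
Local Notation N := n.+1.
Local Notation C := R[i].
Local Notation V := ('I_N -> C).
Variable H : fspace R.
Hypothesis admH : admissible H.
Local Notation s := (kernel_exponent n H).

Lemma kernel_exponent_gt0 : 0 < s.
Proof.
rewrite /kernel_exponent; have : (1 : R) <= N%:R by rewrite ler1n.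
by move: admH; case: H => [|a] /= h; lra.
Qed.

Lemma norm2_lower eps : 0 < eps -> eps <= 8^-1 ->
  exists2 c, 0 < c & forall w (f : V -> C) b, 0 < vnorm w -> vnorm w < 1 -> 0 <= b ->
    (forall z, vnorm z < 1 -> koranyi_box eps w z -> b <= cabs (f z) ^+ 2) ->
    ((c * b * powR (gap w) s)%:E <= norm2 H f)%E.
Proof.
move: admH; case: H => [_|a a1] e0 e8; first exact: (norm2_lower_hardy (n_gt0 : (1 < N)%N)).
have [c c0 hc] := norm2_lower_bergman (n_gt0 : (1 < N)%N) a1 e0 e8.
by exists c => // w f b _; exact: hc.
Qed.

Lemma norm2_kernel m : s + 1 < (2 * m)%:R ->
  exists2 K, 0 <= K & forall (w : V) kappa, vnorm w < 1 ->
    (norm2 H (power_kernel kappa m w) <=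
     (kappa ^+ 2 * (K * gap w `^ (s - (2 * m)%:R)))%:E)%E.
Proof.
move: admH; case: H => [_|a a1] /= hm; first exact: norm2_kernel_hardy.
by apply: norm2_kernel_bergman => //; move: hm; lra.
Qed.

Definition vcontinuous_on_ball (phi : V -> V) := forall z, inball z ->
  forall e : R, 0 < e -> exists2 d : R, 0 < d &
    forall y, vnorm (vsub y z) < d -> inball y -> vnorm (vsub (phi y) (phi z)) < e.

(** Near [z] the values of [phi] keep a distance [rho] from the sphere, so the kernels are bounded
    by rho^(-m) uniformly in their poles; the factor [kappa] does the rest. *)
Lemma power_kernel_small (phi : V -> V) (m : nat) (a : nat -> V) (kappa : nat -> R) z :
  vcontinuous_on_ball phi -> (forall y, inball y -> inball (phi y)) ->
  (forall k, vnorm (a k) < 1) -> (forall k, 0 <= kappa k) ->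
  (forall e : R, 0 < e -> exists K, forall k, (K <= k)%N -> kappa k < e) ->
  inball z -> forall e : R, 0 < e -> exists2 d : R, 0 < d & exists K, forall k, (K <= k)%N ->
    forall y, vnorm (vsub y z) < d -> inball y ->
      cabs (power_kernel (kappa k) m (a k) (phi y)) < e.
Proof.
move=> hc hb ha hk0 hk z1 e e0.
pose rho := (1 - vnorm (phi z)) / 2.
have rho0 : 0 < rho by rewrite divr_gt0// subr_gt0; exact: hb.
have [d d0 hd] := hc z z1 rho rho0.
have [K hK] := hk (e * rho ^+ m) (mulr_gt0 e0 (exprn_gt0 _ rho0)).
exists d => //; exists K => k Kk y yd yb.
have ylt : vnorm (phi y) <= 1 - rho.
  have h := vnormD (vsub (phi y) (phi z)) (phi z).
  have hE : vadd (vsub (phi y) (phi z)) (phi z) = phi y.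
    by apply/funext => j; rewrite /vadd /vsub subrK.
  rewrite hE in h; have := hd y yd yb; move: h; rewrite /rho; lra.
have q : rho <= cabs (1 - inner (phi y) (a k)).
  rewrite (_ : rho = 1 - (1 - rho)); last by ring.
  rewrite lerBlDr -[leLHS](cabs1 R) -[in leLHS](subrK (inner (phi y) (a k)) 1).
  apply: le_trans (cabsD _ _) _; rewrite lerD2l.
  apply: le_trans (cauchy_schwarz _ _) _; apply: le_trans ylt.
  by rewrite ler_piMr ?vnorm_ge0//; exact: ltW.
have q0 := lt_le_trans rho0 q.
rewrite /power_kernel cabsM cabs_rC ger0_norm// cabsV cabsX.
rewrite ltr_pdivrMr ?exprn_gt0//; apply: lt_le_trans (hK k Kk) _.
by apply: ler_wpM2l; [exact: ltW|rewrite lerXn2r// nnegrE ltW].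
Qed.

Lemma cvge0_small (u : nat -> \bar R) : u @ \oo --> (0 : \bar R)%E ->
  forall e : R, 0 < e -> exists K, forall k, (K <= k)%N -> (u k < e%:E)%E.
Proof.
move=> hu e e0.
have h : nbhs (0%R)%:E [set y : \bar R | (y < e%:E)%E].
  exact: (@nbhs_open_ereal_lt _ 0 (fun=> e)).
have [K _ hK] := hu _ h.
by exists K => k Kk; exact: hK.
Qed.

Lemma ge_id_of_homo (t : nat -> nat) :
  {homo t : i j / (i < j)%N >-> (i < j)%N} -> forall k, (k <= t k)%N.
Proof.
move=> ht; elim=> [//|k IH]; exact: leq_ltn_trans IH (ht _ _ (ltnSn k)).
Qed.

Lemma powR_small (u : nat -> R) (p : R) : 0 < p -> (forall k, 0 <= u k) ->
  (forall e : R, 0 < e -> exists K, forall k, (K <= k)%N -> u k < e) ->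
  (forall e : R, 0 < e -> exists K, forall k, (K <= k)%N -> u k `^ p < e).
Proof.
move=> p0 u0 hu e e0; have [K hK] := hu (e `^ p^-1) (powR_gt0 _ e0).
exists K => k Kk; have := hK k Kk => h.
have -> : e = (e `^ p^-1) `^ p by rewrite -powRrM mulVf ?gt_eqF// powRr1// ltW.
by apply: gt0_ltr_powR => //; rewrite nnegrE// powR_ge0.
Qed.

(** A subsequence of the images of normalized kernels converges in norm to some [g]. The local lower
    bound is used twice: at a fixed centre it forces [g] to vanish, and at the moving centres [w k]
    it turns norm convergence into the pointwise estimate. *)
Theorem compact_difference_small (phi psi : V -> V) (m : nat) (w a : nat -> V) :
  vcontinuous_on_ball phi -> (forall y, inball y -> inball (phi y)) ->
  vcontinuous_on_ball psi -> (forall y, inball y -> inball (psi y)) ->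
  compact_op H (fun f z => Cop phi f z - Cop psi f z) ->
  s + 1 < (2 * m)%:R ->
  (forall k, vnorm (a k) < 1) ->
  (forall e : R, 0 < e -> exists K, forall k, (K <= k)%N -> gap (a k) < e) ->
  (forall k, vnorm (w k) < 1 /\ gap (w k) <= 2^-1) ->
  forall eps K, 0 < eps -> eps <= 8^-1 ->
  exists k z, [/\ (K <= k)%N, inball z, koranyi_box eps (w k) z &
    gap (w k) `^ s * gap (a k) `^ ((2 * m)%:R - s) *
      cabs (((1 - inner (phi z) (a k)) ^+ m)^-1 -
            ((1 - inner (psi z) (a k)) ^+ m)^-1) ^+ 2 < eps].
Proof.
move=> cphi bphi cpsi bpsi hT hm a1 a0 hw eps K eps0 eps8.
have ga k : 0 < gap (a k) by exact: gap_gt0.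
have [K0 K00 hK0] := norm2_kernel hm.
pose e : R := (2 * m)%:R - s.
have e0 : 0 < e by rewrite /e; move: hm; lra.
(* [K0 + 1] instead of [K0], which may be 0. *)
pose k0 : R := Num.sqrt (K0 + 1)^-1.
have K10 : 0 < K0 + 1 by rewrite ltr_wpDl.
have k00 : 0 < k0 by rewrite sqrtr_gt0 invr_gt0.
have k02 : k0 ^+ 2 = (K0 + 1)^-1 by rewrite sqr_sqrtr// invr_ge0 ltW.
(* The square of this factor compensates the growth gap^(-e) of the squared norm. *)
pose kappa k := k0 * gap (a k) `^ (e / 2).
have kappa2 k : kappa k ^+ 2 = k0 ^+ 2 * gap (a k) `^ e.
  rewrite exprMn; congr (_ * _); rewrite -powR_mulrn ?powR_ge0// -powRrM.
  by congr (_ `^ _); field.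
have kappa_ge0 k : 0 <= kappa k by rewrite mulr_ge0 ?powR_ge0// ltW.
have kappa_small : forall e' : R, 0 < e' -> exists K, forall k, (K <= k)%N -> kappa k < e'.
  move=> e' e'0; have e2 : 0 < e / 2 by exact: divr_gt0.
  have [|K' hK'] := powR_small e2 (fun k => ltW (ga k)) a0 (e := e' / k0).
    exact: divr_gt0.
  exists K' => k Kk; rewrite /kappa mulrC -ltr_pdivlMr//; exact: hK'.
pose f k := power_kernel (kappa k) m (a k).
have nf k : (norm2 H (f k) <= 1)%E.
  apply: le_trans (hK0 (a k) (kappa k) (a1 k)) _.
  rewrite lee_fin kappa2 k02 (_ : s - (2 * m)%:R = - e); last by rewrite /e; ring.
  rewrite powRN; set g := gap (a k) `^ e.
  have g0 : 0 < g by exact: powR_gt0.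
  rewrite [leLHS](_ : _ = K0 / (K0 + 1)); last by field; rewrite !gt_eqF.
  by rewrite ler_pdivrMr// mul1r lerDl.
have [|t [g [ht [gan _] hg]]] := hT f.
  move=> k; split; last exact: nf.
  split; first exact: power_kernel_analytic.
  exact: le_lt_trans (nf k) (ltry _).
have tid := ge_id_of_homo ht.
(* If [g z] were nonzero, the differences would stay away from [g] near [z], contradicting norm
   convergence. The origin is excluded because [norm2_lower] asks for a nonzero centre. *)
have gz z : vnorm z < 1 -> 0 < vnorm z -> g z = 0.
  move=> z1 z0; apply/eqP; apply: contraT => gz0.
  have b0 : 0 < cabs (g z) by rewrite lt_neqAle cabs_ge0 eq_sym cabs_eq0 gz0.
  set b := cabs (g z) in b0.
  have b2 : 0 < b / 2 by exact: divr_gt0.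
  have b8 : 0 < b / 8 by exact: divr_gt0.
  have [d1 d10 hd1] := analytic_continuous gan z1 b2.
  have [d2 d20 [K2 hd2]] := power_kernel_small m cphi bphi a1 kappa_ge0 kappa_small z1 b8.
  have [d3 d30 [K3 hd3]] := power_kernel_small m cpsi bpsi a1 kappa_ge0 kappa_small z1 b8.
  pose d := Num.min d1 (Num.min d2 d3).
  have d0 : 0 < d by rewrite !lt_min d10 d20.
  (* A point [y] of the box around [z] then satisfies |y - z|^2 <= ep < d^2. *)
  pose ep := Num.min 8^-1 (d ^+ 2 / 2).
  have ep0 : 0 < ep by rewrite lt_min invr_gt0 ltr0n divr_gt0// exprn_gt0.
  have ep8 : ep <= 8^-1 by rewrite ge_min lexx.
  have epd : ep <= d ^+ 2 / 2 by rewrite ge_min lexx orbT.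
  have [c c0 hc] := norm2_lower ep0 ep8.
  pose M : R := c * (b / 4) ^+ 2 * gap z `^ s.
  have M0 : 0 < M.
    by rewrite !mulr_gt0 ?exprn_gt0 ?divr_gt0 ?powR_gt0//; exact: gap_gt0.
  have [K4 hK4] := cvge0_small hg M0.
  pose k := maxn K4 (maxn K2 K3).
  have := hK4 k (leq_maxl _ _); rewrite ltNge => /negP; case.
  apply: hc => //; first exact: sqr_ge0.
  move=> y y1 /andP[_ hy].
  have yd : vnorm (vsub y z) < d.
    rewrite -(@ltr_pXn2r _ 2) ?nnegrE ?vnorm_ge0 ?(ltW d0)//.
    apply: le_lt_trans hy _; apply: (@le_lt_trans _ _ ep).
      by rewrite ler_piMr ?(ltW ep0)//; exact: gap_le1.
    by apply: le_lt_trans epd _; rewrite ltr_pdivrMr// ltr_pMr ?exprn_gt0// ltr1n.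
  move: yd; rewrite !lt_min => /andP[y1' /andP[y2 y3]].
  have tk K' : (K' <= k)%N -> (K' <= t k)%N by move=> h; exact: leq_trans h (tid k).
  have hh2 : (K2 <= t k)%N by apply: tk; rewrite /k !leq_max leqnn orbT.
  have hh3 : (K3 <= t k)%N by apply: tk; rewrite /k !leq_max leqnn !orbT.
  have A1 := hd1 y y1' y1.
  have A2 := hd2 _ hh2 y y2 y1.
  have A3 := hd3 _ hh3 y y3 y1.
  rewrite lerXn2r ?nnegrE ?cabs_ge0 ?divr_ge0 ?(ltW b0)// /Cop.
  set F := f (t k) (phi y) - f (t k) (psi y).
  have F4 : cabs F <= b / 8 + b / 8.
    apply: (le_trans (cabsB _ _)); apply: lerD; first exact: (ltW A2).
    exact: (ltW A3).
  have := cabsD (g y) (g z - g y); rewrite [g y + _]addrC subrK -/b cabsBC => B1.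
  have := cabsD (F - g y) (- F); rewrite addrAC subrr add0r !cabsN => B2.
  by move: A1 F4 B1 B2; clear; lra.
(* If the estimate failed on every box of index at least [K], the lower bound at [w (t k)] would
   keep the norms above a positive constant. *)
apply: contrapT => hn.
have [c c0 hc] := norm2_lower eps0 eps8.
have M0 : 0 < c * (k0 ^+ 2 * eps) by rewrite mulr_gt0// mulr_gt0// exprn_gt0.
have [K4 hK4] := cvge0_small hg M0.
pose k := maxn K4 K.
have := hK4 k (leq_maxl _ _); rewrite ltNge => /negP; case.
have [w1 w2] := hw (t k); set ww := w (t k) in w1 w2.
have gw0 : 0 < gap ww by exact: gap_gt0.
have ww0 : 0 < vnorm ww.
  rewrite lt_neqAle vnorm_ge0 andbT eq_sym; apply/eqP => h.
  by move: w2; rewrite /gap h expr0n subr0; lra.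
have gs0 : 0 < gap ww `^ s by exact: powR_gt0.
rewrite (_ : c * _ = c * (k0 ^+ 2 * eps / gap ww `^ s) * gap ww `^ s); last first.
  by rewrite -!mulrA mulVf ?gt_eqF// mulr1.
apply: hc => //.
  by rewrite divr_ge0 ?(ltW gs0)// mulr_ge0 ?sqr_ge0// ltW.
move=> z z1 hz.
(* The gap at the origin is 1, whereas on the box it is at most 3/2 times 1/2. *)
have z0 : 0 < vnorm z.
  rewrite lt_neqAle vnorm_ge0 andbT eq_sym; apply/eqP => h.
  have /andP[_] := gap_box eps8 w1 hz.
  by rewrite {1}/gap h expr0n subr0; move: w2; lra.
rewrite gz// subr0 /Cop /f /power_kernel -mulrBr cabsM exprMn cabs_rC.
rewrite (ger0_norm (kappa_ge0 _)) kappa2.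
set B := cabs _.
have mulrAACA (x y v r : R) : x * y * v * r = x * (r * y * v) by ring.
rewrite ler_pdivrMr// mulrAACA.
apply: ler_wpM2l; first exact: sqr_ge0.
have [//|h] := leP eps (gap ww `^ s * gap (a (t k)) `^ e * B ^+ 2).
exfalso; apply: hn; exists (t k), z; split => //.
by apply: leq_trans (tid k); exact: leq_maxr.
Qed.

End CompactDifference.

(** * Linear-fractional maps up to the sphere *)

Section LinearFractional.
Variables (R : realType) (n : nat).
Local Notation N := n.+1.
Local Notation C := R[i].
Local Notation V := ('I_N -> C).
Implicit Types z w u : V.

Lemma vnorm_le_sum z : vnorm z <= \sum_j cabs (z j).
Proof.
rewrite -(@ler_pXn2r _ 2) ?nnegrE ?vnorm_ge0//; last first.
  by apply: sumr_ge0 => j _; exact: cabs_ge0.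
rewrite vnorm2E expr2 mulr_suml; apply: ler_sum => j _.
rewrite expr2; apply: ler_wpM2l; first exact: cabs_ge0.
by rewrite (bigD1 j)//= lerDl; apply: sumr_ge0 => i _; exact: cabs_ge0.
Qed.

Definition linear_map (D : V -> V) : Prop :=
  [/\ forall u w, D (vadd u w) = vadd (D u) (D w),
      forall a u, D (vscl a u) = vscl a (D u) &
      exists2 M, 0 <= M & forall u, vnorm (D u) <= M * vnorm u].

Definition linear_form (c : V -> C) : Prop :=
  [/\ forall u w, c (vadd u w) = c u + c w,
      forall a u, c (vscl a u) = a * c u &
      exists2 M, 0 <= M & forall u, cabs (c u) <= M * vnorm u].

Lemma linear_form_inner w : linear_form (fun u => inner u w).
Proof.
split=> [u v|a u|]; [exact: inner_addl|exact: inner_scll|].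
exists (vnorm w) => [|u]; first exact: vnorm_ge0.
by rewrite mulrC; exact: cauchy_schwarz.
Qed.

Lemma linear_form_scale a c : linear_form c -> linear_form (fun u => a * c u).
Proof.
move=> [c1 c2 [M M0 cM]]; split=> [u v|b u|].
- by rewrite c1 mulrDr.
- by rewrite c2 mulrCA.
- exists (cabs a * M) => [|u]; first by rewrite mulr_ge0// cabs_ge0.
  by rewrite cabsM -mulrA; apply: ler_wpM2l; [exact: cabs_ge0|exact: cM].
Qed.

Lemma linear_form_comp D c : linear_map D -> linear_form c -> linear_form (fun u => c (D u)).
Proof.
move=> [d1 d2 [L L0 dL]] [c1 c2 [M M0 cM]]; split=> [u v|b u|].
- by rewrite d1 c1.
- by rewrite d2 c2.
- exists (M * L) => [|u]; first exact: mulr_ge0.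
  by apply: le_trans (cM _) _; rewrite -mulrA; apply: ler_wpM2l.
Qed.

Definition mul_mxv (A : 'M[C]_N) z : V := fun i => \sum_(j < N) A i j * z j.

Lemma linear_mul_mxv A : linear_map (mul_mxv A).
Proof.
split=> [u v|a u|].
- apply/funext => i; rewrite /mul_mxv /vadd -big_split; apply: eq_bigr => j _.
  by rewrite mulrDr.
- apply/funext => i; rewrite /mul_mxv /vscl mulr_sumr; apply: eq_bigr => j _.
  by rewrite mulrCA.
- exists (\sum_i \sum_j cabs (A i j)).
    by apply: sumr_ge0 => i _; apply: sumr_ge0 => j _; exact: cabs_ge0.
  move=> u; apply: le_trans (vnorm_le_sum _) _; rewrite mulr_suml.
  apply: ler_sum => i _; rewrite mulr_suml /mul_mxv.
  elim/big_ind2 : _ => [|a b c d h1 h2|j _].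
  + by rewrite cabs0.
  + by apply: le_trans (cabsD _ _) _; exact: lerD.
  + by rewrite cabsM; apply: ler_wpM2l; [exact: cabs_ge0|exact: cabs_le_vnorm].
Qed.

Lemma linear_map_sub D E : linear_map D -> linear_map E ->
  linear_map (fun u => vsub (D u) (E u)).
Proof.
move=> [d1 d2 [L L0 dL]] [c1 c2 [M M0 cM]]; split=> [u v|b u|].
- by rewrite d1 c1; apply/funext => j; rewrite /vsub /vadd; ring.
- by rewrite d2 c2; apply/funext => j; rewrite /vsub /vscl; ring.
- exists (L + M) => [|u]; first exact: addr_ge0.
  by apply: le_trans (vnormB _ _) _; rewrite mulrDl; apply: lerD.
Qed.

Lemma linear_map_scale a D : linear_map D -> linear_map (fun u => vscl a (D u)).
Proof.
move=> [d1 d2 [L L0 dL]]; split=> [u v|b u|].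
- by rewrite d1; apply/funext => j; rewrite /vscl /vadd; ring.
- by rewrite d2; apply/funext => j; rewrite /vscl; ring.
- exists (cabs a * L) => [|u]; first by rewrite mulr_ge0// cabs_ge0.
  by rewrite vnorm_scl -mulrA; apply: ler_wpM2l; [exact: cabs_ge0|exact: dL].
Qed.

Lemma linear_map_form c w : linear_form c -> linear_map (fun u => vscl (c u) w).
Proof.
move=> [c1 c2 [M M0 cM]]; split=> [u v|b u|].
- by rewrite c1; apply/funext => j; rewrite /vscl /vadd; ring.
- by rewrite c2; apply/funext => j; rewrite /vscl; ring.
- exists (M * vnorm w) => [|u]; first by rewrite mulr_ge0// vnorm_ge0.
  by rewrite vnorm_scl mulrAC; apply: ler_wpM2r; [exact: vnorm_ge0|exact: cM].
Qed.

(* [phi] in projective form around [z0]: the value there, the derivative [D],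
   and the form [c] that governs the second-order term. *)
Definition lf_jet (phi : V -> V) z0 (eta : V) (D : V -> V) (c : V -> C) : Prop :=
  [/\ linear_map D, linear_form c &
      forall h, inball (vadd z0 h) -> 1 + c h != 0 /\
        phi (vadd z0 h) = vadd eta (vscl (1 + c h)^-1 (D h))].

Lemma lfmapE A B c0 d z :
  lfmap A B c0 d z = vscl (inner z c0 + d)^-1 (vadd (mul_mxv A z) B).
Proof. by apply/funext => i; rewrite /lfmap /vscl mulrC. Qed.

(** Subtracting the value at [z0] leaves a numerator linear in [h]; numerator and denominator are
    then divided by the denominator at [z0]. The expansion is exact, without remainder. *)
Lemma lf_expansion A B c0 d z0 : inner z0 c0 + d != 0 -> exists D c,
  [/\ linear_map D, linear_form c,
      forall h, inner (vadd z0 h) c0 + d = (inner z0 c0 + d) * (1 + c h) &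
      forall h, 1 + c h != 0 ->
        lfmap A B c0 d (vadd z0 h) = vadd (lfmap A B c0 d z0) (vscl (1 + c h)^-1 (D h))].
Proof.
set e := inner z0 c0 + d => e0; set eta := lfmap A B c0 d z0.
pose c h := e^-1 * inner h c0.
pose D h := vscl e^-1 (vsub (mul_mxv A h) (vscl (inner h c0) eta)).
exists D, c; split.
- apply: linear_map_scale; apply: linear_map_sub; first exact: linear_mul_mxv.
  by apply: linear_map_form; exact: linear_form_inner.
- by apply: linear_form_scale; exact: linear_form_inner.
- by move=> h; rewrite inner_addl /c -/e mulrDr mulr1 mulVKf// /e; ring.
- move=> h ch; rewrite !lfmapE inner_addl.
  have -> : inner z0 c0 + inner h c0 + d = e * (1 + c h).
    by rewrite /c mulrDr mulr1 mulVKf// /e; ring.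
  have [m1 _ _] := linear_mul_mxv A; rewrite m1.
  apply/funext => j; rewrite /vadd /vscl /D /vscl /vsub /eta lfmapE -/e /vscl /vadd.
  have ih : inner h c0 = e * c h by rewrite /c mulVKf.
  by rewrite ih; field; rewrite e0 ch.
Qed.

Lemma lf_continuous A B c0 d z0 : inner z0 c0 + d != 0 ->
  forall eps : R, 0 < eps -> exists2 del : R, 0 < del & forall y, vnorm (vsub y z0) < del ->
    vnorm (vsub (lfmap A B c0 d y) (lfmap A B c0 d z0)) < eps.
Proof.
move=> e0 eps eps0; have [D [c [hD hc _ hphi]]] := lf_expansion A B e0.
have [_ _ [M M0 DM]] := hD; have [_ _ [L L0 cL]] := hc.
have q0 : 0 < 2 * L + 1 by rewrite ltr_pwDr// mulr_ge0.
have r0 : 0 < 2 * M + 1 by rewrite ltr_pwDr// mulr_ge0.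
exists (Num.min (2 * L + 1)^-1 (eps / (2 * M + 1))).
  by rewrite lt_min invr_gt0 q0 divr_gt0.
move=> y; set h := vsub y z0; rewrite lt_min => /andP[h1 h2].
have yE : y = vadd z0 h by apply/funext => j; rewrite /vadd /h /vsub addrC subrK.
have h3 : (2 * L + 1) * vnorm h < 1 by rewrite mulrC -ltr_pdivlMr// mul1r.
have h4 : (2 * M + 1) * vnorm h < eps by rewrite mulrC -ltr_pdivlMr.
have v0 := vnorm_ge0 h.
have ch : cabs (c h) <= 2^-1 by have := cL h; move: h3 v0; lra.
have c1 : 2^-1 <= cabs (1 + c h).
  have := cabsB (1 + c h) (c h); rewrite addrK cabs1; lra.
have c10 : 0 < cabs (1 + c h) by apply: lt_le_trans c1; rewrite invr_gt0.
have c1n : 1 + c h != 0 by rewrite -cabs_eq0 gt_eqF.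
rewrite yE hphi//.
rewrite (_ : vsub _ _ = vscl (1 + c h)^-1 (D h)); last first.
  by apply/funext => j; rewrite /vsub /vadd addrAC subrr add0r.
rewrite vnorm_scl cabsV; apply: (@le_lt_trans _ _ (2 * (M * vnorm h))); last first.
  by move: h4 v0; lra.
apply: ler_pM; rewrite ?invr_ge0 ?cabs_ge0 ?vnorm_ge0//.
by rewrite -[leRHS]invrK lef_pV2 ?posrE.
Qed.

Lemma vnorm_eq0P z : vnorm z = 0 -> z = fun=> 0.
Proof. by move=> /vnorm0_eq0 h; apply/funext => j; exact: h. Qed.

(* A curve leaving the sphere at [zeta] with velocity [u]; when
   [Re <u, zeta> = 0], any [K > |u|^2 / 2] keeps it in the ball for small
   [t <> 0], with gap comparable to [t ^+ 2]. *)
Definition horo (zeta u : V) (K t : R) : V :=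
  vadd (vscl (rC (1 - K * t ^+ 2)) zeta) (vscl (rC t) u).

Lemma horo_gap (zeta u : V) (K t : R) : vnorm zeta = 1 -> cre (inner u zeta) = 0 ->
  gap (horo zeta u K t) = t ^+ 2 * (2 * K - vnorm u ^+ 2 - K ^+ 2 * t ^+ 2).
Proof.
move=> z1 hu; rewrite /gap /horo vnorm2_add !vnorm_scl !cabs_rC z1.
rewrite inner_scll inner_sclr cconj_rC !cre_rCM (inner_conj u zeta) /= hu !mulr0.
by rewrite mulr1 exprMn !real_normK ?num_real//; ring.
Qed.

(** For K = |u|^2 + 1 the factor in [horo_gap] is |u|^2 + 2 - K (K t^2), which is at least 1. *)
Lemma horo_gap_ge (zeta u : V) (t : R) : vnorm zeta = 1 -> cre (inner u zeta) = 0 ->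
  (vnorm u ^+ 2 + 1) * t ^+ 2 <= 1 ->
  t ^+ 2 <= 1 - vnorm (horo zeta u (vnorm u ^+ 2 + 1) t) ^+ 2.
Proof.
move=> z1 hu ht; rewrite -/(gap _) horo_gap//.
set U := vnorm u ^+ 2 in ht *; have U0 : 0 <= U by exact: sqr_ge0.
rewrite -[leLHS]mulr1; apply: ler_wpM2l; first exact: sqr_ge0.
have := mulr_ge0 (addr_ge0 U0 ler01) (_ : 0 <= 1 - (U + 1) * t ^+ 2).
by rewrite subr_ge0 => /(_ ht); lra.
Qed.

Lemma ge0_small_le0 (x M : R) : 0 <= M -> (forall t : R, 0 < t -> t <= 1 -> x <= t * M) ->
  x <= 0.
Proof.
move=> M0 h; rewrite leNgt; apply/negP => x0.
pose t := Num.min 1 (x / (2 * (M + 1))).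
have M1 : 0 < 2 * (M + 1) by rewrite mulr_gt0// ltr_wpDl.
have t0 : 0 < t by rewrite lt_min ltr01 divr_gt0.
have := h t t0; rewrite ge_min lexx => /(_ isT).
have : t * (2 * (M + 1)) <= x by rewrite -ler_pdivlMr// ge_min lexx orbT.
have : 0 <= t * M by rewrite mulr_ge0// ltW.
by move: t0 x0; lra.
Qed.

(** Without the quotient, the self-map condition can be followed up to a boundary point where the
    denominator vanishes. *)
Lemma lf_selfmap_bound A B c0 d z : lf_selfmap A B c0 d -> inball z ->
  vnorm (vadd (mul_mxv A z) B) <= cabs (inner z c0 + d).
Proof.
move=> [h1 h2] zb; have := h2 z zb; have := h1 z zb.
rewrite /inball lfmapE vnorm_scl cabsV => d0.
have dp : 0 < cabs (inner z c0 + d) by rewrite lt_neqAle cabs_ge0 eq_sym cabs_eq0 d0.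
by rewrite ltr_pdivrMl// mulr1 => /ltW.
Qed.

(** Radial approach shows that the numerator vanishes at [zeta] too. Along a curve tangent to the
    sphere with velocity [u] orthogonal to [zeta], the denominator is O(t^2) while the numerator is
    t A u + O(t^2), so A u = 0. Hence the numerator is a constant vector times the denominator. *)
Lemma lf_const_of_pole A B c0 d zeta : lf_selfmap A B c0 d -> vnorm zeta = 1 ->
  inner zeta c0 + d = 0 -> (forall z, inner z c0 = - d * inner z zeta) ->
  exists b, forall z, inball z -> lfmap A B c0 d z = b.
Proof.
move=> hs z1 pole c0E.
have [a1 a2 _] := linear_mul_mxv A.
pose P := vadd (mul_mxv A zeta) B.
have P0 : P = fun=> 0.
  apply: vnorm_eq0P; apply/eqP; rewrite eq_le vnorm_ge0 andbT.
  apply: (@ge0_small_le0 _ (cabs d + vnorm (mul_mxv A zeta))).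
    by rewrite addr_ge0// ?cabs_ge0 ?vnorm_ge0.
  move=> t t0 t1.
  pose z := vscl (rC (1 - t)) zeta.
  have zb : inball z.
    by rewrite /inball vnorm_scl cabs_rC z1 mulr1 ger0_norm ?subr_ge0//; lra.
  have := lf_selfmap_bound hs zb.
  have -> : inner z c0 + d = rC t * d.
    rewrite /z inner_scll c0E inner_self z1 expr1n rCB [rC 1](_ : _ = 1)//; ring.
  rewrite cabsM cabs_rC gtr0_norm//.
  have -> : vadd (mul_mxv A z) B = vsub P (vscl (rC t) (mul_mxv A zeta)).
    rewrite /z a2; apply/funext => j; rewrite /P /vsub /vadd /vscl rCB [rC 1](_ : _ = 1)//; ring.
  move=> h; have := vnormD (vsub P (vscl (rC t) (mul_mxv A zeta))) (vscl (rC t) (mul_mxv A zeta)).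
  rewrite (_ : vadd _ _ = P); last by apply/funext => j; rewrite /vadd /vsub subrK.
  by rewrite vnorm_scl cabs_rC gtr0_norm//; move: h; lra.
have A0 u : inner u zeta = 0 -> mul_mxv A u = fun=> 0.
  move=> u0; apply: vnorm_eq0P; apply/eqP; rewrite eq_le vnorm_ge0 andbT.
  pose K := vnorm u ^+ 2 + 1; have K1 : 1 <= K by rewrite lerDr sqr_ge0.
  have K0 : 0 < K by lra.
  apply: (@ge0_small_le0 _ (cabs d + vnorm (mul_mxv A zeta))).
    by rewrite addr_ge0// ?cabs_ge0 ?vnorm_ge0.
  move=> t' t'0 t'1.
  (* Dividing the bound by [t] leaves the factor K t, which is [t']. *)
  pose t := t' / K; have t0 : 0 < t by exact: divr_gt0.
  have tK : K * t = t' by rewrite /t mulrC divfK// gt_eqF.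
  have Kt1 : K * t ^+ 2 <= 1.
    rewrite expr2 mulrA tK /t mulrA ler_pdivrMr// mul1r.
    by apply: le_trans K1; apply: mulr_ile1 => //; exact: ltW.
  pose z := horo zeta u K t.
  have zb : inball z.
    have := horo_gap_ge z1 (_ : cre (inner u zeta) = 0) Kt1; rewrite u0 => /(_ erefl) h.
    rewrite /inball -(@ltr_pXn2r _ 2) ?nnegrE ?vnorm_ge0// expr1n -subr_gt0.
    by apply: lt_le_trans h; rewrite exprn_gt0.
  have := lf_selfmap_bound hs zb.
  have -> : inner z c0 + d = rC (K * t ^+ 2) * d.
    rewrite /z /horo inner_addl !inner_scll !c0E u0 inner_self z1 expr1n rCB [rC 1](_ : _ = 1)//; ring.
  rewrite cabsM cabs_rC ger0_norm; last by rewrite mulr_ge0 ?sqr_ge0// ltW.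
  have -> : vadd (mul_mxv A z) B =
      vsub (vscl (rC t) (mul_mxv A u)) (vscl (rC (K * t ^+ 2)) (mul_mxv A zeta)).
    rewrite /z /horo a1 !a2; apply/funext => j.
    have : P j = 0 by rewrite P0.
    rewrite /P /vsub /vadd /vscl rCB [rC 1](_ : _ = 1)// => /eqP; rewrite addrC addr_eq0 => /eqP ->; ring.
  set p := vscl (rC t) _; set q := vscl (rC (K * _)) _ => h.
  have := vnormD (vsub p q) q.
  rewrite (_ : vadd _ _ = p); last by apply/funext => j; rewrite /vadd /vsub subrK.
  rewrite /p /q !vnorm_scl !cabs_rC gtr0_norm// ger0_norm; last by rewrite mulr_ge0 ?sqr_ge0// ltW.
  move=> h'; rewrite -tK -(ler_pM2l t0).
  by move: h h'; rewrite /p /q; lra.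
(* With al = <z, zeta> and B = - A zeta, the numerator is (al - 1) A zeta and the denominator (1 -
   al) d. *)
exists (vscl (- d^-1) (mul_mxv A zeta)) => z zb.
set al := inner z zeta.
have den : inner z c0 + d = (1 - al) * d by rewrite c0E -/al; ring.
have := hs.1 z zb; rewrite den mulf_eq0 negb_or => /andP[al0 d0].
pose u := vsub z (vscl al zeta).
have u0 : inner u zeta = 0.
  by rewrite /u inner_subl inner_scll inner_self z1 expr1n [rC 1](_ : _ = 1)// mulr1 subrr.
have zE : z = vadd u (vscl al zeta) by apply/funext => j; rewrite /vadd /u /vsub subrK.
rewrite lfmapE den [in LHS]zE a1 a2 A0//; apply/funext => j.
have : P j = 0 by rewrite P0.
rewrite /P /vadd /vscl add0r => /eqP; rewrite addrC addr_eq0 => /eqP ->.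
by field; rewrite d0 al0.
Qed.

Lemma inball0 : inball (fun=> 0 : C) (N := N).
Proof. by rewrite /inball /vnorm big1 ?sqrtr0// => j _; rewrite cabs0 expr0n. Qed.

(** The zero set of the denominator is a hyperplane. It cannot enter the open ball; it either misses
    the closed ball or touches the sphere, which is the constant case. *)
Lemma lf_cases A B c0 d : lf_selfmap A B c0 d ->
  (exists b, forall z, inball z -> lfmap A B c0 d z = b) \/
  (forall z : V, vnorm z <= 1 -> inner z c0 + d != 0).
Proof.
move=> hs.
have in0 : inner (fun=> 0) c0 = 0 by rewrite /inner big1// => j _; rewrite mul0r.
have d0 : d != 0 by have := hs.1 _ inball0; rewrite in0 add0r.
have cd0 : 0 < cabs d by rewrite lt_neqAle cabs_ge0 eq_sym cabs_eq0 d0.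
have [lt|ge] := ltP (vnorm c0) (cabs d).
  right => z z1; apply/eqP => /eqP; rewrite addr_eq0 => /eqP h.
  have := cauchy_schwarz z c0; rewrite h cabsN; apply/negP; rewrite -ltNge.
  by apply: le_lt_trans lt; rewrite ler_piMl ?vnorm_ge0.
have c00 : 0 < vnorm c0 by exact: lt_le_trans ge.
(* The point of the polar hyperplane nearest to the origin. *)
pose zeta := vscl (- d * rC (vnorm c0 ^+ 2)^-1) c0.
have rc0 : rC (vnorm c0 ^+ 2) != 0 by rewrite -cabs_eq0 cabs_rC normr_eq0 expf_neq0// gt_eqF.
have pole : inner zeta c0 + d = 0.
  by rewrite /zeta inner_scll inner_self rCV mulfVK// addNr.
have zn : vnorm zeta = cabs d / vnorm c0.
  rewrite /zeta vnorm_scl cabsM cabsN cabs_rC ger0_norm ?invr_ge0 ?sqr_ge0//.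
  by field; rewrite gt_eqF.
have cd : vnorm c0 = cabs d.
  apply/eqP; rewrite eq_le ge andbT leNgt; apply/negP => lt.
  have := hs.1 zeta; rewrite /inball zn ltr_pdivrMr// mul1r => /(_ lt).
  by rewrite pole eqxx.
left; apply: (lf_const_of_pole hs _ pole) => [|z].
  by rewrite zn cd divff// gt_eqF.
rewrite /zeta inner_sclr cconjM cconjN cconj_rC cd mulrA.
have dd : rC (cabs d ^+ 2)^-1 * (d * cconj d) = 1.
  by rewrite mulC_conj -rCM mulVf ?expf_neq0 ?gt_eqF.
transitivity (rC (cabs d ^+ 2)^-1 * (d * cconj d) * inner z c0); last by ring.
by rewrite dd mul1r.
Qed.

Definition vec_of_row (x : 'rV[R]_(N + N)) : V :=
  fun j => Complex (x ord0 (lshift N j)) (x ord0 (rshift N j)).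

Lemma vec_of_row_surj z : exists x, vec_of_row x = z.
Proof.
exists (row_mx (\row_j cre (z j)) (\row_j cim (z j))); apply/funext => j.
by rewrite /vec_of_row row_mxEl row_mxEr !mxE; case: (z j).
Qed.

Lemma near_vec_of_row (x : 'rV[R]_(N + N)) (d : R) : 0 < d ->
  \forall y \near x, vnorm (vsub (vec_of_row y) (vec_of_row x)) < d.
Proof.
move=> d0; pose r := d / (2 * N%:R).
have r0 : 0 < r by rewrite divr_gt0// mulr_gt0.
apply/nbhs_ballP; exists r => //= y [_ hy].
apply: le_lt_trans (vnorm_le_sum _) _.
have -> : d = \sum_(j < N) (r + r).
  rewrite sumr_const card_ord -mulr_natr /r; move: (ltr0Sn R n).
  by move: (N%:R : R) => M M0; field; rewrite gt_eqF.
apply: ltr_sum => [|j _]; first by apply/hasP; exists ord0; rewrite // mem_index_enum.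
apply: le_lt_trans (cabs_le_reim _) _; apply: ltrD.
  by rewrite distrC; exact: hy.
by rewrite distrC; exact: hy.
Qed.

Lemma vnorm_dist z w : `|vnorm z - vnorm w| <= vnorm (vsub z w).
Proof.
have h1 := vnormD (vsub z w) w; have h2 := vnormD (vsub w z) z.
have e1 : vadd (vsub z w) w = z by apply/funext => j; rewrite /vadd /vsub subrK.
have e2 : vadd (vsub w z) z = w by apply/funext => j; rewrite /vadd /vsub subrK.
rewrite e1 in h1; rewrite e2 vnorm_subC in h2.
by rewrite ler_norml; apply/andP; split; move: h1 h2; lra.
Qed.

Lemma lf_max A B c0 d : (forall z : V, vnorm z <= 1 -> inner z c0 + d != 0) ->
  exists2 zeta : V, vnorm zeta <= 1 &
    forall z, vnorm z <= 1 -> vnorm (lfmap A B c0 d z) <= vnorm (lfmap A B c0 d zeta).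
Proof.
move=> hden.
pose S : set 'rV[R]_(N + N) := [set x | vnorm (vec_of_row x) <= 1].
pose f x := vnorm (lfmap A B c0 d (vec_of_row x)).
have cn : continuous (fun x => vnorm (vec_of_row x)).
  move=> x; apply/(cvgrPdist_lt (FF := nbhs_filter x)) => e e0.
  apply: filterS (near_vec_of_row x e0) => y hy.
  by rewrite distrC; exact: le_lt_trans (vnorm_dist _ _) hy.
have cS : compact S.
  have S1 : S = [set v : 'rV[R]_(N + N) | forall i, `[-1, 1]%classic (v ord0 i)] `&` S.
    apply/esym/setIidPr => x hx i /=; rewrite in_itv /= -ler_norml.
    case: (split_ordP i) => j ->.
      by apply: le_trans (le_trans (cabs_le_vnorm _ j) hx); exact: (cre_le_cabs (vec_of_row x j)).
    by apply: le_trans (le_trans (cabs_le_vnorm _ j) hx); exact: (cim_le_cabs (vec_of_row x j)).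
  rewrite S1; apply: compact_closedI.
    by apply: (@rV_compact R^o _ (fun=> `[-1, 1]%classic : set R)) => i; exact: segment_compact.
  rewrite (_ : S = (fun x => vnorm (vec_of_row x)) @^-1` [set t | t <= 1])//.
  by apply: closed_comp => [x _|]; [exact: cn|exact: closed_le].
have S0 : S !=set0.
  have [x hx] := vec_of_row_surj (fun=> 0).
  by exists x; rewrite /S /= hx ltW//; exact: inball0.
have cf : {within S, continuous f}.
  apply: continuous_in_subspaceT => x; rewrite inE => hx.
  apply/(cvgrPdist_lt (FF := nbhs_filter x)) => e e0.
  have [del del0 hdel] := lf_continuous A B (hden _ hx) e0.
  apply: filterS (near_vec_of_row x del0) => y hy.
  by rewrite distrC; apply: le_lt_trans (vnorm_dist _ _) _; exact: hdel.
have [x xS hmax] := compact_EVT_max S0 cS cf.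
exists (vec_of_row x); first by move: xS; rewrite inE.
move=> z z1; have [y hy] := vec_of_row_surj z.
by rewrite -hy; apply: hmax; rewrite inE /S /= hy.
Qed.

Lemma lf_jet_interior A B c0 d (zeta : V) : lf_selfmap A B c0 d ->
  inner zeta c0 + d != 0 ->
  exists D c, lf_jet (lfmap A B c0 d) zeta (lfmap A B c0 d zeta) D c.
Proof.
move=> hs e0; have [D [c [hD hc hden hphi]]] := lf_expansion A B e0.
exists D, c; split => // h hb.
have := hs.1 _ hb; rewrite hden mulf_eq0 negb_or => /andP[_ c1].
by split => //; exact: hphi.
Qed.

Lemma lf_jet_const (phi : V -> V) b (zeta : V) : (forall z, inball z -> phi z = b) ->
  lf_jet phi zeta b (fun=> fun=> 0) (fun=> 0).
Proof.
move=> hb; split.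
- split=> [u w|a u|]; [| |exists 0 => // u].
  + by apply/funext => j; rewrite /vadd addr0.
  + by apply/funext => j; rewrite /vscl mulr0.
  + by rewrite mul0r /vnorm big1 ?sqrtr0// => j _; rewrite cabs0 expr0n.
- split=> [u w|a u|]; [by rewrite addr0|by rewrite mulr0|].
  by exists 0 => // u; rewrite cabs0 mul0r.
- move=> h hh; rewrite addr0 oner_eq0; split => //; rewrite hb//.
  by apply/funext => j; rewrite /vadd /vscl mulr0 addr0.
Qed.

(** [eta] is existential because for a constant map [lfmap] may divide by 0 at [zeta]; the jet then
    uses the constant value. *)
Lemma lf_selfmap_jet A B c0 d (zeta : V) : lf_selfmap A B c0 d -> vnorm zeta = 1 ->
  exists eta D c, lf_jet (lfmap A B c0 d) zeta eta D c.
Proof.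
move=> hs z1; have [[b hb]|hden] := lf_cases hs.
  by exists b, (fun=> fun=> 0), (fun=> 0); exact: lf_jet_const.
have e0 : inner zeta c0 + d != 0 by apply: hden; rewrite z1.
have [D [c hj]] := lf_jet_interior hs e0.
by exists (lfmap A B c0 d zeta), D, c.
Qed.

(** [eta] is the radial limit of [phi] at [zeta]. *)
Lemma lf_jet_value_le1 (phi : V -> V) (zeta : V) eta D c :
  (forall z, inball z -> inball (phi z)) ->
  vnorm zeta = 1 -> lf_jet phi zeta eta D c -> vnorm eta <= 1.
Proof.
move=> hb z1 [[_ d2 [M M0 DM]] [_ c2 [L L0 cL]] hj].
rewrite -subr_le0; apply: (@ge0_small_le0 _ (2 * M * (2 * L + 1))).
  by rewrite !mulr_ge0// addr_ge0// mulr_ge0.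
move=> t t0 t1.
have q0 : 0 < 2 * L + 1 by rewrite ltr_pwDr// mulr_ge0.
pose s := t / (2 * L + 1).
have s0 : 0 < s by exact: divr_gt0.
have sq : s * (2 * L + 1) = t by rewrite /s divfK// gt_eqF.
have sL : s * L <= 2^-1.
  by move: sq s0 t1; set x := s * L; rewrite (_ : s * (2 * L + 1) = 2 * x + s); [lra|rewrite /x; ring].
have s1 : s <= 1.
  have : 0 <= s * L by rewrite mulr_ge0// ltW.
  by move: sq t1; rewrite (_ : s * (2 * L + 1) = 2 * (s * L) + s); [lra|ring].
pose h := vscl (- rC s) zeta.
have hbal : inball (vadd zeta h).
  rewrite (_ : vadd zeta h = vscl (rC (1 - s)) zeta).
    by rewrite /inball vnorm_scl cabs_rC z1 mulr1 ger0_norm ?subr_ge0//; lra.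
  by apply/funext => j; rewrite /vadd /h /vscl rCB [rC 1](_ : _ = 1)//; ring.
have [cn hE] := hj h hbal; have := hb _ hbal; rewrite hE /inball => hlt.
have hn : vnorm h = s by rewrite vnorm_scl cabsN cabs_rC z1 mulr1 gtr0_norm.
have ch : cabs (c h) <= 2^-1 by apply: le_trans (cL h) _; rewrite hn mulrC.
have c1 : 2^-1 <= cabs (1 + c h).
  have := cabsB (1 + c h) (c h); rewrite addrK cabs1; lra.
have c10 : 0 < cabs (1 + c h) by apply: lt_le_trans c1; rewrite invr_gt0.
have small : vnorm (vscl (1 + c h)^-1 (D h)) <= 2 * (M * s).
  rewrite vnorm_scl cabsV; apply: ler_pM; rewrite ?invr_ge0 ?cabs_ge0 ?vnorm_ge0//.
    by rewrite -[leRHS]invrK lef_pV2 ?posrE.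
  by rewrite -hn.
have := vnormB (vadd eta (vscl (1 + c h)^-1 (D h))) (vscl (1 + c h)^-1 (D h)).
rewrite (_ : vsub _ _ = eta); last by apply/funext => j; rewrite /vsub /vadd addrK.
have : 2 * (M * s) <= t * (2 * M * (2 * L + 1)).
  have st : s <= t by rewrite -sq; have : 0 <= s * L by [rewrite mulr_ge0// ltW]; lra.
  have : M * s <= M * t by exact: ler_wpM2l.
  have : 0 <= t * M * L by rewrite !mulr_ge0// ltW.
  by lra.
by move: small hlt; lra.
Qed.

Lemma lf_boundary_point A B c0 d : lf_selfmap A B c0 d ->
  (supnorm (lfmap A B c0 d) < 1%:E)%E \/
  exists (zeta : V) eta D c, [/\ vnorm zeta = 1, vnorm eta = 1 &
    lf_jet (lfmap A B c0 d) zeta eta D c].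
Proof.
move=> hs.
have sup_lt (r : R) : r < 1 -> (forall z, inball z -> vnorm (lfmap A B c0 d z) <= r) ->
    (supnorm (lfmap A B c0 d) < 1%:E)%E.
  move=> r1 hr; apply: (@le_lt_trans _ _ r%:E); last by rewrite lte_fin.
  by apply: ge_ereal_sup => _ [z zb <-]; rewrite lee_fin hr.
have [[b hb]|hden] := lf_cases hs.
  left; apply: (sup_lt (vnorm b)) => [|z zb]; last by rewrite hb.
  by have := hs.2 _ inball0; rewrite hb //; exact: inball0.
have [zeta z1 hmax] := lf_max A B hden.
have [lt|ge] := ltP (vnorm (lfmap A B c0 d zeta)) 1.
  by left; apply: (sup_lt _ lt) => z zb; apply: hmax; exact: ltW.
right.
have zeta1 : vnorm zeta = 1.
  apply/eqP; rewrite eq_le z1 leNgt; apply/negP => zb.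
  by have := hs.2 _ zb; rewrite /inball; apply/negP; rewrite -leNgt.
have [D [c hj]] := lf_jet_interior hs (hden _ z1).
exists zeta, (lfmap A B c0 d zeta), D, c; split => //.
apply/eqP; rewrite eq_le ge andbT.
exact: (lf_jet_value_le1 hs.2 zeta1 hj).
Qed.

End LinearFractional.

(** * Limits of complex sequences *)

Section ComplexLimits.
Variable R : realType.
Local Notation C := R[i].
Implicit Types (u v : nat -> C) (l m : C) (r : nat -> R).

Definition tends0 r := forall e : R, 0 < e -> exists K, forall k, (K <= k)%N -> `|r k| < e.

Definition ctends u l := forall e : R, 0 < e ->
  exists K, forall k, (K <= k)%N -> cabs (u k - l) < e.

Lemma tends0_le r r' : (forall k, `|r k| <= r' k) -> tends0 r' -> tends0 r.
Proof.
move=> h hr e /hr[K hK]; exists K => k /hK; apply: le_lt_trans.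
by apply: le_trans (h k) (ler_norm _).
Qed.

Lemma tends0D r r' : tends0 r -> tends0 r' -> tends0 (fun k => r k + r' k).
Proof.
move=> h h' e e0; have e2 : 0 < e / 2 by exact: divr_gt0.
have [K hK] := h _ e2; have [K' hK'] := h' _ e2.
exists (maxn K K') => k; rewrite geq_max => /andP[/hK a /hK' b].
by apply: le_lt_trans (ler_normD _ _) _; lra.
Qed.

Lemma tends0Z (M : R) r : tends0 r -> tends0 (fun k => M * r k).
Proof.
move=> h e e0; have M0 : 0 < `|M| + 1 by rewrite ltr_wpDl.
have [K hK] := h (e / (`|M| + 1)) (divr_gt0 e0 M0).
exists K => k /hK; rewrite ltr_pdivlMr// normrM => a.
by have := normr_ge0 (r k); lra.
Qed.

Lemma tends0_sqr r : tends0 (fun k => r k ^+ 2) -> tends0 r.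
Proof.
move=> h e e0; have [K hK] := h (e ^+ 2) (exprn_gt0 _ e0).
exists K => k /hK.
by rewrite normrX ltr_pXn2r// nnegrE ltW.
Qed.

Lemma ctendsP u l : ctends u l <-> tends0 (fun k => cabs (u k - l)).
Proof.
by split=> h e /h[K hK]; exists K => k /hK; rewrite ger0_norm ?cabs_ge0.
Qed.

Lemma ctends_le u l r : (forall k, cabs (u k - l) <= r k) -> tends0 r -> ctends u l.
Proof.
move=> h hr; apply/ctendsP; apply: tends0_le hr => k.
by rewrite ger0_norm ?cabs_ge0.
Qed.

Lemma eq_ctends u v l : u =1 v -> ctends u l -> ctends v l.
Proof. by move=> /funext ->. Qed.

Lemma ctends_cst l : ctends (fun=> l) l.
Proof. by move=> e e0; exists 0%N => k _; rewrite subrr cabs0. Qed.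

Lemma ctends_rC r : tends0 r -> ctends (fun k => rC (r k)) 0.
Proof. by move=> h e /h[K hK]; exists K => k /hK; rewrite subr0 cabs_rC. Qed.

Lemma ctendsD u v l m : ctends u l -> ctends v m -> ctends (fun k => u k + v k) (l + m).
Proof.
move=> /ctendsP hu /ctendsP hv; apply: ctends_le (tends0D hu hv) => k.
by rewrite opprD addrACA; exact: cabsD.
Qed.

Lemma ctendsN u l : ctends u l -> ctends (fun k => - u k) (- l).
Proof.
by move=> /ctendsP hu; apply: ctends_le hu => k; rewrite -opprD cabsN.
Qed.

Lemma ctendsB u v l m : ctends u l -> ctends v m -> ctends (fun k => u k - v k) (l - m).
Proof. by move=> hu /ctendsN; exact: ctendsD. Qed.

Lemma ctendsM u v l m : ctends u l -> ctends v m -> ctends (fun k => u k * v k) (l * m).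
Proof.
move=> hu hv e e0.
have L0 : 0 < cabs l + 1 by rewrite ltr_wpDl// cabs_ge0.
have M0 : 0 < cabs m + 1 by rewrite ltr_wpDl// cabs_ge0.
have [K1 h1] := hu _ ltr01.
have [K2 h2] := hv (e / 2 / (cabs l + 1)) (divr_gt0 (divr_gt0 e0 (ltr0Sn _ _)) L0).
have [K3 h3] := hu (e / 2 / (cabs m + 1)) (divr_gt0 (divr_gt0 e0 (ltr0Sn _ _)) M0).
exists (maxn K1 (maxn K2 K3)) => k; rewrite !geq_max => /and3P[/h1 a1 /h2 a2 /h3 a3].
have -> : u k * v k - l * m = u k * (v k - m) + (u k - l) * m by ring.
apply: le_lt_trans (cabsD _ _) _; rewrite !cabsM.
have b1 : cabs (u k) <= cabs l + 1.
  by have := cabsD (u k - l) l; rewrite subrK; move: a1; lra.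
move: a2 a3; rewrite !ltr_pdivlMr// => a2 a3.
have c1 : cabs (u k) * cabs (v k - m) <= (cabs l + 1) * cabs (v k - m).
  by apply: ler_wpM2r => //; exact: cabs_ge0.
have := cabs_ge0 (u k - l).
by move: a2 a3 c1; lra.
Qed.

Lemma ctendsX u l k : ctends u l -> ctends (fun i => u i ^+ k) (l ^+ k).
Proof.
move=> hu; elim: k => [|k IH]; first exact: ctends_cst.
rewrite (_ : (fun i => _) = fun i => u i * u i ^+ k); last first.
  by apply/funext => i; rewrite exprS.
by rewrite exprS; exact: ctendsM.
Qed.

Lemma ctendsV u l : l != 0 -> ctends u l -> ctends (fun k => (u k)^-1) l^-1.
Proof.
move=> l0 hu e e0; have cl0 : 0 < cabs l by rewrite lt_neqAle cabs_ge0 eq_sym cabs_eq0 l0.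
have [K1 h1] := hu (cabs l / 2) (divr_gt0 cl0 (ltr0Sn _ _)).
have [K2 h2] := hu (e * (cabs l ^+ 2 / 2)) (mulr_gt0 e0 (divr_gt0 (exprn_gt0 _ cl0) (ltr0Sn _ _))).
exists (maxn K1 K2) => k; rewrite geq_max => /andP[/h1 a1 /h2 a2].
have uk : cabs l / 2 <= cabs (u k).
  by have := cabsB (u k) (u k - l); rewrite opprB addrC subrK; move: a1; lra.
have uk0 : 0 < cabs (u k) by apply: lt_le_trans uk; exact: divr_gt0.
have u0 : u k != 0 by rewrite -cabs_eq0 gt_eqF.
have -> : (u k)^-1 - l^-1 = - (u k - l) * (u k * l)^-1 by field; rewrite u0 l0.
rewrite cabsM cabsN cabsV cabsM ltr_pdivrMr ?mulr_gt0//.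
apply: lt_le_trans a2 _; apply: ler_wpM2l; first exact: ltW.
by rewrite expr2 mulrAC; apply: ler_wpM2r => //; exact: ltW.
Qed.

Lemma ctends_unique u l m : ctends u l -> ctends u m -> l = m.
Proof.
move=> hl hm; apply/eqP; rewrite -subr_eq0 -cabs_eq0; apply/negP => h.
have e0 : 0 < cabs (l - m) / 2 by rewrite divr_gt0// lt_neqAle cabs_ge0 eq_sym andbT; exact/negP.
have [K hK] := hl _ e0; have [K' hK'] := hm _ e0.
have a := hK _ (leq_maxl K K'); have b := hK' _ (leq_maxr K K').
have := cabsB (u (maxn K K') - m) (u (maxn K K') - l).
rewrite (_ : _ - _ - _ = l - m); last by ring.
by move: a b; lra.
Qed.

Lemma ctends_ge u l (b : R) : (forall k, b <= cabs (u k)) -> ctends u l -> b <= cabs l.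
Proof.
move=> hb hu; rewrite leNgt; apply/negP => lt.
have e0 : 0 < b - cabs l by rewrite subr_gt0.
have [K hK] := hu _ e0.
have := hK K (leqnn K); have := cabsD (u K - l) l; rewrite subrK.
by have := hb K; lra.
Qed.

Lemma ctends_cre_le0 u l : (forall k, cre (u k) <= 0) -> ctends u l -> cre l <= 0.
Proof.
move=> hb hu; rewrite leNgt; apply/negP => lt.
have [K hK] := hu _ lt; have := hK K (leqnn K).
have := cre_le_cabs (u K - l); rewrite creD creN ler_norml => /andP[a _].
by have := hb K; move: a; lra.
Qed.

End ComplexLimits.

(** * Rescaled expansions along the source and target curves *)

Section BoundaryApproach.
Variables (R : realType) (n : nat).
Local Notation N := n.+1.
Local Notation C := R[i].
Local Notation V := ('I_N -> C).
Implicit Types (z w u p zeta eta : V) (D : V -> V) (c : V -> C).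

Definition vtends (h : nat -> V) u := tends0 (fun k => vnorm (vsub (h k) u)).

Lemma linear_form_sub c u w : linear_form c -> c (vsub u w) = c u - c w.
Proof.
move=> [c1 c2 _]; rewrite (_ : vsub u w = vadd u (vscl (-1) w)) ?c1 ?c2 ?mulN1r//.
by apply/funext => j; rewrite /vsub /vadd /vscl mulN1r.
Qed.

Lemma ctends_linear_form c h u : linear_form c -> vtends h u ->
  ctends (fun k => c (h k)) (c u).
Proof.
move=> hc hu; have [_ _ [M M0 cM]] := hc.
apply: ctends_le (tends0Z M hu) => k.
by rewrite -linear_form_sub//; exact: cM.
Qed.

Lemma tends0_harmonic (x : R) : 0 < x -> tends0 (fun k => x / k.+1%:R).
Proof.
move=> x0 e e0; exists (Num.truncn (x / e)) => k hk.
rewrite ger0_norm; last by rewrite divr_ge0// ltW.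
rewrite ltr_pdivrMr// mulrC -ltr_pdivrMr//.
have /truncn_itv/andP[_ h] : 0 <= x / e by rewrite divr_ge0// ltW.
by apply: lt_le_trans h _; rewrite ler_nat ltnS.
Qed.

Lemma inner_unit zeta : vnorm zeta = 1 -> inner zeta zeta = 1.
Proof. by move=> z1; rewrite inner_self z1 expr1n. Qed.

Lemma horo_sub zeta u (K t : R) :
  vsub (horo zeta u K t) zeta = vscl (rC t) (vsub u (vscl (rC (K * t)) zeta)).
Proof.
by apply/funext => j; rewrite /vsub /horo /vadd /vscl rCB !rCM [rC 1](_ : _ = 1)//; ring.
Qed.

Section Source.
Variables (zeta u : V) (t eps : nat -> R) (z : nat -> V).
Hypotheses (z1 : vnorm zeta = 1) (hu : cre (inner u zeta) = 0).
Local Notation K := (vnorm u ^+ 2 + 1).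
Hypotheses (t_gt0 : forall k, 0 < t k) (t0 : tends0 t) (tK : forall k, K * t k ^+ 2 <= 2^-1).
Hypotheses (eps_gt0 : forall k, 0 < eps k) (eps0 : tends0 eps).
Hypothesis zbox : forall k, koranyi_box (eps k) (horo zeta u K (t k)) (z k).
Let w k := horo zeta u K (t k).
Let e k := vscl (rC (t k)^-1) (vsub (z k) (w k)).

Definition blowup k := vscl (rC (t k)^-1) (vsub (z k) zeta).

Let rCt k : rC (t k) != 0.
Proof. by rewrite -cabs_eq0 cabs_rC normr_eq0 gt_eqF. Qed.

Lemma horo_gap_le k : gap (w k) <= 2 * K * t k ^+ 2.
Proof.
rewrite horo_gap// mulrC; apply: ler_wpM2r; first exact: sqr_ge0.
have := sqr_ge0 (vnorm u); have : 0 <= K ^+ 2 * t k ^+ 2 by rewrite mulr_ge0// sqr_ge0.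
lra.
Qed.

(** By the second condition of the box, |z - w|^2 / t^2 is at most eps gap / t^2, hence at most 2 K
    eps. *)
Lemma blowup_error : tends0 (fun k => vnorm (e k)).
Proof.
apply: tends0_sqr; apply: tends0_le (tends0Z (2 * K) eps0) => k.
rewrite ger0_norm ?sqr_ge0// /e vnorm_scl cabs_rC gtr0_norm ?invr_gt0// exprMn exprVn.
have [_ h] := andP (zbox k); have := horo_gap_le k; rewrite -/(w k) in h *.
move=> g; rewrite mulrC ler_pdivrMr ?exprn_gt0//.
apply: le_trans h _; rewrite [leRHS](_ : _ = eps k * (2 * K * t k ^+ 2)); last by ring.
by apply: ler_wpM2l => //; exact: ltW.
Qed.

Lemma blowup_subE k : vsub (blowup k) u = vsub (e k) (vscl (rC (K * t k)) zeta).
Proof.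
have h : vsub (z k) zeta = vadd (vsub (z k) (w k)) (vsub (w k) zeta).
  by apply/funext => j; rewrite /vadd /vsub; ring.
rewrite /blowup h horo_sub; apply/funext => j.
rewrite /e /vadd /vsub /vscl rCV; field; exact: rCt.
Qed.

Lemma blowup_tends : vtends blowup u.
Proof.
apply: tends0_le (tends0D blowup_error (tends0Z K t0)) => k.
rewrite ger0_norm ?vnorm_ge0// blowup_subE; apply: le_trans (vnormB _ _) _.
rewrite lerD2l vnorm_scl z1 mulr1 cabs_rC ger0_norm// mulr_ge0 ?(ltW (t_gt0 k))//.
by rewrite addr_ge0// sqr_ge0.
Qed.

(** The first condition of the box bounds the normal error by eps times order t^2, so it survives a
    second division by [t]. The limit is the second-order normal displacement of the curve
    itself. *)
Lemma blowup_normal_tends :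
  ctends (fun k => rC (t k)^-1 * (inner (blowup k) zeta - inner u zeta)) (- rC K).
Proof.
have B := tends0D (tends0Z (2 * (2 * K)) eps0) (tends0Z (2 * vnorm u) blowup_error).
apply: ctends_le B => k; rewrite -inner_subl blowup_subE inner_subl inner_scll inner_unit//.
rewrite mulr1 opprK rCM rCV.
rewrite (_ : _ * _ + _ = (rC (t k))^-1 * inner (e k) zeta); last by field; exact: rCt.
have tk := t_gt0 k.
have q : 2^-1 <= 1 - K * t k ^+ 2 by have := tK k; lra.
(* The box controls the component along [w k] rather than along [zeta]; the exchange costs t <e, u>,
   negligible after division by [t]. *)
have E : rC (1 - K * t k ^+ 2) * inner (e k) zeta =
  (rC (t k))^-1 * inner (vsub (z k) (w k)) (w k) - rC (t k) * inner (e k) u.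
  rewrite {1}/w [in X in _ = _ * X - _]/horo inner_addr !inner_sclr !cconj_rC.
  by rewrite /e !inner_scll rCV; field; exact: rCt.
have /(congr1 (@cabs R)) := E; rewrite cabsM cabs_rC ger0_norm; last by lra.
move=> E'; have := cabsB ((rC (t k))^-1 * inner (vsub (z k) (w k)) (w k)) (rC (t k) * inner (e k) u).
rewrite -E' !cabsM !cabsV !cabs_rC gtr0_norm// => h.
have [h1 _] := andP (zbox k); rewrite -/(w k) in h1.
have h2 := horo_gap_le k.
have h3 := cauchy_schwarz (e k) u.
have h4 : (1 - K * t k ^+ 2) * cabs (inner (e k) zeta) <=
  t k * (2 * K * eps k) + t k * (vnorm (e k) * vnorm u).
  apply: le_trans h _; apply: lerD; last by apply: ler_wpM2l => //; exact: ltW.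
  rewrite mulrC ler_pdivrMr//; apply: le_trans h1 _.
  rewrite [leRHS](_ : _ = eps k * (2 * K * t k ^+ 2)); last by ring.
  by apply: ler_wpM2l => //; exact: ltW.
have h5 : 2^-1 * cabs (inner (e k) zeta) <= (1 - K * t k ^+ 2) * cabs (inner (e k) zeta).
  by apply: ler_wpM2r => //; exact: cabs_ge0.
rewrite mulrC ler_pdivrMr//; move: (le_trans h5 h4).
set A := cabs _; set B := vnorm (e k).
move=> H; rewrite [leRHS](_ : _ = 2 * (t k * (2 * K * eps k) + t k * (B * vnorm u))); last by ring.
by move: H; lra.
Qed.

End Source.
Section Target.
Variables (phi : V -> V) (zeta eta eta0 u p : V) (D : V -> V) (c : V -> C).
Variables (t : nat -> R) (h z : nat -> V) (K : R).
Hypothesis jet : lf_jet phi zeta eta D c.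
Hypotheses (t_gt0 : forall k, 0 < t k) (t0 : tends0 t) (hu : vtends h u).
Hypotheses (zE : forall k, z k = vadd zeta (vscl (rC (t k)) (h k)))
  (zb : forall k, inball (z k)).
Let T k : C := rC (t k).
Let G k : C := (1 + T k * c (h k))^-1.
Let alpha k : C := inner (D (h k)) eta0.
Let delta k : C := inner (D (h k)) p.
Let X k := 1 - inner (phi (z k)) (horo eta0 p K (t k)).

Let T0 : ctends T 0. Proof. exact: ctends_rC. Qed.

Let Tn0 k : T k != 0.
Proof. by rewrite -cabs_eq0 cabs_rC normr_eq0 gt_eqF. Qed.

Let c_lin : linear_form c. Proof. by case: jet. Qed.
Let D_lin : linear_map D. Proof. by case: jet. Qed.

Let gamma_tends : ctends (fun k => c (h k)) (c u).
Proof. exact: ctends_linear_form. Qed.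

Let alpha_tends : ctends alpha (inner (D u) eta0).
Proof.
exact: (ctends_linear_form (linear_form_comp D_lin (linear_form_inner eta0)) hu).
Qed.

Let delta_tends : ctends delta (inner (D u) p).
Proof.
exact: (ctends_linear_form (linear_form_comp D_lin (linear_form_inner p)) hu).
Qed.

Let den k : 1 + T k * c (h k) != 0.
Proof.
have [_ [_ c2 _] hj] := jet; have := zb k; rewrite zE => /hj[].
by rewrite c2.
Qed.

Let G_tends : ctends G 1.
Proof.
rewrite -[1]invr1; apply: ctendsV (oner_neq0 _) _.
have := ctendsD (ctends_cst 1) (ctendsM T0 gamma_tends).
by rewrite mul0r addr0.
Qed.

Let shrink_tends : ctends (fun k => 1 - rC K * T k ^+ 2) (1 - rC K * 0 ^+ 2).
Proof. exact: ctendsB (ctends_cst 1) (ctendsM (ctends_cst (rC K)) (ctendsX 2 T0)). Qed.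

(** An exact identity; the limits at orders t^0, t^1 and t^2 below all come from it. *)
Let XE k : X k = 1 - (1 - rC K * T k ^+ 2) * inner eta eta0 - T k * inner eta p -
  G k * (T k * ((1 - rC K * T k ^+ 2) * alpha k + T k * delta k)).
Proof.
have [[_ d2 _] [_ c2 _] hj] := jet; have := zb k; rewrite /X zE => /hj[_ ->].
rewrite c2 d2 /horo inner_addr !inner_addl !inner_sclr !inner_scll !cconj_rC.
rewrite rCB !rCM [rC 1](_ : _ = 1)// -/(T k) /alpha /delta /G.
by field; exact: den.
Qed.

Lemma target_value_tends : ctends X (1 - inner eta eta0).
Proof.
rewrite (_ : X = fun k => 1 - (1 - rC K * T k ^+ 2) * inner eta eta0 - T k * inner eta p -
  G k * (T k * ((1 - rC K * T k ^+ 2) * alpha k + T k * delta k))); last first.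
  exact/funext.
have -> : 1 - inner eta eta0 = 1 - (1 - rC K * 0 ^+ 2) * inner eta eta0 - 0 * inner eta p -
  1 * (0 * ((1 - rC K * 0 ^+ 2) * inner (D u) eta0 + 0 * inner (D u) p)) by ring.
have h1 := ctendsM shrink_tends (ctends_cst (inner eta eta0)).
have h2 := ctendsM T0 (ctends_cst (inner eta p)).
have h3 := ctendsD (ctendsM shrink_tends alpha_tends) (ctendsM T0 delta_tends).
exact: ctendsB (ctendsB (ctendsB (ctends_cst 1) h1) h2) (ctendsM G_tends (ctendsM T0 h3)).
Qed.

Hypotheses (eta1 : vnorm eta = 1) (eta0E : eta0 = eta).

Lemma target_slope_tends :
  ctends (fun k => X k / T k) (- inner eta p - inner (D u) eta).
Proof.
have e1 := inner_unit eta1.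
rewrite (_ : (fun k => X k / T k) = fun k => rC K * T k - inner eta p -
  G k * ((1 - rC K * T k ^+ 2) * alpha k + T k * delta k)); last first.
  by apply/funext => k; rewrite XE eta0E e1; field; exact: Tn0.
have -> : - inner eta p - inner (D u) eta = rC K * 0 - inner eta p -
  1 * ((1 - rC K * 0 ^+ 2) * inner (D u) eta0 + 0 * inner (D u) p) by rewrite eta0E; ring.
have h1 := ctendsD (ctendsM shrink_tends alpha_tends) (ctendsM T0 delta_tends).
have h2 := ctendsB (ctendsM (ctends_cst (rC K)) T0) (ctends_cst (inner eta p)).
exact: ctendsB h2 (ctendsM G_tends h1).
Qed.

Variables (lam mu0 : C).
Hypothesis normalD : forall v, inner (D v) eta = lam * inner v zeta.
Hypothesis pE : inner eta p = - (lam * inner u zeta).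
Hypothesis mu_tends : ctends (fun k => (T k)^-1 * (inner (h k) zeta - inner u zeta)) mu0.

(** [pE] cancels the terms of order [t]. By [normalD] the normal part of D (h k) only involves <h,
    zeta>, whose deviation from <u, zeta> is of order [t] with coefficient [mu0]. *)
Lemma target_curvature_tends :
  ctends (fun k => X k / T k ^+ 2)
    (rC K + lam * inner u zeta * c u - lam * mu0 - inner (D u) p).
Proof.
have e1 := inner_unit eta1; set om := inner u zeta.
pose mu k := (T k)^-1 * (inner (h k) zeta - om).
rewrite (_ : (fun k => X k / T k ^+ 2) = fun k => rC K +
  G k * (lam * om * c (h k) + rC K * T k * lam * om - (1 - rC K * T k ^+ 2) * lam * mu k
    - delta k)); last first.
  apply/funext => k; rewrite XE eta0E e1 pE /alpha eta0E normalD /mu /G.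
  by rewrite -/om; field; rewrite Tn0 den.
have -> : rC K + lam * om * c u - lam * mu0 - inner (D u) p = rC K +
  1 * (lam * om * c u + rC K * 0 * lam * om - (1 - rC K * 0 ^+ 2) * lam * mu0
    - inner (D u) p) by ring.
have h1 := ctendsM (ctendsM (ctendsM (ctends_cst (rC K)) T0) (ctends_cst lam)) (ctends_cst om).
have h2 := ctendsM (ctendsM shrink_tends (ctends_cst lam)) mu_tends.
have h3 := ctendsD (ctendsM (ctends_cst (lam * om)) gamma_tends) h1.
exact: ctendsD (ctends_cst (rC K)) (ctendsM G_tends (ctendsB (ctendsB h3 h2) delta_tends)).
Qed.

End Target.
End BoundaryApproach.

(** * Sequences provided by compactness of the difference *)

Section CompactApproach.
Variables (R : realType) (n : nat).
Local Notation N := n.+1.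
Local Notation C := R[i].
Local Notation V := ('I_N -> C).
Implicit Types (z w u p zeta eta : V).
Variables (H : fspace R) (phi psi : V -> V).
Hypotheses (n_gt0 : (0 < n)%N) (admH : admissible H).
Hypotheses (phi_cont : vcontinuous_on_ball phi) (phi_ball : forall z, inball z -> inball (phi z)).
Hypotheses (psi_cont : vcontinuous_on_ball psi) (psi_ball : forall z, inball z -> inball (psi z)).
Hypothesis cpt : compact_op H (fun f z => Cop phi f z - Cop psi f z).

Lemma horo_inball zeta u (t : R) : vnorm zeta = 1 -> cre (inner u zeta) = 0 -> 0 < t ->
  (vnorm u ^+ 2 + 1) * t ^+ 2 <= 2^-1 -> vnorm (horo zeta u (vnorm u ^+ 2 + 1) t) < 1.
Proof.
move=> z1 hu t0 ht; apply: gap_gt0P; apply: (@lt_le_trans _ _ (t ^+ 2)).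
  exact: exprn_gt0.
by apply: horo_gap_ge => //; move: ht; lra.
Qed.

(* Along [t k], kernel functions of exponent [m] at the points of the curve
   through [eta] do not separate [phi (z k)] from [psi (z k)]. *)
Record boundary_approach zeta eta u p (m : nat) (t eps : nat -> R) (z : nat -> V) : Prop :=
  BoundaryApproach {
    ba_t_gt0 : forall k, 0 < t k;
    ba_t_tends : tends0 t;
    ba_source : forall k, (vnorm u ^+ 2 + 1) * t k ^+ 2 <= 2^-1;
    ba_target : forall k, (vnorm p ^+ 2 + 1) * t k ^+ 2 <= 2^-1;
    ba_eps_gt0 : forall k, 0 < eps k;
    ba_eps_tends : tends0 eps;
    ba_inball : forall k, inball (z k);
    ba_box : forall k, koranyi_box (eps k) (horo zeta u (vnorm u ^+ 2 + 1) (t k)) (z k);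
    ba_kernel : ctends (fun k =>
      let a := horo eta p (vnorm p ^+ 2 + 1) (t k) in
      (rC (t k) ^+ 2 / (1 - inner (phi (z k)) a)) ^+ m -
      (rC (t k) ^+ 2 / (1 - inner (psi (z k)) a)) ^+ m) 0 }.

(** Both gaps are at least t^2, so the weight in [compact_difference_small] dominates t^(4m), the
    factor that normalizes both kernels. *)
Lemma boundary_approach_exists zeta eta u p (m : nat) :
  vnorm zeta = 1 -> vnorm eta = 1 -> cre (inner u zeta) = 0 -> cre (inner p eta) = 0 ->
  kernel_exponent n H + 1 < (2 * m)%:R ->
  exists t eps (z : nat -> V), boundary_approach zeta eta u p m t eps z.
Proof.
move=> z1 e1 hu hp hm; set s := kernel_exponent n H in hm.
have s0 : 0 < s by exact: kernel_exponent_gt0.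
pose K := vnorm u ^+ 2 + 1; pose L := vnorm p ^+ 2 + 1.
have K1 : 1 <= K by rewrite lerDr sqr_ge0.
have L1 : 1 <= L by rewrite lerDr sqr_ge0.
have KL0 : 0 < K + L by move: K1 L1; lra.
(* Small enough that [K * tau k ^+ 2] and [L * tau k ^+ 2] are at most 1/8: both curves stay in the
   ball and [gap (w k) <= 2^-1]. *)
pose x := (2 * (K + L))^-1; pose tau (k : nat) := x / k.+1%:R.
have x0 : 0 < x by rewrite invr_gt0 mulr_gt0.
have tau0 k : 0 < tau k by rewrite divr_gt0.
have taux k : tau k <= x by rewrite ler_pdivrMr// ler_peMr ?(ltW x0)// ler1n.
have x4 : x <= 4^-1 by rewrite lef_pV2 ?posrE ?mulr_gt0//; move: K1 L1; lra.
have tau2 k : tau k ^+ 2 <= 4^-1 * x.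
  rewrite expr2; apply: ler_pM; rewrite ?(ltW (tau0 k))//.
  exact: le_trans (taux k) x4.
have Kx (M : R) : 0 <= M -> M <= K + L -> M * x <= 2^-1.
  move=> M0 hM; rewrite /x invfM mulrCA ler_piMr// ler_pdivrMr// mul1r//.
have KtauL (M : R) k : 0 <= M -> M <= K + L -> M * tau k ^+ 2 <= 8^-1.
  move=> M0 hM; have := Kx M M0 hM; have : M * tau k ^+ 2 <= M * (4^-1 * x).
    exact: ler_wpM2l.
  by lra.
have Ktau k : K * tau k ^+ 2 <= 8^-1 by apply: KtauL; move: K1 L1; lra.
have Ltau k : L * tau k ^+ 2 <= 8^-1 by apply: KtauL; move: K1 L1; lra.
have tau_tends : tends0 tau by exact: tends0_harmonic.
pose w k := horo zeta u K (tau k); pose a k := horo eta p L (tau k).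
have a_in k : vnorm (a k) < 1 by apply: horo_inball => //; move: (Ltau k); rewrite /L; lra.
have w_in k : vnorm (w k) < 1 by apply: horo_inball => //; move: (Ktau k); rewrite /K; lra.
have hw k : vnorm (w k) < 1 /\ gap (w k) <= 2^-1.
  split; first exact: w_in.
  by apply: le_trans (horo_gap_le tau z1 hu k) _; move: (Ktau k); rewrite /K; lra.
have ha e : 0 < e -> exists J, forall k, (J <= k)%N -> gap (a k) < e.
  move=> e0; have e2 : 0 < e / (2 * L) by rewrite divr_gt0// mulr_gt0//; move: L1; lra.
  have [J hJ] := tau_tends _ e2; exists J => k /hJ; rewrite gtr0_norm//.
  rewrite ltr_pdivlMr ?mulr_gt0//; last by move: L1; lra.
  move=> h; apply: le_lt_trans (horo_gap_le tau e1 hp k) _; apply: le_lt_trans h.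
  rewrite -/L mulrC expr2 -mulrA; apply: ler_wpM2l; first exact: ltW.
  rewrite ler_piMl//; first by move: L1; lra.
  by move: (taux k) x4; lra.
have small := compact_difference_small n_gt0 admH phi_cont phi_ball psi_cont psi_ball cpt hm
  a_in ha hw.
pose eps (i : nat) : R := 8^-1 / i.+1%:R.
have eps0 i : 0 < eps i by rewrite divr_gt0.
have eps8 i : eps i <= 8^-1 by rewrite ler_pdivrMr// ler_peMr// ler1n.
have /choice[f hf] : forall i, exists kz : nat * V, [/\ (i <= kz.1)%N, inball kz.2,
    koranyi_box (eps i) (w kz.1) kz.2 &
    gap (w kz.1) `^ s * gap (a kz.1) `^ ((2 * m)%:R - s) *
    cabs (((1 - inner (phi kz.2) (a kz.1)) ^+ m)^-1 -
          ((1 - inner (psi kz.2) (a kz.1)) ^+ m)^-1) ^+ 2 < eps i].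
  by move=> i; have [k [z [h1 h2 h3 h4]]] := small _ i (eps0 i) (eps8 i); exists (k, z).
exists (fun i => tau (f i).1), eps, (fun i => (f i).2); split => //.
- move=> e /tau_tends[J hJ]; exists J => k hk; apply: hJ.
  by have [h _ _ _] := hf k; exact: leq_trans h.
- by move=> k; apply: le_trans (Ktau _) _; lra.
- by move=> k; apply: le_trans (Ltau _) _; lra.
- exact: tends0_harmonic.
- by move=> k; have [] := hf k.
- by move=> k; have [] := hf k.
apply/ctendsP; apply: tends0_sqr.
apply: tends0_le (tends0_harmonic (_ : 0 < 8^-1)) => // k.
have [_ _ _ hk] := hf k; rewrite -/(eps k) /= subr0 ger0_norm ?sqr_ge0//.
apply: le_trans (ltW hk); move: (f k).1 (f k).2 => i z {hk}.
rewrite -/L -/(a i); set X := 1 - _; set Y := 1 - inner (psi z) _.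
rewrite !exprMn !exprVn -mulrBr cabsM exprMn.
apply: ler_wpM2r; first exact: sqr_ge0.
have t20 : 0 < tau i ^+ 2 by exact: exprn_gt0.
rewrite cabsM !cabsX cabs_rC gtr0_norm// -expr2 -!exprM.
rewrite (_ : (m * 2 * 2 = 2 * (2 * m))%N); last by rewrite mulnC [(m * 2)%N]mulnC.
rewrite exprM -powR_mulrn ?(ltW t20)//.
(* The power t^(4m) is split along [s] and 2m - s, each part to be compared with its own gap. *)
have -> : (tau i ^+ 2) `^ (2 * m)%:R = (tau i ^+ 2) `^ s * (tau i ^+ 2) `^ ((2 * m)%:R - s).
  by rewrite -powRD ?subrKC//; apply/implyP => _; rewrite gt_eqF.
apply: ler_pM; rewrite ?powR_ge0//; apply: ge0_ler_powR; rewrite ?nnegrE ?(ltW t20)//.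
all: rewrite ?(ltW (gap_gt0 _))// ?(ltW s0)//.
- by apply: horo_gap_ge => //; move: (Ktau i); rewrite /K; lra.
- by move: hm; lra.
- by apply: horo_gap_ge => //; move: (Ltau i); rewrite /L; lra.
Qed.

(** |1 - <z, a>| >= 1 - |a| >= (1 - |a|^2) / 2 >= t^2 / 2. In the limit this makes the second-order
    coefficient nonzero, hence invertible. *)
Lemma target_denominator_ge eta p (t : R) z : vnorm eta = 1 -> cre (inner p eta) = 0 ->
  0 < t -> (vnorm p ^+ 2 + 1) * t ^+ 2 <= 2^-1 -> inball z ->
  2^-1 <= cabs ((1 - inner z (horo eta p (vnorm p ^+ 2 + 1) t)) / rC t ^+ 2).
Proof.
move=> e1 hp t0 ht hz; set a := horo _ _ _ _.
have a1 : vnorm a < 1 by exact: horo_inball.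
have ga : t ^+ 2 <= 1 - vnorm a ^+ 2 by apply: horo_gap_ge => //; move: ht; lra.
have := cabsD (1 - inner z a) (inner z a); rewrite subrK cabs1 => h1.
have h2 : cabs (inner z a) <= vnorm a.
  apply: le_trans (cauchy_schwarz z a) _.
  by rewrite ler_piMl ?vnorm_ge0// ltW.
rewrite cabsM cabsV cabsX cabs_rC gtr0_norm// ler_pdivlMr ?exprn_gt0//.
have h3 : vnorm a ^+ 2 = 1 - (1 - vnorm a) * (1 + vnorm a) by ring.
have h4 : (1 - vnorm a) * (1 + vnorm a) <= (1 - vnorm a) * 2.
  by apply: ler_wpM2l; move: a1; lra.
by move: ga h1 h2 h3 h4; lra.
Qed.

End CompactApproach.

(** * Normal derivative where a map touches the sphere *)

Section NormalDerivative.
Variables (R : realType) (n : nat).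
Local Notation N := n.+1.
Local Notation C := R[i].
Local Notation V := ('I_N -> C).
Implicit Types (z w u p zeta eta : V) (D : V -> V) (c : V -> C).

Lemma inner0l w : inner (fun=> 0 : C) w = 0 :> C.
Proof. by rewrite /inner big1// => j _; rewrite mul0r. Qed.

Lemma inner0r w : inner w (fun=> 0 : C) = 0 :> C.
Proof. by rewrite inner_conj inner0l -[0]/(rC 0) cconj_rC. Qed.

Lemma horo0 eta (t : R) : horo eta (fun=> 0) 0 t = eta.
Proof.
apply/funext => j; rewrite /horo /vadd /vscl mul0r subr0 mulr0 addr0.
by rewrite [rC 1](_ : _ = 1)// mul1r.
Qed.

Lemma vadd_decomp zeta u : vnorm zeta = 1 ->
  u = vadd (vscl (inner u zeta) zeta) (vsub u (vscl (inner u zeta) zeta)) /\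
  inner (vsub u (vscl (inner u zeta) zeta)) zeta = 0.
Proof.
move=> z1; split; first by apply/funext => j; rewrite /vadd /vsub addrC subrK.
by rewrite inner_subl inner_scll inner_unit// mulr1 subrr.
Qed.

Variables (phi : V -> V) (zeta eta : V) (D : V -> V) (c : V -> C).
Hypothesis phi_ball : forall z, inball z -> inball (phi z).
Hypotheses (z1 : vnorm zeta = 1) (e1 : vnorm eta = 1) (jet : lf_jet phi zeta eta D c).

(** Re (1 - <phi z, eta>) is nonnegative on the ball, and its first-order coefficient along the
    curve of velocity [u] is - Re <D u, eta>. *)
Lemma jet_inner_cre_le0 u : cre (inner u zeta) = 0 -> cre (inner (D u) eta) <= 0.
Proof.
move=> hu; pose K := vnorm u ^+ 2 + 1.
have K1 : 1 <= K by rewrite lerDr sqr_ge0.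
pose x := (2 * K)^-1; pose t (k : nat) := x / k.+1%:R.
have x0 : 0 < x by rewrite invr_gt0 mulr_gt0//; move: K1; lra.
have t_gt0 k : 0 < t k by rewrite divr_gt0.
have tx k : t k <= x by rewrite ler_pdivrMr// ler_peMr ?(ltW x0)// ler1n.
have x2 : x <= 1.
  by rewrite invf_le1 ?mulr_gt0//; move: K1; lra.
have Kx : K * x = 2^-1 by rewrite /x; field; move: K1; lra.
have Kt k : K * t k ^+ 2 <= 2^-1.
  rewrite -Kx; apply: ler_wpM2l; first by move: K1; lra.
  by rewrite expr2; apply: le_trans (tx k); rewrite ler_piMl ?(ltW (t_gt0 k))//; exact: le_trans x2.
pose h k := vsub u (vscl (rC (K * t k)) zeta).
have t0 : tends0 t by exact: tends0_harmonic.
have hu' : vtends h u.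
  apply: tends0_le (tends0Z K t0) => k; rewrite ger0_norm ?vnorm_ge0//.
  rewrite (_ : vsub _ _ = vscl (- rC (K * t k)) zeta); last first.
    by apply/funext => j; rewrite /h /vsub /vscl; ring.
  rewrite vnorm_scl z1 mulr1 cabsN cabs_rC ger0_norm// mulr_ge0 ?(ltW (t_gt0 k))//.
  by move: K1; lra.
pose z k := vadd zeta (vscl (rC (t k)) (h k)).
have zb k : inball (z k).
  have -> : z k = horo zeta u K (t k).
    apply/funext => j; have := congr1 (fun f => f j) (horo_sub zeta u K (t k)).
    by rewrite {1}/vsub => /(canRL (subrK _)) ->; rewrite /z /vadd addrC.
  exact: horo_inball.
(* With p = 0 and K = 0 the target curve stays at [eta]. *)
have := target_slope_tends (fun=> 0) 0 jet t_gt0 t0 hu' (fun k => erefl (z k)) zb e1 erefl.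
rewrite inner0r oppr0 sub0r => /ctendsN; rewrite opprK; apply: ctends_cre_le0 => k.
rewrite horo0 mulrC -rCV creN cre_rCM oppr_le0 mulr_ge0 ?invr_ge0 ?(ltW (t_gt0 k))//.
rewrite creD creN subr_ge0; apply: le_trans (ler_norm _) _.
apply: le_trans (cre_le_cabs _) _; apply: le_trans (cauchy_schwarz _ _) _.
by rewrite e1 mulr1; apply: ltW; exact: phi_ball.
Qed.

(** The preceding sign condition holds for all complex multiples of vectors orthogonal to [zeta] and
    for imaginary multiples of [zeta]; it forces <D u, eta> to vanish on the former and <D zeta,
    eta> to be real. *)
Lemma jet_normal_derivative :
  exists2 lam : R, lam != 0 & forall u, inner (D u) eta = rC lam * inner u zeta.
Proof.
have [[d1 d2 dM] c_lin hj] := jet.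
(* The scalar conj <D u, eta> turns the inequality into |<D u, eta>|^2 <= 0. *)
have ortho u : inner u zeta = 0 -> inner (D u) eta = 0.
  move=> u0; have := @jet_inner_cre_le0 (vscl (cconj (inner (D u) eta)) u).
  rewrite d2 !inner_scll u0 mulr0 => /(_ erefl).
  rewrite mulrC mulC_conj /= => h; apply/eqP; rewrite -cabs_eq0 -sqrf_eq0.
  by rewrite eq_le h sqr_ge0.
have im0 : cim (inner (D zeta) eta) = 0.
  have hi (b : R) : - (b * cim (inner (D zeta) eta)) <= 0.
    have := @jet_inner_cre_le0 (vscl (Complex 0 b) zeta).
    by rewrite d2 !inner_scll inner_unit// mulr1 => /(_ erefl); rewrite creM /= mul0r sub0r.
  by apply/eqP; rewrite eq_le; have := hi 1; have := hi (-1); lra.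
exists (cre (inner (D zeta) eta)).
  apply/eqP => l0.
  have Dz : inner (D zeta) eta = 0 by exact: eqC.
  have D0 u : inner (D u) eta = 0.
    have [E hu] := vadd_decomp u z1; rewrite {1}E.
    by rewrite d1 d2 inner_addl inner_scll Dz (ortho _ hu) mulr0 addr0.
  (* The jet is exact on the whole ball: at the centre, [lam = 0] would give <phi 0, eta> = 1,
     although phi 0 is interior. *)
  have E : vadd zeta (fun j => - zeta j) = fun=> 0.
    by apply/funext => j; rewrite /vadd subrr.
  have := hj (fun j => - zeta j); rewrite E => /(_ (inball0 _ _))[_].
  move=> /(congr1 (fun v => inner v eta)); rewrite inner_addl inner_scll D0 mulr0 addr0.
  rewrite inner_unit// => h; have := cauchy_schwarz (phi (fun=> 0)) eta.
  rewrite h cabs1 e1 mulr1 leNgt => /negP; apply; apply: phi_ball; exact: inball0.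
move=> u; have [E hu] := vadd_decomp u z1; rewrite {1}E.
rewrite d1 d2 inner_addl inner_scll (ortho _ hu) addr0 mulrC; congr (_ * _).
exact: eqC.
Qed.

End NormalDerivative.

(** * Equality of the two maps from contact at one boundary point *)

Section Rigidity.
Variables (R : realType) (n : nat).
Local Notation N := n.+1.
Local Notation C := R[i].
Local Notation V := ('I_N -> C).
Local Notation I := (Complex 0 1 : C).
Implicit Types (z w u p zeta eta : V) (D : V -> V) (c : V -> C) (lam : R).

Section KernelLimits.
Variables (phi psi : V -> V) (zeta eta u p : V) (m : nat).
Variables (t eps : nat -> R) (z : nat -> V).
Hypothesis ba : boundary_approach phi psi zeta eta u p m t eps z.
Hypotheses (z1 : vnorm zeta = 1) (e1 : vnorm eta = 1).
Hypotheses (hu : cre (inner u zeta) = 0) (hp : cre (inner p eta) = 0).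
Local Notation K := (vnorm u ^+ 2 + 1).
Local Notation L := (vnorm p ^+ 2 + 1).

Variables (chi : V -> V) (chi_ball : forall y, inball y -> inball (chi y)).
Variables (D : V -> V) (c : V -> C).

Let X k := 1 - inner (chi (z k)) (horo eta p L (t k)).
Let T k : C := rC (t k).

Let tn0 k : T k != 0.
Proof. by rewrite -cabs_eq0 cabs_rC normr_eq0 gt_eqF// (ba_t_gt0 ba). Qed.

Let T0 : ctends T 0. Proof. exact: ctends_rC (ba_t_tends ba). Qed.

Let h_tends : vtends (blowup zeta t z) u.
Proof.
exact: blowup_tends (ba_t_gt0 ba) (ba_t_tends ba) (ba_eps_gt0 ba) (ba_eps_tends ba) (ba_box ba).
Qed.

Let zE k : z k = vadd zeta (vscl (T k) (blowup zeta t z k)).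
Proof.
by apply/funext => j; rewrite /vadd /vscl /blowup /vscl /vsub rCV mulVKf ?tn0// addrC subrK.
Qed.

(** Here the denominator has a nonzero limit while the numerator t^2 tends to 0. *)
Lemma kernel_vanish_value eta' : lf_jet chi zeta eta' D c -> inner eta' eta != 1 ->
  (0 < m)%N -> ctends (fun k => (T k ^+ 2 / X k) ^+ m) 0.
Proof.
move=> jet ne m0; have x0 : 1 - inner eta' eta != 0 by rewrite subr_eq0 eq_sym.
have h := target_value_tends eta p L jet (ba_t_tends ba) h_tends zE (ba_inball ba).
have := ctendsX m (ctendsM (ctendsX 2 T0) (ctendsV x0 h)).
by rewrite expr0n mul0r expr0n eqn0Ngt m0.
Qed.

(** Here the denominator is of exact order [t], still dominated by t^2 in the quotient. *)
Lemma kernel_vanish_slope : lf_jet chi zeta eta D c ->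
  - inner eta p - inner (D u) eta != 0 ->
  (0 < m)%N -> ctends (fun k => (T k ^+ 2 / X k) ^+ m) 0.
Proof.
move=> jet ne m0.
have h := target_slope_tends p L jet (ba_t_gt0 ba) (ba_t_tends ba) h_tends zE (ba_inball ba)
  e1 erefl.
have l0 : (0 * (- inner eta p - inner (D u) eta)^-1) ^+ m = 0.
  by rewrite mul0r expr0n eqn0Ngt m0.
rewrite -l0; apply: eq_ctends (ctendsX m (ctendsM T0 (ctendsV ne h))) => k.
by rewrite invf_div expr2 mulrA.
Qed.

Lemma kernel_tends lam : lf_jet chi zeta eta D c ->
  (forall v, inner (D v) eta = rC lam * inner v zeta) ->
  inner eta p = - (rC lam * inner u zeta) ->
  let x := rC L + rC lam * inner u zeta * c u - rC lam * - rC K - inner (D u) p in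
  x != 0 /\ ctends (fun k => (T k ^+ 2 / X k) ^+ m) (x^-1 ^+ m).
Proof.
move=> jet hD pE x.
have hmu := blowup_normal_tends z1 hu (ba_t_gt0 ba) (ba_source ba) (ba_eps_gt0 ba)
  (ba_eps_tends ba) (ba_box ba).
have hmu' : ctends (fun k => (T k)^-1 * (inner (blowup zeta t z k) zeta - inner u zeta)) (- rC K).
  by apply: eq_ctends hmu => k; rewrite rCV.
have h := target_curvature_tends L jet (ba_t_gt0 ba) (ba_t_tends ba) h_tends zE (ba_inball ba)
  e1 erefl hD pE hmu'.
have x0 : x != 0.
  have hX k : 2^-1 <= cabs (X k / T k ^+ 2).
    apply: target_denominator_ge => //; [exact: (ba_t_gt0 ba)|exact: (ba_target ba)|].
    by apply: chi_ball; exact: (ba_inball ba).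
  have := ctends_ge hX h; rewrite -/x => hx; rewrite -cabs_eq0 gt_eqF//.
  by apply: lt_le_trans hx; rewrite invr_gt0.
split; [exact: x0|apply: eq_ctends (ctendsX m (ctendsV x0 h)) => k].
by rewrite invf_div.
Qed.

End KernelLimits.

Lemma unit_vector_eq eta eta' : vnorm eta = 1 -> vnorm eta' <= 1 -> inner eta' eta = 1 ->
  eta' = eta.
Proof.
move=> e1 e'1 h; have : vnorm (vsub eta' eta) ^+ 2 <= 0.
  rewrite vnorm2_sub h e1; have : vnorm eta' ^+ 2 <= 1 by rewrite expr_le1 ?vnorm_ge0.
  by rewrite /=; lra.
move=> h0; have /vnorm0_eq0 h1 : vnorm (vsub eta' eta) = 0.
  by apply/eqP; rewrite -sqrf_eq0 eq_le h0 sqr_ge0.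
by apply/funext => j; apply/eqP; rewrite -subr_eq0; apply/eqP; exact: h1.
Qed.

(** A single [m]-th power determines [x] only up to a root of unity; the quotient of two consecutive
    powers determines it. *)
Lemma eq_of_consecutive_powers (x y : C) (m : nat) : x != 0 -> y != 0 ->
  x ^+ m = y ^+ m -> x ^+ m.+1 = y ^+ m.+1 -> x = y.
Proof.
move=> x0 y0 h; rewrite !exprS -h => h'; apply: (mulIf _ h').
by rewrite expf_neq0.
Qed.

(** The affine hyperplane <u, zeta> = i avoids the origin, so it spans the whole space. *)
Lemma linear_map_eq0 E zeta : linear_map E ->
  (forall u, inner u zeta = I -> E u = fun=> 0) -> vnorm zeta = 1 ->
  forall v, E v = fun=> 0.
Proof.
move=> [l1 l2 _] hE z1 v; set b := I - inner v zeta.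
have iz : inner (vscl I zeta) zeta = I by rewrite inner_scll inner_unit// mulr1.
have i2 : I * I = -1 by apply: eqC; rewrite ?creM ?cimM ?creN ?cimN /=; ring.
have -> : v = vadd (vadd v (vscl b zeta)) (vscl (b * I) (vscl I zeta)).
  apply/funext => j; rewrite /vadd /vscl.
  by rewrite [b * I * _]mulrA -[b * I * I]mulrA i2; ring.
rewrite l1 l2 (hE _ iz) hE; last first.
  by rewrite inner_addl inner_scll inner_unit// mulr1 addrC subrK.
by apply/funext => j; rewrite /vadd /vscl mulr0 addr0.
Qed.

Variables (phi psi : V -> V) (m0 : nat).
Hypotheses (m0_gt0 : (0 < m0)%N).
Hypotheses (phi_ball : forall z, inball z -> inball (phi z)).
Hypotheses (psi_ball : forall z, inball z -> inball (psi z)).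
Hypothesis approach : forall zeta eta u p m,
  vnorm zeta = 1 -> vnorm eta = 1 -> cre (inner u zeta) = 0 -> cre (inner p eta) = 0 ->
  (m0 <= m)%N -> exists t eps (z : nat -> V), boundary_approach phi psi zeta eta u p m t eps z.

Variables (zeta eta eta' : V) (D D' : V -> V) (c c' : V -> C).
Hypotheses (z1 : vnorm zeta = 1) (e1 : vnorm eta = 1).
Hypotheses (jet : lf_jet phi zeta eta D c) (jet' : lf_jet psi zeta eta' D' c').

Lemma kernel_limits_eq u p t eps (z : nat -> V) m (a b : C) :
  boundary_approach phi psi zeta eta u p m t eps z ->
  ctends (fun k => (rC (t k) ^+ 2 / (1 - inner (phi (z k)) (horo eta p (vnorm p ^+ 2 + 1) (t k)))) ^+ m) a ->
  ctends (fun k => (rC (t k) ^+ 2 / (1 - inner (psi (z k)) (horo eta p (vnorm p ^+ 2 + 1) (t k)))) ^+ m) b ->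
  a = b.
Proof.
move=> ba ha hb; apply/eqP; rewrite -subr_eq0; apply/eqP.
exact: ctends_unique (ctendsB ha hb) (ba_kernel ba).
Qed.

Let m0m : (m0 <= m0)%N := leqnn m0.

(** With u = p = 0 the kernels along [phi] have a nonzero limit, whereas a different boundary value
    would make those along [psi] vanish. *)
Lemma boundary_value_eq : eta' = eta.
Proof.
have [lam _ hD] := jet_normal_derivative phi_ball z1 e1 jet.
apply: (unit_vector_eq e1); first exact: (lf_jet_value_le1 psi_ball z1 jet').
apply: contrapT => /eqP ne.
have hz w : cre (inner (fun=> 0 : C) w) = 0 by rewrite inner0l.
have [t [eps [z ba]]] := approach z1 e1 (hz zeta) (hz eta) m0m.
have hQ := kernel_vanish_value ba z1 (hz _) jet' ne m0_gt0.
have pE : inner eta (fun=> 0) = - (rC lam * inner (fun=> 0) zeta).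
  by rewrite inner0l inner0r mulr0 oppr0.
have [x0 hP] := kernel_tends ba z1 e1 (hz _) (hz _) phi_ball jet hD pE.
have /eqP := kernel_limits_eq ba hP hQ.
by rewrite expf_eq0 invr_eq0 (negbTE x0) andbF.
Qed.

Let jet2 : lf_jet psi zeta eta D' c'.
Proof. by rewrite -boundary_value_eq. Qed.

(** Source velocities with <u, zeta> = i are admissible and make the term lam <u, zeta> c(u) visible
    at order t^2. *)
Lemma boundary_jet_eq : (forall v, D v = D' v) /\ (forall v, c v = c' v).
Proof.
have [lam lam0 hD] := jet_normal_derivative phi_ball z1 e1 jet.
have [lam' _ hD'] := jet_normal_derivative psi_ball z1 e1 jet2.
have iz : inner (vscl I zeta) zeta = I by rewrite inner_scll inner_unit// mulr1.
have cI : cconj I = - I by apply: eqC; rewrite ?creN ?cimN /= ?oppr0.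
have ie : inner eta (vscl (I * rC lam) eta) = - (rC lam * I).
  by rewrite inner_sclr inner_unit// mulr1 cconjM cI cconj_rC mulNr mulrC.
have re : cre (inner (vscl (I * rC lam) eta) eta) = 0.
  by rewrite inner_scll inner_unit// mulr1 mulrC cre_rCM /= mulr0.
have n1 : I * I = -1 by apply: eqC; rewrite ?creM ?cimM ?creN ?cimN /=; ring.
have I0 : I != 0 by apply/eqP => h; move: n1; rewrite h mul0r => /eqP; rewrite eq_sym oppr_eq0 oner_eq0.
have rl0 : rC lam != 0 by rewrite -cabs_eq0 cabs_rC normr_eq0.
(* The target velocity i lam eta cancels the slope of [phi]; that of [psi] would be i (lam - lam'),
   and its kernels would vanish. *)
have lamE : lam' = lam.
  apply: contrapT => /eqP ne.
  have hz : cre (inner (vscl I zeta) zeta) = 0 by rewrite iz.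
  have [t [eps [z ba]]] := approach z1 e1 hz re m0m.
  have pE : inner eta (vscl (I * rC lam) eta) = - (rC lam * inner (vscl I zeta) zeta).
    by rewrite ie iz.
  have [x0 hP] := kernel_tends ba z1 e1 hz re phi_ball jet hD pE.
  have ne' : - inner eta (vscl (I * rC lam) eta) - inner (D' (vscl I zeta)) eta != 0.
    rewrite ie opprK hD' iz -mulrBl -rCB mulf_neq0// -cabs_eq0 cabs_rC normr_eq0.
    by rewrite subr_eq0 eq_sym.
  have hQ := kernel_vanish_slope ba z1 e1 hz jet2 ne' m0_gt0.
  have /eqP := kernel_limits_eq ba hP hQ.
  by rewrite expf_eq0 invr_eq0 (negbTE x0) andbF.
rewrite lamE in hD'.
(* Adding [p'] orthogonal to [eta] keeps the slopes cancelled, so it is a free test vector in the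
   comparison at order t^2. *)
have key u p' : inner u zeta = I -> inner p' eta = 0 ->
    rC lam * I * (c u - c' u) = inner (vsub (D u) (D' u)) p'.
  move=> hu hp'; set p := vadd (vscl (I * rC lam) eta) p'.
  have hu0 : cre (inner u zeta) = 0 by rewrite hu.
  have ep' : inner eta p' = 0 by rewrite inner_conj hp' -[0]/(rC 0) cconj_rC.
  have hp : cre (inner p eta) = 0 by rewrite inner_addl hp' addr0.
  have pE : inner eta p = - (rC lam * inner u zeta) by rewrite inner_addr ep' addr0 ie hu.
  have xy m : (m0 <= m)%N -> let x := rC (vnorm p ^+ 2 + 1) + rC lam * inner u zeta * c u -
      rC lam * - rC (vnorm u ^+ 2 + 1) - inner (D u) p in
    let y := rC (vnorm p ^+ 2 + 1) + rC lam * inner u zeta * c' u -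
      rC lam * - rC (vnorm u ^+ 2 + 1) - inner (D' u) p in
    [/\ x != 0, y != 0 & x^-1 ^+ m = y^-1 ^+ m].
    move=> hm x y; have [t [eps [z ba]]] := approach z1 e1 hu0 hp hm.
    have [x0 hP] := kernel_tends ba z1 e1 hu0 hp phi_ball jet hD pE.
    have [y0 hQ] := kernel_tends ba z1 e1 hu0 hp psi_ball jet2 hD' pE.
    by split => //; exact: kernel_limits_eq ba hP hQ.
  have [x0 y0 h0] := xy _ m0m; have [_ _ h1] := xy _ (leqnSn m0).
  have := eq_of_consecutive_powers _ _ h0 h1; rewrite !invr_eq0 => /(_ x0 y0)/invr_inj.
  have Ep : inner (vsub (D u) (D' u)) p = inner (vsub (D u) (D' u)) p'.
    by rewrite inner_addr inner_sclr [in X in _ * X]inner_subl hD hD' subrr mulr0 add0r.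
  rewrite -Ep inner_subl hu => hxy.
  have /eqP := hxy; rewrite -subr_eq0 => /eqP h; apply: subr0_eq; apply: etrans h.
  by ring.
have cE u : inner u zeta = I -> c u = c' u.
  move=> hu; have := key u (fun=> 0) hu (inner0l _); rewrite inner0r.
  by move/eqP; rewrite !mulf_eq0 (negbTE rl0) (negbTE I0)/= subr_eq0 => /eqP.
have E0 u : inner u zeta = I -> vsub (D u) (D' u) = fun=> 0.
  move=> hu; set e := vsub (D u) (D' u).
  have he : inner e eta = 0 by rewrite inner_subl hD hD' subrr.
  (* The difference of the derivatives is orthogonal to [eta], the normal parts being equal, so it
     can be its own test vector. *)
  have := key u e hu he; rewrite cE// subrr mulr0 -/e inner_self.
  move=> /(congr1 (@cre R))/= h; apply: vnorm_eq0P; apply/eqP.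
  by rewrite -sqrf_eq0 -h.
have [Dl cl _] := jet; have [Dl' cl' _] := jet2.
split=> v.
  have h := linear_map_eq0 (linear_map_sub Dl Dl') E0 z1 v.
  apply/funext => j; apply/eqP; rewrite -subr_eq0; apply/eqP.
  by have := congr1 (fun f => f j) h.
have hc : linear_map (fun u => vscl (c u - c' u) zeta).
  apply: (linear_map_form zeta (c := fun u => c u - c' u)).
  have [c1 c2 [M M0 cM]] := cl; have [c1' c2' [M' M0' cM']] := cl'.
  split=> [u w|a u|].
  - by rewrite c1 c1'; ring.
  - by rewrite c2 c2'; ring.
  - exists (M + M') => [|u]; first exact: addr_ge0.
    by rewrite mulrDl; apply: le_trans (cabsB _ _) _; exact: lerD.
have h0 u : inner u zeta = I -> vscl (c u - c' u) zeta = fun=> 0.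
  by move=> hu; rewrite cE// subrr; apply/funext => j; rewrite /vscl mul0r.
have /(congr1 (fun f => inner f zeta)) := linear_map_eq0 hc h0 z1 v.
by rewrite inner_scll inner_unit// mulr1 inner0l => /eqP; rewrite subr_eq0 => /eqP.
Qed.

Lemma boundary_rigidity z : inball z -> phi z = psi z.
Proof.
have [hD hc] := boundary_jet_eq; have [_ _ hj] := jet; have [_ _ hj'] := jet2.
have E : z = vadd zeta (vsub z zeta) by apply/funext => j; rewrite /vadd /vsub addrC subrK.
rewrite {1}E => hz; rewrite E (hj _ hz).2 (hj' _ hz).2 hc.
by congr (vadd _ (vscl _ _)).
Qed.

End Rigidity.

(** * The final dichotomy *)

Lemma lf_selfmap_continuous (R : realType) (n : nat) (A : 'M[R[i]]_n.+1)
    (B c0 : 'I_n.+1 -> R[i]) (d : R[i]) :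
  lf_selfmap A B c0 d -> vcontinuous_on_ball (lfmap A B c0 d).
Proof.
move=> hs z hz e e0; have [del del0 h] := lf_continuous A B (hs.1 z hz) e0.
by exists del => // y hy _; exact: h.
Qed.

Lemma boundary_approach_sym (R : realType) (n : nat) (phi psi : ('I_n.+1 -> R[i]) -> 'I_n.+1 -> R[i])
    zeta eta u p m t eps (z : nat -> 'I_n.+1 -> R[i]) :
  boundary_approach phi psi zeta eta u p m t eps z ->
  boundary_approach psi phi zeta eta u p m t eps z.
Proof.
case=> h1 h2 h3 h4 h5 h6 h7 h8 h9; split => //.
by rewrite -oppr0; apply: eq_ctends (ctendsN h9) => k; rewrite opprB.
Qed.

Theorem theorem4 (R : realType) (N : nat) (H : fspace R)
    (A1 : 'M[R[i]]_N) (B1 C1 : 'I_N -> R[i]) (d1 : R[i])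
    (A2 : 'M[R[i]]_N) (B2 C2 : 'I_N -> R[i]) (d2 : R[i]) :
  (1 < N)%N -> admissible H ->
  lf_selfmap A1 B1 C1 d1 -> lf_selfmap A2 B2 C2 d2 ->
  compact_op H (fun f z => Cop (lfmap A1 B1 C1 d1) f z - Cop (lfmap A2 B2 C2 d2) f z) ->
  (forall z, inball z -> lfmap A1 B1 C1 d1 z = lfmap A2 B2 C2 d2 z) \/
  ((supnorm (lfmap A1 B1 C1 d1) < 1%:E)%E /\ (supnorm (lfmap A2 B2 C2 d2) < 1%:E)%E).
Proof.
case: N A1 B1 C1 A2 B2 C2 => [//|n] A1 B1 C1 A2 B2 C2 n_gt0 admH hs1 hs2 cpt.
have s_gt0 := kernel_exponent_gt0 n admH.
(* Already [m0] exceeds s + 1, so every [m >= m0] is admissible, in particular two consecutive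
   ones. *)
pose m0 := (Num.truncn (kernel_exponent n H + 1)).+1.
have hm m : (m0 <= m)%N -> kernel_exponent n H + 1 < (2 * m)%:R.
  move=> h; have /truncn_itv/andP[_] : 0 <= kernel_exponent n H + 1 by rewrite addr_ge0 ?(ltW s_gt0).
  move=> h'; apply: lt_le_trans h' _; rewrite ler_nat; apply: leq_trans h _.
  by rewrite leq_pmull.
have b1 := hs1.2; have b2 := hs2.2.
have approach zeta eta u p m : vnorm zeta = 1 -> vnorm eta = 1 ->
    cre (inner u zeta) = 0 -> cre (inner p eta) = 0 -> (m0 <= m)%N ->
    exists t eps (z : nat -> 'I_n.+1 -> R[i]),
      boundary_approach (lfmap A1 B1 C1 d1) (lfmap A2 B2 C2 d2) zeta eta u p m t eps z.
  move=> z1 e1 hu hp /hm h.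
  apply: (boundary_approach_exists n_gt0 admH _ b1 _ b2 cpt z1 e1 hu hp h);
    exact: lf_selfmap_continuous.
have [lt1|[zeta [eta [D [c [z1 e1 jet]]]]]] := lf_boundary_point hs1; last first.
  have [eta' [D' [c' jet']]] := lf_selfmap_jet hs2 z1.
  by left; exact: (boundary_rigidity (m0 := m0) isT b1 b2 approach z1 e1 jet jet').
(* Contact of the second map with the sphere is treated with the roles of the two maps exchanged. *)
have [lt2|[zeta [eta [D [c [z1 e1 jet]]]]]] := lf_boundary_point hs2; first by right.
have [eta' [D' [c' jet']]] := lf_selfmap_jet hs1 z1.
left=> z hz; apply/esym; move: z hz.
apply: (boundary_rigidity (m0 := m0) isT b2 b1 _ z1 e1 jet jet') => zeta' eta1 u p m h1 h2 h3 h4 h5.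
have [t [eps [z ba]]] := approach _ _ _ _ _ h1 h2 h3 h4 h5.
by exists t, eps, z; exact: boundary_approach_sym.
Qed.
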